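(* Let $1\leq n\leq N-1$ and let $f:\mathbb{R}^N\rightarrow\mathbb{R}^N$ be quasiconformal. Suppose that $$\sup_{x\in B^n(x_0,1)}\int_{0}^{1} \widetilde{H}_{f}(B^N(x,r))^{2}\, \frac{dr}{r} <\infty \quad \text{for all } x_0\in\mathbb{R}^n.$$ Then the set $f(\mathbb{R}^{n})$ is locally bi-Lipschitz equivalent to subsets of $\mathbb{R}^n$ near $f(x_0)$ for each $x_0\in\mathbb{R}^n$, with local bi-Lipschitz constant depending only on $n$, $N$, and the quantity $A(x_0):=\sup_{x\in B^n(x_0,1)}\int_{0}^{1} \widetilde{H}_{f}(B^N(x,r))^{2}\, \frac{dr}{r}$; that is, for each $x_0\in\mathbb{R}^n$ there exist $\rho>0$, $c>0$, a constant $L=L(n,N,A(x_0))$, and a map $h:f(\mathbb{R}^n)\cap B^N(f(x_0),\rho)\to\mathbb{R}^n$ such that $c|p-q|\le|h(p)-h(q)|\le Lc|p-q|$ for all $p,q\in f(\mathbb{R}^n)\cap B^N(f(x_0),\rho)$. Thus, $f(\mathbb{R}^n)$ is $n$-rectifiable and the restriction of $\mathcal{H}^{n}$ to $f(\mathbb{R}^n)$ is locally finite.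
   Context: $\mathbb{R}^n$ is identified with the subspace $\mathbb{R}^n\times\{0\}^{N-n}$ of $\mathbb{R}^N$. $B^n(x,r)$ denotes the closed ball in $\mathbb{R}^n$ and $B^N(x,r)$ the closed ball in $\mathbb{R}^N$. For $X\subset\mathbb{R}^N$ and a map $f$ into $\mathbb{R}^N$ whose domain contains $X$, the weak quasisymmetry constant $H_f(X)\in[1,\infty]$ is the least constant such that for all $x,y,a\in X$, $|x-a|\leq|y-a|$ implies $|f(x)-f(a)|\leq H_f(X)|f(y)-f(a)|$. Set $\widetilde H_f(X):=H_f(X)-1$. A quasiconformal map $f:\Omega\to\mathbb{R}^N$ on a domain $\Omega\subset\mathbb{R}^N$ ($N\ge2$) is a topological embedding (homeomorphism onto its image) with $f\in W^{1,N}_{\mathrm{loc}}(\Omega)$ and $$K_f(\Omega):=\operatorname*{ess\,sup}_{x\in\Omega}\max\left\{\frac{\lambda_N^N}{\lambda_1\cdots\lambda_N},\frac{\lambda_1\cdots\lambda_N}{\lambda_1^N}\right\}<\infty,$$ where $\lambda_1\le\dots\le\lambda_N$ are the singular values of $Df(x)$. Quasiconformal maps $\mathbb{R}^N\to\mathbb{R}^N$ are homeomorphisms of $\mathbb{R}^N$. $\mathcal{H}^n$ is $n$-dimensional Hausdorff measure on $\mathbb{R}^N$, normalized so that $\mathcal{H}^n(B^n(0,1))$ equals the Lebesgue measure of $B^n(0,1)$. A set $X\subset\mathbb{R}^N$ is $n$-rectifiable if there exist countably many Lipschitz maps $f_i:[0,1]^n\to\mathbb{R}^N$ with $\mathcal{H}^n(X\setminus\bigcup_i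 f_i([0,1]^n))=0$. *)

(* Defs.v *)
From HB Require Import structures.
From mathcomp Require Import all_boot all_order all_algebra.
From mathcomp Require Import all_classical all_reals all_analysis ess_sup_inf.

Set Implicit Arguments.
Unset Strict Implicit.
Unset Printing Implicit Defensive.

Import Order.TTheory GRing.Theory Num.Theory.
Import numFieldNormedType.Exports.

Local Open Scope classical_set_scope.
Local Open Scope ring_scope.

Section euclidean.
Context {R : realType}.

(* The library norm on ['rV[R]_N] is the sup norm; it induces the same
   topology, but metric notions need the Euclidean norm. *)
Definition enorm {N : nat} (x : 'rV[R]_N) : R :=
  Num.sqrt (\sum_i x 0 i ^+ 2).

Definition eball {N : nat} (x : 'rV[R]_N) (r : R) : set 'rV[R]_N :=
  [set y | enorm (y - x) <= r].

(* For [n <= N], the identification of R^n with R^n x {0}^(N-n). *)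
Definition embed {n N : nat} (x : 'rV[R]_n) : 'rV[R]_N :=
  \row_(i < N) if insub (nat_of_ord i) is Some j then x 0 j else 0.

Definition wqs_const {N : nat} (f : 'rV[R]_N -> 'rV[R]_N)
    (X : set 'rV[R]_N) : \bar R :=
  ereal_inf [set H%:E | H in [set H : R | 1 <= H /\
    forall x y a, X x -> X y -> X a ->
      enorm (x - a) <= enorm (y - a) ->
      enorm (f x - f a) <= H * enorm (f y - f a)]].

Definition wqs_excess {N : nat} (f : 'rV[R]_N -> 'rV[R]_N)
    (X : set 'rV[R]_N) : \bar R := (wqs_const f X - 1%:E)%E.

Definition dini_sup {n N : nat} (f : 'rV[R]_N -> 'rV[R]_N)
    (x0 : 'rV[R]_n) : \bar R :=
  ereal_sup [set (\int[lebesgue_measure]_(r in `]0%R, 1%R[)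
      (wqs_excess f (eball (embed x) r) ^+ 2 * (r^-1)%:E))%E
    | x in eball x0 1].

End euclidean.

(* The library's sigma-finite instance on products is shadowed by the one for
   finite measures. *)
Lemma product_sigma_finite d1 d2 (T1 : measurableType d1)
    (T2 : measurableType d2) (R : realType)
    (m1 : {sigma_finite_measure set T1 -> \bar R})
    (m2 : {sigma_finite_measure set T2 -> \bar R}) :
  sigma_finite setT (m1 \x m2)%E.
Proof.
have /sigma_finiteP[F [FT ndF Foo]] := sigma_finiteT m1.
have /sigma_finiteP[G [GT ndG Goo]] := sigma_finiteT m2.
exists (fun k => F k `*` G k).
  rewrite -setXTT FT GT predeqE => -[x y]; split.
    move=> [/= [k _ Fkx] [l _ Gly]]; exists (maxn k l) => //; split.
    - by move: x Fkx; exact/subsetPset/ndF/leq_maxl.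
    - by move: y Gly; exact/subsetPset/ndG/leq_maxr.
  by move=> [k _ []/= ? ?]; split; exists k.
move=> k; have [? ?] := Foo k; have [? ?] := Goo k.
split; first exact: measurableX.
by rewrite product_measure1E// lte_mul_pinfty// ge0_fin_numE.
Qed.

(* Lebesgue measure on R^n: the iterated product of the one-dimensional
   Lebesgue measure on tuples, transported to row vectors. *)
Section lebesgue_tuple_step.
Context {R : realType} {n : nat}.
Variable mu :
  {sigma_finite_measure set (n.-tuple (measurableTypeR R)) -> \bar R}.

Definition tcons (p : measurableTypeR R * n.-tuple (measurableTypeR R)) :
  n.+1.-tuple (measurableTypeR R) := [tuple of p.1 :: p.2].

Lemma measurable_tcons : measurable_fun setT tcons.
Proof. exact: measurable_cons. Qed.

Definition lebesgue_tuple_step :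
    set (n.+1.-tuple (measurableTypeR R)) -> \bar R :=
  pushforward (@lebesgue_measure R \x mu)%E tcons.

Let step0 : lebesgue_tuple_step set0 = 0%E.
Proof. by rewrite /lebesgue_tuple_step /pushforward preimage_set0 measure0. Qed.

Let step_ge0 A : (0 <= lebesgue_tuple_step A)%E.
Proof. by rewrite /lebesgue_tuple_step /pushforward; exact: measure_ge0. Qed.

Let step_sigma_additive : semi_sigma_additive lebesgue_tuple_step.
Proof.
have mcons := measurable_tcons.
exact: (@measure_semi_sigma_additive _ _ _
  (pushforward (@lebesgue_measure R \x mu)%E tcons)).
Qed.

HB.instance Definition _ := isMeasure.Build _ _ _ lebesgue_tuple_step
  step0 step_ge0 step_sigma_additive.

Let step_sigma_finite : sigma_finite setT lebesgue_tuple_step.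
Proof.
have [F FT F_fin] := product_sigma_finite (@lebesgue_measure R) mu.
pose uncons (t : n.+1.-tuple (measurableTypeR R)) :
    measurableTypeR R * n.-tuple (measurableTypeR R) :=
  (tnth t ord0, [tuple of behead t]).
have consK : cancel tcons uncons.
  by move=> [x t]; congr pair; apply/val_inj.
have munc : measurable_fun setT uncons.
  apply/measurable_fun_pairP; split.
    exact: (@measurable_tnth _ (measurableTypeR R) n.+1 ord0).
  exact: measurable_behead.
exists (fun k => uncons @^-1` F k).
  by rewrite -preimage_bigcup -FT preimage_setT.
move=> k; have [mF Foo] := F_fin k; split.
  by rewrite -[X in measurable X]setTI; exact: munc.
rewrite /lebesgue_tuple_step /pushforward -comp_preimage.
by rewrite (_ : uncons \o tcons = id) ?preimage_id//; apply/funext => p /=.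
Qed.

HB.instance Definition _ := Measure_isSigmaFinite.Build _ _ _
  lebesgue_tuple_step step_sigma_finite.

End lebesgue_tuple_step.

Fixpoint lebesgue_tuple (R : realType) (n : nat) :
    {sigma_finite_measure set (n.-tuple (measurableTypeR R)) -> \bar R} :=
  if n is m.+1 then lebesgue_tuple_step (lebesgue_tuple R m)
  else dirac [tuple].

Definition tuple_of_row {R : realType} {N : nat} (x : 'rV[R]_N) :
  N.-tuple (measurableTypeR R) := [tuple x 0 i | i < N].

(* ['rV[R]_N] with the sigma-algebra generated by the coordinates, i.e. the
   Borel sets. *)
Definition borel_row (R : realType) (N : nat) :=
  g_sigma_algebra_preimageType (@tuple_of_row R N).

Definition row_of_tuple {R : realType} {N : nat}
  (t : N.-tuple (measurableTypeR R)) : borel_row R N := \row_i tnth t i.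

Section lebesgue_row.
Context {R : realType} {N : nat}.

Lemma row_of_tupleK : cancel (@row_of_tuple R N) tuple_of_row.
Proof. by move=> t; apply: eq_from_tnth => i; rewrite tnth_mktuple mxE. Qed.

Lemma measurable_row_of_tuple :
  measurable_fun setT (@row_of_tuple R N).
Proof.
move=> _ _ [B mB <-]; rewrite !setTI -comp_preimage.
by rewrite (_ : _ \o _ = id) ?preimage_id//; apply/funext/row_of_tupleK.
Qed.

Definition lebesgue_row : set (borel_row R N) -> \bar R :=
  pushforward (lebesgue_tuple R N) row_of_tuple.

Let lebesgue_row0 : lebesgue_row set0 = 0%E.
Proof. by rewrite /lebesgue_row /pushforward preimage_set0 measure0. Qed.

Let lebesgue_row_ge0 A : (0 <= lebesgue_row A)%E.
Proof. by rewrite /lebesgue_row /pushforward; exact: measure_ge0. Qed.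

Let lebesgue_row_sigma_additive : semi_sigma_additive lebesgue_row.
Proof.
have mrow := measurable_row_of_tuple.
exact: (@measure_semi_sigma_additive _ _ _
  (pushforward (lebesgue_tuple R N) row_of_tuple)).
Qed.

HB.instance Definition _ := isMeasure.Build _ _ _ lebesgue_row
  lebesgue_row0 lebesgue_row_ge0 lebesgue_row_sigma_additive.

End lebesgue_row.

Section quasiconformal.
Context {R : realType} {N : nat}.

Definition partial (i : 'I_N) (phi : 'rV[R]_N -> R) : 'rV[R]_N -> R :=
  fun x => 'D_(delta_mx 0 i) phi x.

Definition smooth (phi : 'rV[R]_N -> R) : Prop :=
  forall s : seq 'I_N, let psi := foldr partial phi s in
    continuous psi /\ forall i x, derivable psi x (delta_mx 0 i).

Definition test_function (Omega : set 'rV[R]_N) (phi : 'rV[R]_N -> R) : Prop :=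
  let supp := closure [set x | phi x != 0] in
  [/\ smooth phi, compact supp & supp `<=` Omega].

Definition locally_Lp (p : nat) (Omega : set 'rV[R]_N) (u : 'rV[R]_N -> R)
    : Prop :=
  measurable_fun (Omega : set (borel_row R N)) (u : _ -> measurableTypeR R) /\
  forall K : set 'rV[R]_N, compact K -> K `<=` Omega ->
    (\int[@lebesgue_row R N]_(x in K) (`|u x| ^+ p)%:E < +oo)%E.

Definition weak_partial (Omega : set 'rV[R]_N) (i : 'I_N)
    (u v : 'rV[R]_N -> R) : Prop :=
  forall phi, test_function Omega phi ->
    (\int[@lebesgue_row R N]_(x in Omega) (u x * partial i phi x)%:E =
     - \int[@lebesgue_row R N]_(x in Omega) (v x * phi x)%:E)%E.

(* [f] is in W^{1,p}_loc(Omega; R^N) with weak derivative [Df]; the entry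
   (i, j) of [Df x] is the j-th partial derivative of the i-th component. *)
Definition sobolev_loc (p : nat) (Omega : set 'rV[R]_N)
    (f : 'rV[R]_N -> 'rV[R]_N) (Df : 'rV[R]_N -> 'M[R]_N) : Prop :=
  (forall i, locally_Lp p Omega (fun x => f x 0 i)) /\
  forall i j, locally_Lp p Omega (fun x => Df x i j) /\
    weak_partial Omega j (fun x => f x 0 i) (fun x => Df x i j).

Definition is_singular_values (A : 'M[R]_N) (s : seq R) : Prop :=
  [/\ sorted <=%R s, all (>= 0) s &
      char_poly (A^T *m A) = \prod_(l <- s) ('X - (l ^+ 2)%:P)].

(* By the spectral theorem there is exactly one such sequence, so the default
   value is never used. *)
Definition singular_values (A : 'M[R]_N) : seq R :=
  xget [::] [set s | is_singular_values A s].

(* The quotients are taken in [\bar R], where [a / 0 = +oo] for [a > 0] and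
   [0 / 0 = 0]: a singular nonzero matrix has infinite dilatation, and a zero
   derivative imposes no condition, as in the inequality |Df|^N <= K |det Df|. *)
Definition dilatation (A : 'M[R]_N) : \bar R :=
  let s := singular_values A in
  let lmin := head 0 s in
  let lmax := last 0 s in
  let jac := \prod_(l <- s) l in
  maxe ((lmax ^+ N)%:E / jac%:E)%E (jac%:E / (lmin ^+ N)%:E)%E.

Definition ess_sup_on (Omega : set 'rV[R]_N) (g : 'rV[R]_N -> \bar R)
    : \bar R :=
  ess_sup (@lebesgue_row R N) (patch (fun=> -oo%E) Omega g).

Definition embedding (Omega : set 'rV[R]_N) (f : 'rV[R]_N -> 'rV[R]_N)
    : Prop :=
  {within Omega, continuous f} /\
  exists g : 'rV[R]_N -> 'rV[R]_N,
    (forall x, Omega x -> g (f x) = x) /\ {within f @` Omega, continuous g}.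

Definition domain (Omega : set 'rV[R]_N) : Prop :=
  [/\ open Omega, connected Omega & Omega !=set0].

Definition quasiconformal (Omega : set 'rV[R]_N) (f : 'rV[R]_N -> 'rV[R]_N)
    : Prop :=
  [/\ domain Omega, embedding Omega f &
      exists Df, sobolev_loc N Omega f Df /\
        (ess_sup_on Omega (fun x => dilatation (Df x)) < +oo)%E].

(* Quasiconformal maps of the whole space onto itself: for N >= 2 a
   quasiconformal embedding of R^N in R^N is a homeomorphism of R^N. *)
Definition quasiconformal_homeo (f : 'rV[R]_N -> 'rV[R]_N) : Prop :=
  quasiconformal setT f /\ range f = setT.

End quasiconformal.

Section hausdorff.
Context {R : realType}.

Definition diam {N : nat} (U : set 'rV[R]_N) : \bar R :=
  ereal_sup (0%E |` [set (enorm (p.1 - p.2))%:E | p in U `*` U]).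

Definition hausdorff_content {N : nat} (n : nat) (delta : R)
    (A : set 'rV[R]_N) : \bar R :=
  ereal_inf [set (\sum_(k <oo) diam (U k) ^+ n)%E |
    U in [set U : nat -> set 'rV[R]_N |
      A `<=` \bigcup_k U k /\ forall k, (diam (U k) <= delta%:E)%E]].

Definition hausdorff_unnormalized {N : nat} (n : nat) (A : set 'rV[R]_N)
    : \bar R :=
  ereal_sup [set hausdorff_content n delta A | delta in [set d : R | 0 < d]].

(* Normalized so that the unit ball of R^n gets its Lebesgue measure. *)
Definition hausdorff {N : nat} (n : nat) (A : set 'rV[R]_N) : \bar R :=
  (lebesgue_row (eball (0 : 'rV[R]_n) 1%R) /
     hausdorff_unnormalized n (embed @` eball (0 : 'rV[R]_n) 1%R : set 'rV[R]_N)
   * hausdorff_unnormalized n A)%E.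

Definition unit_cube (n : nat) : set 'rV[R]_n :=
  [set x | forall i, 0 <= x 0 i <= 1].

Definition rectifiable {N : nat} (n : nat) (X : set 'rV[R]_N) : Prop :=
  exists F : nat -> 'rV[R]_n -> 'rV[R]_N,
    (forall k, exists M : R, forall x y, unit_cube x -> unit_cube y ->
       enorm (F k x - F k y) <= M * enorm (x - y)) /\
    hausdorff n (X `\` \bigcup_k (F k @` @unit_cube n)) = 0%E.

Definition hausdorff_locally_finite {N : nat} (n : nat) (X : set 'rV[R]_N)
    : Prop :=
  forall p, exists2 r : R, 0 < r & (hausdorff n (X `&` eball p r) < +oo)%E.

End hausdorff.

(* Main.v *)
Require Import Defs.
From HB Require Import structures.
From mathcomp Require Import all_boot all_order all_algebra.
From mathcomp Require Import all_classical all_reals all_analysis.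
From mathcomp Require Import measurable_realfun.
From mathcomp Require Import ring lra zify.

(** Let the weak quasisymmetry constant of [f] be at most [1 + e] on a ball. If
    [y] is equidistant from [a] and [b], then [f y] is almost equidistant from
    [f a] and [f b], with an error linear in [e]: [f] sends bisectors near
    bisectors ([bisector_dot]). Apply this to the [N] diameters parallel to the
    axes of a ball of radius [r] centered in the [n]-plane. Their images are
    almost orthogonal to each other, hence almost a basis of [R^N]
    ([almost_orthonormal_parseval]); the last [N - n] of them are almost normal
    to the image of the plane. So at the point [x] and the scale [r] this image
    is within [e * r] of an [n]-plane, in relative units, and the planes at
    neighbouring points and scales make angles of order [e]
    ([dot_normal_le], [dot_normal_normal_le]). It is here that balls of [R^N]
    are needed. The same argument shows that midpoints are sent near midpoints,
    so that distances grow geometrically with the scale ([stretch_double_ge]).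

    The map [f] itself may fail to be bi-Lipschitz on the plane, because the
    product of the [1 + e_j] over the dyadic scales [j] can diverge when the sum
    of the [e_j ^ 2] converges. Its image is flattened instead. Fix a fine scale
    and send [f x] to its average projection, by a Lipschitz partition of unity,
    to the planes of that scale; then project the result to the planes of the
    next coarser scale, and so on ([descend]). The points stay near [f x]
    ([descend_close]). If the difference [w] of two points has slope of order
    [e] with respect to the planes, then the projections move both points by
    vectors that are normal to the planes, and whose difference has size of order
    [e * |w|]; hence [|w| ^ 2] changes by a factor [1 + O(e ^ 2)]
    ([average_projection_dist]). Moreover the new difference has again slope of
    order [e], with a constant that does not depend on the previous slope
    ([average_projection_tangent]). So the distortion over all scales is at most
    the exponential of a multiple of the sum of the [e_j ^ 2]
    ([descend_bilipschitz]), which the integral controls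
    ([dyadic_sum_le_integral]). At the coarsest scale all differences are almost
    tangent to a single plane, whose coordinates give a map to [R^n]. Letting
    the initial scale tend to zero along an ultrafilter gives the chart
    ([local_flattening]).

    The smallness of [e] that absorbs all the constants holds on a small ball
    around [x0], because the integral at [x0] is finite and the excess is
    monotone in the radius ([dini_sup_small]). Finally the inverse of a chart
    extends to a Lipschitz map on a cube ([lipschitz_cube]): this gives
    rectifiability, by countably many rational balls, and local finiteness of the
    Hausdorff measure, by subdividing the cube. *)

Set Implicit Arguments.
Unset Strict Implicit.
Unset Printing Implicit Defensive.
Import Order.TTheory GRing.Theory Num.Theory.
Import numFieldNormedType.Exports.
Local Open Scope classical_set_scope.
Local Open Scope ring_scope.

(** * Euclidean geometry of row vectors *)

Lemma sqr_le_norm {R : realType} (a b : R) : `|a| <= b -> a ^+ 2 <= b ^+ 2.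
Proof. by rewrite ler_norml => /andP[]; nra. Qed.

Section Euclidean.
Context {R : realType} {N : nat}.
Implicit Types (u v w x y : 'rV[R]_N) (a b : R).

Definition dot u v : R := \sum_i u 0 i * v 0 i.

Lemma dotC u v : dot u v = dot v u.
Proof. by apply: eq_bigr => i _; rewrite mulrC. Qed.

Lemma dotDl u v w : dot (u + v) w = dot u w + dot v w.
Proof. by rewrite -big_split; apply: eq_bigr => i _; rewrite mxE mulrDl. Qed.

Lemma dotZl a u v : dot (a *: u) v = a * dot u v.
Proof. by rewrite big_distrr; apply: eq_bigr => i _; rewrite mxE -mulrA. Qed.

Lemma dotNl u v : dot (- u) v = - dot u v.
Proof. by rewrite -scaleN1r dotZl mulN1r. Qed.

Lemma dotBl u v w : dot (u - v) w = dot u w - dot v w.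
Proof. by rewrite dotDl dotNl. Qed.

Lemma dot0l v : dot 0 v = 0.
Proof. by rewrite -(scale0r 0) dotZl mul0r. Qed.

Lemma dotDr u v w : dot u (v + w) = dot u v + dot u w.
Proof. by rewrite dotC dotDl !(dotC u). Qed.

Lemma dotBr u v w : dot u (v - w) = dot u v - dot u w.
Proof. by rewrite dotC dotBl !(dotC u). Qed.

Lemma dotZr a u v : dot u (a *: v) = a * dot u v.
Proof. by rewrite dotC dotZl dotC. Qed.

Lemma dot_sumr (I : Type) (r : seq I) (P : pred I) (F : I -> 'rV[R]_N) u :
  dot u (\sum_(i <- r | P i) F i) = \sum_(i <- r | P i) dot u (F i).
Proof.
elim/big_rec2: _ => [|i x y _ <-]; first by rewrite dotC dot0l.
by rewrite dotDr.
Qed.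

Lemma dot_suml (I : Type) (r : seq I) (P : pred I) (F : I -> 'rV[R]_N) u :
  dot (\sum_(i <- r | P i) F i) u = \sum_(i <- r | P i) dot (F i) u.
Proof. by rewrite dotC dot_sumr; apply: eq_bigr => i _; rewrite dotC. Qed.

Lemma dot_delta u k : dot u (delta_mx 0 k) = u 0 k.
Proof.
rewrite /dot (bigD1 k)//= mxE !eqxx mulr1 big1 ?addr0// => i ik.
by rewrite mxE (negPf ik) andbF mulr0.
Qed.

Lemma enorm_ge0 u : 0 <= enorm u.
Proof. exact: sqrtr_ge0. Qed.

Lemma enormE u : enorm u ^+ 2 = dot u u.
Proof.
rewrite /enorm sqr_sqrtr; first by apply: eq_bigr => i _; rewrite expr2.
by apply: sumr_ge0 => i _; rewrite sqr_ge0.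
Qed.

Lemma dot_eq0 u : dot u u = 0 -> u = 0.
Proof.
move=> /eqP; rewrite psumr_eq0 => [|i _]; last by rewrite -expr2 sqr_ge0.
move=> /allP u0; apply/rowP => i; rewrite mxE; apply/eqP.
by have := u0 i (mem_index_enum i); rewrite implyTb mulf_eq0 orbb.
Qed.

Lemma enorm0_eq0 u : enorm u = 0 -> u = 0.
Proof. by move=> u0; apply: dot_eq0; rewrite -enormE u0 expr0n. Qed.

Lemma enorm0 : enorm (0 : 'rV[R]_N) = 0.
Proof. by apply/eqP; rewrite -sqrf_eq0 enormE dot0l. Qed.

Lemma enorm_gt0 u : (0 < enorm u) = (u != 0).
Proof.
rewrite lt_def enorm_ge0 andbT; congr (~~ _).
by apply/eqP/eqP => [/enorm0_eq0//|->]; rewrite enorm0.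
Qed.

Lemma enormZ a u : enorm (a *: u) = `|a| * enorm u.
Proof.
apply/eqP; rewrite -(@eqrXn2 _ 2)//; last 2 first.
- exact: enorm_ge0.
- by rewrite mulr_ge0// enorm_ge0.
by rewrite exprMn !enormE dotZl dotZr mulrA -expr2 real_normK// num_real.
Qed.

Lemma enormN u : enorm (- u) = enorm u.
Proof. by rewrite -scaleN1r enormZ normrN1 mul1r. Qed.

Lemma enormB u v : enorm (u - v) = enorm (v - u).
Proof. by rewrite -enormN opprB. Qed.

Lemma dot_enorm_sqrD u v :
  enorm (u + v) ^+ 2 = enorm u ^+ 2 + 2 * dot u v + enorm v ^+ 2.
Proof. by rewrite !enormE dotDl !dotDr (dotC v u); ring. Qed.

Lemma dot_enorm_sqrB u v :
  enorm (u - v) ^+ 2 = enorm u ^+ 2 - 2 * dot u v + enorm v ^+ 2.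
Proof. by rewrite !enormE dotBl !dotBr (dotC v u); ring. Qed.

Lemma norm_dot_le u v : `|dot u v| <= enorm u * enorm v.
Proof.
have [->|u0] := eqVneq u 0; first by rewrite dot0l normr0 enorm0 mul0r.
have [->|v0] := eqVneq v 0; first by rewrite dotC dot0l normr0 enorm0 mulr0.
rewrite -enorm_gt0 in u0; rewrite -enorm_gt0 in v0.
have p : 0 < enorm u * enorm v by rewrite mulr_gt0.
have key w1 w2 : 0 < enorm w1 * enorm w2 -> dot w1 w2 <= enorm w1 * enorm w2.
  move=> p12; have := sqr_ge0 (enorm (enorm w2 *: w1 - enorm w1 *: w2)).
  rewrite dot_enorm_sqrB !enormZ dotZl dotZr !ger0_norm ?enorm_ge0//.
  by nra.
rewrite ler_norml key// andbT lerNl -dotNl -(enormN u).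
by apply: key; rewrite enormN.
Qed.

Lemma dot_le u v : dot u v <= enorm u * enorm v.
Proof. exact: le_trans (ler_norm _) (norm_dot_le _ _). Qed.

Lemma ler_enormD u v : enorm (u + v) <= enorm u + enorm v.
Proof.
rewrite -(@ler_pXn2r _ 2)// ?nnegrE ?addr_ge0 ?enorm_ge0//.
by rewrite dot_enorm_sqrD; have := dot_le u v; nra.
Qed.

Lemma ler_enorm_dist u v w : enorm (u - w) <= enorm (u - v) + enorm (v - w).
Proof. by rewrite -{1}(subrK v u) -addrA ler_enormD. Qed.

Lemma ler_enorm_sum (I : Type) (r : seq I) (P : pred I) (F : I -> 'rV[R]_N) :
  enorm (\sum_(i <- r | P i) F i) <= \sum_(i <- r | P i) enorm (F i).
Proof.
elim/big_rec2: _ => [|i x y _ xy]; first by rewrite enorm0.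
by apply: le_trans (ler_enormD _ _) _; rewrite lerD2l.
Qed.

Lemma enorm_delta k : enorm (delta_mx 0 k : 'rV[R]_N) = 1.
Proof.
apply/eqP; rewrite -(@eqrXn2 _ 2)// ?enorm_ge0// enormE dot_delta.
by rewrite mxE !eqxx expr1n.
Qed.

Lemma ler_coord_enorm u k : `|u 0 k| <= enorm u.
Proof.
rewrite -dot_delta; apply: le_trans (norm_dot_le _ _) _.
by rewrite enorm_delta mulr1.
Qed.

Lemma enorm_le_coord u b : 0 <= b -> (forall k, `|u 0 k| <= b) ->
  enorm u <= N%:R * b.
Proof.
move=> b0 ub; rewrite -(@ler_pXn2r _ 2)// ?nnegrE ?enorm_ge0 ?mulr_ge0//.
rewrite enormE; apply: (@le_trans _ _ (\sum_(i < N) b ^+ 2)).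
  by apply: ler_sum => i _; rewrite -expr2; exact: sqr_le_norm.
rewrite sumr_const card_ord -[_ *+ N]mulr_natl exprMn ler_wpM2r ?sqr_ge0//.
by rewrite expr2 -natrM ler_nat; case: (N) => // m; rewrite leq_pmulr.
Qed.

End Euclidean.

(** * Almost orthonormal frames *)

Section Frames.
Context {R : realType} {N : nat}.
Implicit Types (v w : 'rV[R]_N) (u : 'I_N -> 'rV[R]_N) (eta : R).
Implicit Types (K : pred 'I_N).

Definition almost_orthonormal u eta :=
  (forall k, enorm (u k) = 1) /\
  (forall k l, k != l -> `|dot (u k) (u l)| <= eta).

Lemma mxtrace_sqr_sym (M : 'M[R]_N) : M^T = M ->
  \tr (M *m M) = \sum_i \sum_j M i j ^+ 2.
Proof.
move=> MT; apply: eq_bigr => i _; rewrite mxE; apply: eq_bigr => j _.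
by rewrite -{2}MT mxE expr2.
Qed.

Lemma enorm_mulmx v (M : 'M[R]_N) :
  enorm (v *m M) ^+ 2 <= enorm v ^+ 2 * \sum_i \sum_j M i j ^+ 2.
Proof.
rewrite enormE exchange_big big_distrr /=; apply: ler_sum => j _.
have -> : (v *m M) 0 j = dot v (col j M)^T.
  by rewrite mxE; apply: eq_bigr => i _; rewrite !mxE.
have -> : \sum_i M i j ^+ 2 = enorm (col j M)^T ^+ 2.
  by rewrite enormE; apply: eq_bigr => i _; rewrite !mxE expr2.
by rewrite -expr2 -exprMn; apply: sqr_le_norm; exact: norm_dot_le.
Qed.

(** As many almost orthonormal vectors as the dimension are an almost
    orthonormal basis: for a square matrix [D], the traces of
    [(D^T D - 1)^2] and [(D D^T - 1)^2] agree, so that [D^T D] is as close to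
    the identity as the Gram matrix [D D^T] is. *)
Lemma almost_orthonormal_parseval u eta v w : 0 <= eta ->
  almost_orthonormal u eta ->
  `|dot v w - \sum_k dot v (u k) * dot (u k) w|
    <= N%:R * eta * enorm v * enorm w.
Proof.
move=> eta0 [u1 uo]; pose D : 'M[R]_N := \matrix_(k, i) u k 0 i.
pose M := 1%:M - D^T *m D; pose G := 1%:M - D *m D^T.
have MT : M^T = M by rewrite linearB /= trmx1 trmx_mul trmxK.
have GT : G^T = G by rewrite linearB /= trmx1 trmx_mul trmxK.
have MG : \tr (M *m M) = \tr (G *m G).
  rewrite /M /G !mulmxBl !mul1mx !mulmxBr !mulmx1 !linearB /=.
  have -> : \tr (D^T *m D *m (D^T *m D)) = \tr (D *m D^T *m (D *m D^T)).
    by rewrite -mulmxA mxtrace_mulC !mulmxA.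
  by rewrite (mxtrace_mulC D^T).
have DD k l : (D *m D^T) k l = dot (u k) (u l).
  by rewrite mxE; apply: eq_bigr => i _; rewrite !mxE.
have Gle k l : G k l ^+ 2 <= eta ^+ 2.
  rewrite /G mxE [X in X + _]mxE [X in _ + X]mxE DD.
  have [->|kl] := eqVneq k l.
    by rewrite -enormE u1 expr1n mulr1n subrr expr0n sqr_ge0.
  by rewrite mulr0n sub0r sqrrN; apply: sqr_le_norm; exact: uo.
have Mle : \sum_i \sum_j M i j ^+ 2 <= (N%:R * eta) ^+ 2.
  rewrite -mxtrace_sqr_sym// MG mxtrace_sqr_sym//.
  apply: (@le_trans _ _ (\sum_(i < N) \sum_(j < N) eta ^+ 2)).
    by apply: ler_sum => i _; apply: ler_sum => j _.
  rewrite !sumr_const card_ord -mulrnA -[_ *+ _]mulr_natl natrM exprMn.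
  by rewrite expr2.
have -> : dot v w - \sum_k dot v (u k) * dot (u k) w = dot (v *m M) w.
  rewrite /M mulmxBr mulmx1 dotBl; congr (_ - _).
  rewrite mulmxA {2}/dot.
  under [RHS]eq_bigr => i _ do rewrite mxE big_distrl /=.
  rewrite exchange_big; apply: eq_bigr => k _ /=.
  have -> : (v *m D^T) 0 k = dot v (u k).
    by rewrite mxE; apply: eq_bigr => i _; rewrite !mxE.
  set c := dot v (u k).
  rewrite /dot big_distrr; apply: eq_bigr => i _.
  by rewrite /= mxE mulrA.
apply: le_trans (norm_dot_le _ _) _; rewrite ler_wpM2r ?enorm_ge0//.
rewrite -(@ler_pXn2r _ 2)// ?nnegrE ?mulr_ge0 ?enorm_ge0//.
apply: le_trans (enorm_mulmx _ _) _.
by rewrite exprMn mulrC ler_wpM2r ?sqr_ge0.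
Qed.

Lemma dot_unit_le v w : enorm w = 1 -> `|dot v w| <= enorm v.
Proof. by move=> w1; have := norm_dot_le v w; rewrite w1 mulr1. Qed.

(** A substitute for the orthogonal projection onto the span of the selected
    vectors; it differs from it to first order only in the angles of the frame,
    and it needs no inverse of the Gram matrix. *)
Definition component u (K : pred 'I_N) v : 'rV[R]_N :=
  \sum_(k | K k) dot v (u k) *: u k.

Lemma componentB u K v w :
  component u K (v - w) = component u K v - component u K w.
Proof.
rewrite -sumrB; apply: eq_bigr => k _.
by rewrite dotBl scalerBl.
Qed.

Lemma dot_component u K v w :
  dot w (component u K v) = \sum_(k | K k) dot v (u k) * dot w (u k).
Proof. by rewrite dot_sumr; apply: eq_bigr => k _; rewrite dotZr. Qed.

Lemma sumr_le_card (K : pred 'I_N) (F : 'I_N -> R) (M : R) : 0 <= M ->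
  (forall k, K k -> F k <= M) -> \sum_(k | K k) F k <= N%:R * M.
Proof.
move=> M0 FM; apply: (@le_trans _ _ (\sum_(k < N) M)).
  rewrite big_mkcond; apply: ler_sum => k _.
  by case: ifP => // Kk; apply: FM.
by rewrite sumr_const card_ord -[_ *+ N]mulr_natl.
Qed.

Lemma enorm_component_le u K v (M : R) : 0 <= M ->
  (forall k, enorm (u k) = 1) ->
  (forall k, K k -> `|dot v (u k)| <= M) ->
  enorm (component u K v) <= N%:R * M.
Proof.
move=> M0 u1 vM; apply: le_trans (ler_enorm_sum _ _ _) _.
by apply: sumr_le_card => // k Kk; rewrite enormZ u1 mulr1 vM.
Qed.

(** Exact contraction, in spite of the errors of the frame: with
    [p := component u K v] and [S] the sum of the squares of the coefficients,
    [dot v p = S], while [dot p p] exceeds [S] by at most [N%:R * eta * S]. *)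
Lemma enorm_sub_component u eta K v : 0 <= eta -> N%:R * eta <= 1 ->
  almost_orthonormal u eta -> enorm (v - component u K v) <= enorm v.
Proof.
move=> eta0 eta1 [u1 uo]; set p := component u K v.
pose S := \sum_(k | K k) dot v (u k) ^+ 2.
have S0 : 0 <= S by apply: sumr_ge0 => k _; rewrite sqr_ge0.
have vp : dot v p = S by rewrite dot_component; apply: eq_bigr => k; rewrite expr2.
have pp : dot p p <= S + N%:R * eta * S.
  rewrite {2}/p dot_component.
  have -> : S + N%:R * eta * S =
      \sum_(k | K k) (dot v (u k) ^+ 2 + N%:R * eta * dot v (u k) ^+ 2).
    by rewrite big_split -big_distrr.
  (* by the arithmetic-geometric inequality the off-diagonal terms cost eta times
     half the sum of the two squares *)
  have cross k l : 2 * `|dot v (u k) * dot v (u l)| <=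
      dot v (u k) ^+ 2 + dot v (u l) ^+ 2.
    rewrite normrM -(real_normK (num_real (dot v (u k)))).
    rewrite -(real_normK (num_real (dot v (u l)))).
    by have := sqr_ge0 (`|dot v (u k)| - `|dot v (u l)|); nra.
  have le1 : \sum_(k | K k) dot v (u k) * dot p (u k) <=
     \sum_(k | K k) (dot v (u k) ^+ 2 +
        \sum_(l | K l) eta / 2 * (dot v (u k) ^+ 2 + dot v (u l) ^+ 2)).
    apply: ler_sum => k Kk; rewrite [dot p _]dotC dot_component big_distrr /=.
    rewrite (bigD1 k)//= -enormE u1 expr1n mulr1 -expr2 lerD2l.
    rewrite [leRHS](bigD1 k)//= -[leLHS]add0r lerD//.
      by rewrite mulr_ge0 ?addr_ge0 ?sqr_ge0 ?divr_ge0.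
    apply: ler_sum => l /andP[Kl lk].
    rewrite mulrA; apply: le_trans (ler_norm _) _; rewrite normrM.
    have := cross k l; have := uo k l; rewrite eq_sym => /(_ lk) h1 h2.
    have := normr_ge0 (dot v (u k) * dot v (u l)).
    have := normr_ge0 (dot (u k) (u l)).
    by nra.
  apply: le_trans le1 _; rewrite !big_split /= lerD2l.
  have -> : \sum_(k | K k) \sum_(l | K l)
      eta / 2 * (dot v (u k) ^+ 2 + dot v (u l) ^+ 2) = #|K|%:R * eta * S.
    have inner k : \sum_(l | K l)
        eta / 2 * (dot v (u k) ^+ 2 + dot v (u l) ^+ 2) =
        eta / 2 * (#|K|%:R * dot v (u k) ^+ 2 + S).
      by rewrite -mulr_sumr big_split /= sumr_const mulr_natl.
    under eq_bigr => k _ do rewrite inner.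
    rewrite -mulr_sumr big_split /= -mulr_sumr -/S sumr_const.
    by rewrite -[S *+ _]mulr_natl; field.
  rewrite -mulr_sumr -/S ler_wpM2r// ler_wpM2r// ler_nat.
  by rewrite -[leqRHS](card_ord N) max_card.
rewrite -(@ler_pXn2r _ 2)// ?nnegrE ?enorm_ge0//.
by rewrite dot_enorm_sqrB vp (enormE p); nra.
Qed.

(** If [w] is almost orthogonal to the first [n] vectors of an almost
    orthonormal frame and [v] to the other ones, then [v] and [w] are almost
    orthogonal: tangency to a plane passes to a nearby plane. *)
Lemma dot_transfer u eta (n : nat) v w (M : R) : 0 <= eta -> 0 <= M ->
  almost_orthonormal u eta -> enorm w = 1 ->
  (forall l : 'I_N, (l < n)%N -> `|dot (u l) w| <= eta) ->
  (forall k : 'I_N, (n <= k)%N -> `|dot v (u k)| <= M) ->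
  `|dot v w| <= 2 * N%:R * eta * enorm v + N%:R * M.
Proof.
move=> eta0 M0 uo w1 uw vu.
have := almost_orthonormal_parseval v w eta0 uo; rewrite w1 mulr1.
set S := \sum_k _ => vwS.
have Sle : `|S| <= N%:R * (eta * enorm v + M).
  apply: le_trans (ler_norm_sum _ _ _) _.
  apply: sumr_le_card => [|k _].
    by rewrite addr_ge0 ?mulr_ge0 ?enorm_ge0.
  have u1 := uo.1 k; rewrite normrM; have [nk|kn] := leqP n k.
    have := vu k nk; have := dot_unit_le (u k) w1; rewrite u1.
    have := normr_ge0 (dot v (u k)); have := normr_ge0 (dot (u k) w).
    by have := enorm_ge0 v; nra.
  have := uw k kn; have := dot_unit_le v u1.
  have := normr_ge0 (dot v (u k)); have := normr_ge0 (dot (u k) w).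
  by have := enorm_ge0 v; nra.
rewrite -(subrK S (dot v w)); apply: le_trans (ler_normD _ _) _.
by lra.
Qed.

End Frames.

(** * Maps with small weak quasisymmetry excess *)

Section WeaklyQuasisymmetric.
Context {R : realType} {N : nat}.
Variable f : 'rV[R]_N -> 'rV[R]_N.
Hypothesis f_inj : injective f.
Implicit Types (x y z a b : 'rV[R]_N) (X : set 'rV[R]_N) (e r t D kappa : R).
Implicit Types (k l : 'I_N).

Definition weakly_qs X e := forall x y a, X x -> X y -> X a ->
  enorm (x - a) <= enorm (y - a) ->
  enorm (f x - f a) <= (1 + e) * enorm (f y - f a).

Lemma weakly_qs_sub X Y e : X `<=` Y -> weakly_qs Y e -> weakly_qs X e.
Proof. by move=> XY q x y a /XY Yx /XY Yy /XY Ya; exact: q. Qed.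

(** The bisector of [a] and [b] is sent near the bisector of [f a] and [f b],
    with an error linear in [e]: this is the source of all flatness below. *)
Lemma bisector_sqr X e D y a b : weakly_qs X e -> 0 <= e <= 1 ->
  X y -> X a -> X b ->
  (forall x x', X x -> X x' -> enorm (f x - f x') <= D) ->
  enorm (y - a) = enorm (y - b) ->
  enorm (f y - f a) ^+ 2 - enorm (f y - f b) ^+ 2 <= 3 * e * D ^+ 2.
Proof.
move=> q /andP[e0 e1] Xy Xa Xb XD yab; have := q a b y Xa Xb Xy.
rewrite (enormB a) (enormB b) yab lexx => /(_ isT).
rewrite (enormB (f a)) (enormB (f b)).
have := XD y b Xy Xb; have := enorm_ge0 (f y - f b).
have := enorm_ge0 (f y - f a).
set p := enorm (f y - f a); set p' := enorm (f y - f b).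
move=> p0 p'0 p'D pp'.
have p2 : p ^+ 2 <= (1 + e) ^+ 2 * p' ^+ 2.
  by rewrite -exprMn lerXn2r ?nnegrE ?mulr_ge0 ?addr_ge0.
have p'2 : p' ^+ 2 <= D ^+ 2 by rewrite lerXn2r ?nnegrE ?(le_trans p'0).
have e2 : e ^+ 2 <= e by rewrite expr2 ler_piMl.
have h : (1 + e) ^+ 2 * p' ^+ 2 - p' ^+ 2 <= 3 * e * p' ^+ 2.
  have -> : (1 + e) ^+ 2 * p' ^+ 2 - p' ^+ 2 = (2 * e + e ^+ 2) * p' ^+ 2.
    by ring.
  by rewrite ler_wpM2r ?sqr_ge0//; lra.
have : 3 * e * p' ^+ 2 <= 3 * e * D ^+ 2 by rewrite ler_wpM2l// mulr_ge0.
lra.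
Qed.

Lemma bisector_dot X e D y z a b : weakly_qs X e -> 0 <= e <= 1 ->
  X y -> X z -> X a -> X b ->
  (forall x x', X x -> X x' -> enorm (f x - f x') <= D) ->
  enorm (y - a) = enorm (y - b) -> enorm (z - a) = enorm (z - b) ->
  `|dot (f y - f z) (f a - f b)| <= 3 * e * D ^+ 2.
Proof.
move=> q e01 Xy Xz Xa Xb XD yab zab.
have polar : 2 * dot (f y - f z) (f a - f b) =
    (enorm (f y - f b) ^+ 2 - enorm (f y - f a) ^+ 2) +
    (enorm (f z - f a) ^+ 2 - enorm (f z - f b) ^+ 2).
  by rewrite !dot_enorm_sqrB dotBl !dotBr; ring.
have := bisector_sqr q e01 Xy Xa Xb XD yab.
have := bisector_sqr q e01 Xy Xb Xa XD (esym yab).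
have := bisector_sqr q e01 Xz Xa Xb XD zab.
have := bisector_sqr q e01 Xz Xb Xa XD (esym zab).
move=> h1 h2 h3 h4; rewrite ler_norml; apply/andP; split; lra.
Qed.

Lemma reflection_equidistant x y k r : (y - x) 0 k = 0 ->
  enorm (y - (x + r *: delta_mx 0 k)) = enorm (y - (x - r *: delta_mx 0 k)).
Proof.
move=> yx; rewrite opprD addrA (opprD x) opprK addrA.
apply/eqP; rewrite -(@eqrXn2 _ 2)// ?enorm_ge0//.
rewrite [eqbLHS]dot_enorm_sqrB [eqbRHS]dot_enorm_sqrD !dotZr !dot_delta yx.
by rewrite !mulr0 subr0 addr0.
Qed.

(** The images of the diameters of the ball of radius [r] around [x] parallel to
    the axes make a frame. For [x] in the [n]-plane spanned by the first axes,
    the normals of index at least [n] are the approximate normal directions of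
    the image of that plane at the scale [r], and the others its approximate
    tangent directions. *)
Definition chord x r k := f (x + r *: delta_mx 0 k) - f (x - r *: delta_mx 0 k).

Definition normal x r k := (enorm (chord x r k))^-1 *: chord x r k.

Definition stretch k x t := enorm (f (x + t *: delta_mx 0 k) - f x).

Lemma enorm_scale_delta t k : 0 <= t ->
  enorm (t *: delta_mx 0 k : 'rV[R]_N) = t.
Proof. by move=> t0; rewrite enormZ enorm_delta mulr1 ger0_norm. Qed.

Lemma stretch_gt0 k x t : 0 < t -> 0 < stretch k x t.
Proof.
move=> t0; rewrite enorm_gt0 subr_eq0 (inj_eq f_inj).
by rewrite -subr_eq0 addrC addKr -enorm_gt0 enorm_scale_delta// ltW.
Qed.

Lemma chord_gt0 x r k : 0 < r -> 0 < enorm (chord x r k).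
Proof.
move=> r0; rewrite enorm_gt0 subr_eq0 (inj_eq f_inj) -subr_eq0.
rewrite opprB addrC addrA subrK -enorm_gt0 -scalerDl enorm_scale_delta//.
  by rewrite addr_gt0.
by rewrite addr_ge0 ?ltW.
Qed.

Lemma enorm_normal x r k : 0 < r -> enorm (normal x r k) = 1.
Proof.
move=> r0; have d0 := chord_gt0 x k r0.
by rewrite enormZ ger0_norm ?invr_ge0 ?ltW// mulVf// gt_eqF.
Qed.

Lemma eball_center x r : 0 <= r -> eball x r x.
Proof. by rewrite /eball/= subrr enorm0. Qed.

Lemma eballP x r k (s : R) : 0 <= r -> `|s| <= r -> eball x r (x + s *: delta_mx 0 k).
Proof. by move=> r0 sr; rewrite /eball/= addrAC subrr add0r enormZ enorm_delta mulr1. Qed.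

Lemma eball_addr x r k : 0 <= r -> eball x r (x + r *: delta_mx 0 k).
Proof. by move=> r0; apply: eballP; rewrite ?ger0_norm. Qed.

Lemma eball_subr x r k : 0 <= r -> eball x r (x - r *: delta_mx 0 k).
Proof. by move=> r0; rewrite -scaleNr; apply: eballP; rewrite ?normrN ?ger0_norm. Qed.

Lemma eball_sub x y (r s : R) : enorm (x - y) + r <= s -> eball x r `<=` eball y s.
Proof.
move=> h z /= zr; apply: le_trans (ler_enorm_dist _ x _) _.
by rewrite addrC; apply: le_trans h; rewrite lerD2l.
Qed.

(** A diameter of a ball is its longest chord, and remains so in the image up to
    a factor: compare all the distances from one of its endpoints. *)
Lemma eball_diam_le z r e k y y' : weakly_qs (eball z r) e -> 0 <= e <= 1 ->
  0 <= r -> eball z r y -> eball z r y' ->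
  enorm (f y - f y') <= 4 * enorm (chord z r k).
Proof.
move=> q /andP[e0 e1] r0 By By'.
set p := z + r *: delta_mx 0 k; set a := z - r *: delta_mx 0 k.
have Bp : eball z r p by exact: eball_addr.
have Ba : eball z r a by exact: eball_subr.
have pa : enorm (p - a) = 2 * r.
  rewrite /p /a opprB addrC addrA subrK -scalerDl enorm_scale_delta ?addr_ge0//.
  by ring.
have H w : eball z r w -> enorm (f w - f a) <= 2 * enorm (f p - f a).
  move=> Bw; have wa : enorm (w - a) <= enorm (p - a).
    rewrite pa; apply: le_trans (ler_enorm_dist _ z _) _.
    rewrite (enormB z); move: Bw Ba; rewrite /eball/=; lra.
  by apply: le_trans (q _ _ _ Bw Bp Ba wa) _; rewrite ler_wpM2r ?enorm_ge0//; lra.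
apply: le_trans (ler_enorm_dist _ (f a) _) _; rewrite (enormB (f a)).
by have := H _ By; have := H _ By'; rewrite /chord -/p -/a; lra.
Qed.

(** Halving the segment from [x] to [y] divides the distance of the images by at
    most 3, since the midpoint is equidistant from both ends. *)
Lemma doubling z r e k x y t (p : nat) :
  weakly_qs (eball z r) e -> 0 <= e <= 1 -> 0 <= t ->
  eball z r x -> eball z r (x + t *: delta_mx 0 k) -> eball z r y ->
  enorm (y - x) <= 2 ^+ p * t ->
  enorm (f y - f x) <= 2 * 3 ^+ p * stretch k x t.
Proof.
move=> q /andP[e0 e1] t0 Bx Bxt; elim: p y => [|p IH] y By yx.
  rewrite expr0 mulr1; rewrite expr0 mul1r in yx.
  have := q y (x + t *: delta_mx 0 k) x By Bxt Bx.
  rewrite [x + _ - _]addrC addKr enorm_scale_delta// => /(_ yx).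
  rewrite -/(stretch k x t) => h; apply: le_trans h _.
  by rewrite ler_wpM2r ?enorm_ge0//; lra.
pose m := x + 2^-1 *: (y - x).
have mx : m - x = 2^-1 *: (y - x) by rewrite /m addrC addKr.
have ym : y - m = 2^-1 *: (y - x).
  by apply/rowP => i; rewrite !mxE; field.
have Bm : eball z r m.
  have -> : eball z r m = (enorm (m - z) <= r) :> Prop by [].
  have -> : m - z = 2^-1 *: (y - z) + 2^-1 *: (x - z).
    by apply/rowP => i; rewrite !mxE; field.
  apply: le_trans (ler_enormD _ _) _; rewrite !enormZ ger0_norm ?invr_ge0//.
  by move: By Bx; rewrite /eball/=; lra.
have mxn : enorm (m - x) = enorm (y - x) / 2.
  by rewrite mx enormZ ger0_norm ?invr_ge0// mulrC.
have h1 := IH m Bm _.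
have {}h1 : enorm (f m - f x) <= 2 * 3 ^+ p * stretch k x t.
  by apply: h1; rewrite mxn; move: yx; rewrite exprS; lra.
have := q y x m By Bx Bm.
rewrite (enormB x) mxn ym enormZ ger0_norm ?invr_ge0// mulrC lexx => /(_ isT).
rewrite (enormB (f x)) => h2.
have h3 : enorm (f y - f m) <= 2 * enorm (f m - f x).
  by apply: le_trans h2 _; rewrite ler_wpM2r ?enorm_ge0//; lra.
apply: le_trans (ler_enorm_dist _ (f m) _) _; rewrite exprS; lra.
Qed.

(** The points in the hyperplane through [x] orthogonal to the [k]-th axis are
    equidistant from the endpoints of the chord, so their images differ by a
    vector almost orthogonal to the chord. Here and in the next two lemmas [D]
    bounds the diameter of [f @` X] and is comparable to the lengths of the
    chords: errors in [D ^+ 2] become relative errors. *)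
Lemma dot_normal_le X e D kappa x r k y z : weakly_qs X e -> 0 <= e <= 1 ->
  0 < r -> 0 <= kappa ->
  (forall x x', X x -> X x' -> enorm (f x - f x') <= D) ->
  D <= kappa * enorm (chord x r k) ->
  X (x + r *: delta_mx 0 k) -> X (x - r *: delta_mx 0 k) -> X y -> X z ->
  (y - x) 0 k = 0 -> (z - x) 0 k = 0 ->
  `|dot (f y - f z) (normal x r k)| <= 3 * kappa * D * e.
Proof.
move=> q e01 r0 kap0 XD Dk Xp Xm Xy Xz yx zx.
have d0 := chord_gt0 x k r0.
have := bisector_dot q e01 Xy Xz Xp Xm XD (reflection_equidistant r yx)
  (reflection_equidistant r zx).
rewrite -/(chord x r k) => h.
rewrite dotZr normrM [`|_^-1|]ger0_norm ?invr_ge0 ?(ltW d0)// ler_pdivrMl//.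
apply: le_trans h _; case/andP: e01 => e0 _.
have D0 : 0 <= D by apply: le_trans (XD y y Xy Xy); exact: enorm_ge0.
have -> : 3 * e * D ^+ 2 = (3 * e * D) * D by ring.
have -> : enorm (chord x r k) * (3 * kappa * D * e) =
  (3 * e * D) * (kappa * enorm (chord x r k)) by ring.
by rewrite ler_wpM2l// !mulr_ge0.
Qed.

(** Frames at different points and scales are almost orthogonal to each other,
    as soon as the indices differ and the centers agree in the coordinate [k]:
    this bounds the angle of two tangent planes. *)
Lemma dot_normal_normal_le X e D kappa x r k x' r' l : weakly_qs X e ->
  0 <= e <= 1 -> 0 < r -> 0 < r' -> 0 <= kappa ->
  (forall x x', X x -> X x' -> enorm (f x - f x') <= D) ->
  D <= kappa * enorm (chord x r k) -> D <= kappa * enorm (chord x' r' l) ->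
  X (x + r *: delta_mx 0 k) -> X (x - r *: delta_mx 0 k) ->
  X (x' + r' *: delta_mx 0 l) -> X (x' - r' *: delta_mx 0 l) ->
  (x' - x) 0 k = 0 -> l != k ->
  `|dot (normal x' r' l) (normal x r k)| <= 3 * kappa ^+ 2 * e.
Proof.
move=> q e01 r0 r'0 kap0 XD Dk Dl Xp Xm Xp' Xm' xx' lk.
have d0 := chord_gt0 x' l r'0.
have h : `|dot (chord x' r' l) (normal x r k)| <= 3 * kappa * D * e.
  apply: (dot_normal_le q e01) => //.
    by rewrite addrAC mxE xx' add0r !mxE eq_sym (negPf lk) andbF mulr0.
  by rewrite addrAC mxE xx' add0r !mxE eq_sym (negPf lk) andbF mulr0 oppr0.
rewrite dotZl normrM [`|_^-1|]ger0_norm ?invr_ge0 ?(ltW d0)// ler_pdivrMl//.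
apply: le_trans h _; case/andP: e01 => e0 _.
have -> : 3 * kappa * D * e = (3 * kappa * e) * D by ring.
have -> : enorm (chord x' r' l) * (3 * kappa ^+ 2 * e) =
  (3 * kappa * e) * (kappa * enorm (chord x' r' l)) by ring.
by rewrite ler_wpM2l// !mulr_ge0.
Qed.

Lemma normal_almost_orthonormal X e D kappa x r : weakly_qs X e ->
  0 <= e <= 1 -> 0 < r -> 0 <= kappa ->
  (forall x x', X x -> X x' -> enorm (f x - f x') <= D) ->
  (forall k, D <= kappa * enorm (chord x r k)) -> eball x r `<=` X ->
  almost_orthonormal (normal x r) (3 * kappa ^+ 2 * e).
Proof.
move=> q e01 r0 kap0 XD Dk BX; split=> [k|k l kl]; first exact: enorm_normal.
have Xp k' : X (x + r *: delta_mx 0 k') by apply/BX/eball_addr/ltW.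
have Xm k' : X (x - r *: delta_mx 0 k') by apply/BX/eball_subr/ltW.
apply: (dot_normal_normal_le q e01 r0 r0 kap0 XD (Dk l) (Dk k) (Xp l) (Xm l)
  (Xp k) (Xm k) _ kl).
by rewrite subrr mxE.
Qed.

(** The middle of a segment is sent near the middle of the image of its
    endpoints: the error is almost orthogonal to all the vectors of a frame.
    So distances grow by a definite factor when the scale doubles. *)
Lemma stretch_double_ge e k0 x t :
  weakly_qs (eball (x + t *: delta_mx 0 k0) t) e ->
  0 <= e -> N%:R * e <= 10000^-1 -> 0 < t ->
  stretch k0 x t <= 2 / 3 * stretch k0 x (2 * t).
Proof.
set c := x + _; set X := eball c t => q e0 Ne t0.
have N1 : 1 <= N%:R :> R by rewrite (ler_nat _ 1); exact: leq_ltn_trans (leq0n _) (ltn_ord k0).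
have e1 : 0 <= e <= 1 by rewrite e0; nra.
have Xc : X c by exact/eball_center/ltW.
have diam k y y' : X y -> X y' -> enorm (f y - f y') <= 4 * enorm (chord c t k).
  by apply: (eball_diam_le k q e1); exact: ltW.
pose d := enorm (chord c t k0); pose D := 4 * d.
have d0 : 0 < d by exact: chord_gt0.
have Xp k : X (c + t *: delta_mx 0 k) by exact/eball_addr/ltW.
have Xm k : X (c - t *: delta_mx 0 k) by exact/eball_subr/ltW.
have Dk k : D <= 16 * enorm (chord c t k).
  by have := diam k _ _ (Xp k0) (Xm k0); rewrite -/(chord c t k0) -/d /D; lra.
have XD y y' : X y -> X y' -> enorm (f y - f y') <= D by exact: diam.
have uo := normal_almost_orthonormal q e1 t0 (ler0n _ 16) XD Dk (fun _ h => h).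
have cx : c - t *: delta_mx 0 k0 = x by rewrite addrK.
have cp : c + t *: delta_mx 0 k0 = x + (2 * t) *: delta_mx 0 k0.
  by rewrite -addrA -scalerDl; congr (_ + _ *: _); ring.
pose v := f c - 2^-1 *: (f (c + t *: delta_mx 0 k0) + f (c - t *: delta_mx 0 k0)).
have v2 : v = 2^-1 *: ((f c - f (c + t *: delta_mx 0 k0)) +
                      (f c - f (c - t *: delta_mx 0 k0))).
  by apply/rowP => i; rewrite !mxE; field.
have vu l : `|dot v (normal c t l)| <= 192 * e * d.
  have [->|lk] := eqVneq l k0.
    have vd : `|dot v (chord c t k0)| <= 3 * e * D ^+ 2.
      have cc : (c - c) 0 k0 = 0 by rewrite subrr mxE.
      have h := reflection_equidistant t cc.
      have h1 := bisector_sqr q e1 Xc (Xp k0) (Xm k0) XD h.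
      have h2 := bisector_sqr q e1 Xc (Xm k0) (Xp k0) XD (esym h).
      have -> : dot v (chord c t k0) = 2^-1 *
          (enorm (f c - f (c - t *: delta_mx 0 k0)) ^+ 2 -
           enorm (f c - f (c + t *: delta_mx 0 k0)) ^+ 2).
        rewrite v2 /chord !dot_enorm_sqrB !enormE !dotZl !dotDl !dotNl !dotBr.
        by rewrite (dotC (f (c - _)) (f (c + _))); field.
      rewrite ler_norml; apply/andP; split; lra.
    rewrite dotZr normrM [`|_^-1|]ger0_norm ?invr_ge0 ?(ltW d0)// ler_pdivrMl//.
    apply: le_trans vd _; rewrite -/d /D; have := ltW d0; nra.
  rewrite v2 dotZl dotDl normrM ger0_norm ?invr_ge0//.
  have h y : X y -> (y - c) 0 l = 0 ->
      `|dot (f c - f y) (normal c t l)| <= 3 * 16 * D * e.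
    move=> Xy yc; apply: (dot_normal_le q e1) => //.
    by rewrite subrr mxE.
  have h1 : `|dot (f c - f (c + t *: delta_mx 0 k0)) (normal c t l)|
      <= 3 * 16 * D * e.
    by apply: h => //; rewrite addrAC subrr add0r !mxE (negPf lk) andbF mulr0.
  have h2 : `|dot (f c - f (c - t *: delta_mx 0 k0)) (normal c t l)|
      <= 3 * 16 * D * e.
    apply: h => //; rewrite addrAC subrr add0r !mxE (negPf lk) andbF mulr0.
    by rewrite oppr0.
  have := ler_normD (dot (f c - f (c + t *: delta_mx 0 k0)) (normal c t l))
    (dot (f c - f (c - t *: delta_mx 0 k0)) (normal c t l)).
  by rewrite /D in h1 h2; lra.
have eta0 : 0 <= 3 * 16 ^+ 2 * e by rewrite !mulr_ge0.
have := almost_orthonormal_parseval v v eta0 uo; rewrite -enormE.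
set S := \sum_k _ => vS.
have Sle : S <= N%:R * (192 * e * d) ^+ 2.
  apply: sumr_le_card => [|l _]; first exact: sqr_ge0.
  by rewrite (dotC _ v) -expr2; apply: sqr_le_norm.
have vle : enorm v <= 6^-1 * d.
  have v0 := enorm_ge0 v.
  rewrite -(@ler_pXn2r _ 2)// ?nnegrE ?mulr_ge0 ?invr_ge0 ?(ltW d0)//.
  have h : enorm v ^+ 2 <= S + N%:R * (3 * 16 ^+ 2 * e) * enorm v ^+ 2.
    have := ler_norm (enorm v ^+ 2 - S); move: vS; rewrite expr2 => h1 h2; lra.
  have h3 : N%:R * (3 * 16 ^+ 2 * e) * enorm v ^+ 2 <= 2^-1 * enorm v ^+ 2.
    by rewrite ler_wpM2r ?sqr_ge0//; lra.
  have h4 : N%:R * (192 * e * d) ^+ 2 <= 72^-1 * d ^+ 2.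
    have -> : N%:R * (192 * e * d) ^+ 2 = (N%:R * e * (192 ^+ 2 * e)) * d ^+ 2.
      by ring.
    rewrite ler_wpM2r ?sqr_ge0//.
    have e2 : e <= 10000^-1 by nra.
    have := mulr_ge0 (ler0n R N) e0; nra.
  by rewrite exprMn; lra.
have -> : stretch k0 x t = enorm (v + 2^-1 *: chord c t k0).
  rewrite /stretch -/c /chord cx; congr enorm.
  by rewrite /v cx; apply/rowP => i; rewrite !mxE; field.
have -> : stretch k0 x (2 * t) = d by rewrite /d /chord cp cx.
apply: le_trans (ler_enormD _ _) _; rewrite enormZ ger0_norm ?invr_ge0//.
by rewrite -/d; lra.
Qed.

End WeaklyQuasisymmetric.

(** * Comparison of scales *)

Section Scales.
Context {R : realType} {N : nat}.
Variable f : 'rV[R]_N -> 'rV[R]_N.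
Hypothesis f_inj : injective f.
Implicit Types (x y z : 'rV[R]_N) (e r t : R) (k l : 'I_N).

Lemma stretch_pow_ge e k0 z r x t p : weakly_qs f (eball z r) e ->
  0 <= e -> N%:R * e <= 10000^-1 -> 0 < t ->
  enorm (x - z) + 2 ^+ p * t <= r ->
  stretch f k0 x t <= (2 / 3) ^+ p * stretch f k0 x (2 ^+ p * t).
Proof.
move=> q e0 Ne t0; elim: p => [|p IH] h; first by rewrite !expr0 !mul1r.
have p0 : 0 < 2 ^+ p * t by rewrite mulr_gt0 ?exprn_gt0.
apply: (le_trans (IH _)).
  by apply: le_trans h; rewrite lerD2l exprS; lra.
have -> : 2 ^+ p.+1 * t = 2 * (2 ^+ p * t) by rewrite exprS mulrA.
rewrite exprSr -[leRHS]mulrA ler_wpM2l ?exprn_ge0 ?divr_ge0//.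
apply: (stretch_double_ge f_inj _ e0 Ne p0).
apply: weakly_qs_sub q; apply: eball_sub; apply: le_trans h.
rewrite addrAC exprS; apply: (@le_trans _ _ ((enorm (x - z) + 2 ^+ p * t) + 2 ^+ p * t)).
  rewrite lerD2r; apply: le_trans (ler_enormD _ _) _.
  by rewrite enorm_scale_delta// ltW.
lra.
Qed.

(** A common bound for the distances between points of the image of a ball;
    [scale_stretch] and [scale_chord] compare it with the distances that are
    observed at the neighbouring scales. *)
Definition scale k0 z r : R := 4 * enorm (chord f z r k0).

Definition scale_ratio : R := locked (4 * 10 ^+ 5).

Lemma scale_diam k0 z r e y y' : weakly_qs f (eball z r) e -> 0 <= e <= 1 ->
  0 <= r -> eball z r y -> eball z r y' -> enorm (f y - f y') <= scale k0 z r.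
Proof. exact: eball_diam_le. Qed.

Lemma scale_doubling k0 k z r e x t (p : nat) :
  weakly_qs f (eball z r) e -> 0 <= e <= 1 -> 0 <= t -> 0 <= r ->
  eball z r x -> eball z r (x + t *: delta_mx 0 k) -> 2 * r <= 2 ^+ p * t ->
  scale k0 z r <= 16 * 3 ^+ p * stretch f k x t.
Proof.
move=> q e01 t0 r0 Bx Bxt rt.
have H y : eball z r y -> enorm (f y - f x) <= 2 * 3 ^+ p * stretch f k x t.
  move=> By; apply: (doubling q e01 t0 Bx Bxt By).
  apply: le_trans rt; apply: le_trans (ler_enorm_dist _ z _) _.
  by rewrite (enormB z); move: By Bx; rewrite /eball/=; lra.
have h1 := H _ (eball_addr z k0 r0); have h2 := H _ (eball_subr z k0 r0).
have := ler_enorm_dist (f (z + r *: delta_mx 0 k0)) (f x)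
  (f (z - r *: delta_mx 0 k0)).
by rewrite (enormB (f x)) -/(chord _ _ _ _) /scale; lra.
Qed.

Lemma scale_stretch k0 k z r e x t :
  weakly_qs f (eball z r) e -> 0 <= e <= 1 -> 0 <= t -> 0 <= r ->
  eball z r x -> eball z r (x + t *: delta_mx 0 k) -> 2 * r <= 2 ^+ 9 * t ->
  scale k0 z r <= scale_ratio * stretch f k x t.
Proof.
move=> q e01 t0 r0 Bx Bxt rt.
apply: le_trans (scale_doubling k0 q e01 t0 r0 Bx Bxt rt) _.
by rewrite ler_wpM2r ?enorm_ge0// /scale_ratio -lock; lra.
Qed.

Lemma scale_chord k0 k z r e x t :
  weakly_qs f (eball z r) e -> 0 <= e <= 1 -> 0 <= t -> 0 <= r ->
  eball x t `<=` eball z r -> 2 * r <= 2 ^+ 4 * t ->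
  scale k0 z r <= scale_ratio * enorm (chord f x t k).
Proof.
move=> q e01 t0 r0 BB rt.
have Bx := eball_center x t0; have Bxt := eball_addr x k t0.
apply: le_trans (scale_doubling k0 q e01 t0 r0 (BB _ Bx) (BB _ Bxt) rt) _.
have := eball_diam_le k (weakly_qs_sub BB q) e01 t0 Bxt Bx.
rewrite -/(stretch f k x t) /scale_ratio -lock => h.
by have := enorm_ge0 (chord f x t k); lra.
Qed.

Lemma scale_gt0 k0 z r : 0 < r -> 0 < scale k0 z r.
Proof. by move=> r0; rewrite mulr_gt0// chord_gt0. Qed.

End Scales.

(** * Averaged projections *)

Section Averages.
Context {R : realType} {N : nat} {I : Type}.
Variables (r : seq I) (act : pred I).
Implicit Types (th : I -> R) (F : I -> 'rV[R]_N).

Lemma sum_act_le (g b : I -> R) : (forall i, 0 <= b i) ->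
  (forall i, act i -> g i <= b i) -> (forall i, ~~ act i -> g i = 0) ->
  \sum_(i <- r) g i <= \sum_(i <- r) b i.
Proof.
move=> b0 gb g0; apply: ler_sum => i _.
by case: (boolP (act i)) => [/gb//|/g0->].
Qed.

Lemma enorm_sum_act_le th F (B : R) : 0 <= B ->
  (forall i, act i -> enorm (F i) <= B) -> (forall i, ~~ act i -> th i = 0) ->
  enorm (\sum_(i <- r) th i *: F i) <= (\sum_(i <- r) `|th i|) * B.
Proof.
move=> B0 FB th0; apply: le_trans (ler_enorm_sum _ _ _) _.
rewrite mulr_suml; apply: sum_act_le => i; first by rewrite mulr_ge0.
  by move=> /FB ?; rewrite enormZ ler_wpM2l.
by move=> /th0 ->; rewrite scale0r enorm0.
Qed.

Lemma dot_sum_act_le th F w (B : R) : 0 <= B ->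
  (forall i, act i -> `|dot (F i) w| <= B) -> (forall i, ~~ act i -> th i = 0) ->
  `|dot (\sum_(i <- r) th i *: F i) w| <= (\sum_(i <- r) `|th i|) * B.
Proof.
move=> B0 FB th0; rewrite dot_suml; apply: le_trans (ler_norm_sum _ _ _) _.
rewrite mulr_suml; apply: sum_act_le => i; first by rewrite mulr_ge0.
  by move=> /FB ?; rewrite dotZl normrM ler_wpM2l.
by move=> /th0 ->; rewrite scale0r dot0l normr0.
Qed.

End Averages.

Section ProjectionStep.
Context {R : realType} {N : nat} {I : Type}.
Variables (r : seq I) (act : pred I) (n : nat).
Variables (u : I -> 'I_N -> 'rV[R]_N) (p : I -> 'rV[R]_N).
Implicit Types (a b w : 'rV[R]_N) (th : I -> R).

Definition normal_index : pred 'I_N := fun k => (n <= k)%N.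

(** Each frame [u i], together with the point [p i], determines an affine
    [n]-plane, of normal space spanned by the vectors of index at least [n];
    the point [a] is sent to the average, with weights [th], of its projections
    to these planes. *)
Definition average_projection th a : 'rV[R]_N :=
  a - \sum_(i <- r) th i *: component (u i) normal_index (a - p i).

Variables (th th' : I -> R) (a b : 'rV[R]_N) (eta alpha M gamma : R).
Hypothesis th_ge0 : forall i, 0 <= th i.
Hypothesis th_sum : \sum_(i <- r) th i = 1.
Hypothesis th_act : forall i, ~~ act i -> th i = 0.
Hypothesis th'_act : forall i, ~~ act i -> th' i = 0.
Hypothesis eta_ge0 : 0 <= eta.
Hypothesis eta_le : N%:R * eta <= 1.
Hypothesis u_onb : forall i, act i -> almost_orthonormal (u i) eta.
Hypotheses (alpha_ge0 : 0 <= alpha) (M_ge0 : 0 <= M) (gamma_ge0 : 0 <= gamma).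
Let w := a - b.
Hypothesis w_tangent : forall i, act i -> forall k : 'I_N, (n <= k)%N ->
  `|dot w (u i k)| <= alpha * enorm w.
Hypothesis b_near : forall i, act i -> forall k : 'I_N, (n <= k)%N ->
  `|dot (b - p i) (u i k)| <= M.
Hypothesis th_close : (\sum_(i <- r) `|th i - th' i|) * M <= gamma * enorm w.

Let w' := average_projection th a - average_projection th' b.
Let P := \sum_(i <- r) th i *: component (u i) normal_index w.
Let Q := \sum_(i <- r) (th i - th' i) *: component (u i) normal_index (b - p i).

Let w'E : w' = w - P - Q.
Proof.
have -> : P = \sum_(i <- r) th i *: component (u i) normal_index (a - p i)
    - \sum_(i <- r) th i *: component (u i) normal_index (b - p i).
  rewrite -sumrB; apply: eq_bigr => i _; rewrite -scalerBr -componentB.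
  by rewrite opprB addrA subrK.
have -> : Q = \sum_(i <- r) th i *: component (u i) normal_index (b - p i)
    - \sum_(i <- r) th' i *: component (u i) normal_index (b - p i).
  by rewrite -sumrB; apply: eq_bigr => i _; rewrite -scalerBl.
rewrite /w' /average_projection /w.
by apply/rowP => i; rewrite ![in LHS]mxE ![in RHS]mxE; ring.
Qed.

Let th_normsum : \sum_(i <- r) `|th i| = 1.
Proof. by rewrite -th_sum; apply: eq_bigr => i _; rewrite ger0_norm. Qed.

Let w0 : 0 <= enorm w. Proof. exact: enorm_ge0. Qed.

Let dth_act i : ~~ act i -> th i - th' i = 0.
Proof. by move=> ai; rewrite th_act// th'_act// subrr. Qed.

Let P_le : enorm P <= N%:R * alpha * enorm w.
Proof.
rewrite -mulrA -[leRHS]mul1r -[X in _ <= X * _]th_normsum; apply: enorm_sum_act_le th_act => //.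
  by rewrite !mulr_ge0.
move=> i ai; apply: enorm_component_le (w_tangent ai) => //.
  by rewrite mulr_ge0.
by case: (u_onb ai).
Qed.

Let Q_le : enorm Q <= N%:R * gamma * enorm w.
Proof.
apply: (@le_trans _ _ ((\sum_(i <- r) `|th i - th' i|) * (N%:R * M))).
  apply: enorm_sum_act_le dth_act => //; first by rewrite mulr_ge0.
  move=> i ai; apply: enorm_component_le (b_near ai) => //.
  by case: (u_onb ai).
by rewrite mulrCA -mulrA ler_wpM2l.
Qed.

Let wP_le : `|dot w P| <= N%:R * alpha ^+ 2 * enorm w ^+ 2.
Proof.
rewrite dotC -[leRHS]mul1r -[X in _ <= X * _]th_normsum; apply: dot_sum_act_le th_act => //.
  by rewrite !mulr_ge0 ?sqr_ge0.
move=> i ai; rewrite dotC dot_component -mulrA -exprMn.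
apply: le_trans (ler_norm_sum _ _ _) _; apply: sumr_le_card => [|k nk].
  exact: sqr_ge0.
rewrite -expr2 normrX; apply: sqr_le_norm; rewrite normr_id.
exact: (w_tangent ai nk).
Qed.

Let wQ_le : `|dot w Q| <= N%:R * gamma * alpha * enorm w ^+ 2.
Proof.
rewrite dotC.
apply: (@le_trans _ _ ((\sum_(i <- r) `|th i - th' i|) *
  (N%:R * (M * (alpha * enorm w))))).
  apply: dot_sum_act_le dth_act => //; first by rewrite !mulr_ge0.
  move=> i ai; rewrite dotC dot_component.
  apply: le_trans (ler_norm_sum _ _ _) _; apply: sumr_le_card => [|k nk].
    by rewrite !mulr_ge0.
  by rewrite normrM ler_pM// ?(b_near ai nk) ?(w_tangent ai nk).
have h : 0 <= N%:R * alpha * enorm w by rewrite !mulr_ge0.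
have := ler_wpM2l h th_close.
by set S := \sum_(i <- r) _; rewrite expr2; lra.
Qed.

(** The displacements are combinations of the vectors [u i k], and [w] has slope
    [alpha] on them. So the two points move almost orthogonally to the segment
    that joins them, and their distance changes only to second order in [alpha]
    and [gamma]. *)
Lemma average_projection_dist :
  `|enorm w' ^+ 2 - enorm w ^+ 2| <=
  (2 * (N%:R * alpha ^+ 2 + N%:R * gamma * alpha) +
   (N%:R * alpha + N%:R * gamma) ^+ 2) * enorm w ^+ 2.
Proof.
have -> : w' = w - (P + Q) by rewrite w'E opprD addrA.
rewrite dot_enorm_sqrB dotDr.
have PQ : enorm (P + Q) ^+ 2 <= (N%:R * alpha + N%:R * gamma) ^+ 2 * enorm w ^+ 2.
  rewrite -exprMn lerXn2r ?nnegrE ?enorm_ge0//.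
    by rewrite mulr_ge0// addr_ge0 ?mulr_ge0.
  by apply: le_trans (ler_enormD _ _) _; rewrite mulrDl lerD.
have := sqr_ge0 (enorm (P + Q)).
move: wP_le wQ_le; rewrite !ler_norml => /andP[h1 h2] /andP[h3 h4] h5.
apply/andP; split; lra.
Qed.

(** The part of [w] that is kept is tangent to the planes, so that the slope of
    the new difference comes from the mutual angles of the planes, [eta], and
    from the variation of the weights, [gamma]. The old slope [alpha] enters only
    through its product with [eta]: this is why slopes do not accumulate. *)
Lemma average_projection_tangent (w1 : 'rV[R]_N) : enorm w1 = 1 ->
  (forall i, act i -> forall l : 'I_N, (l < n)%N -> `|dot (u i l) w1| <= eta) ->
  `|dot w' w1| <=
  (2 * N%:R * eta + N%:R * (N%:R * eta * alpha) + N%:R * gamma) * enorm w.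
Proof.
move=> w11 uw1; pose v i := w - component (u i) normal_index w.
have -> : w' = (\sum_(i <- r) th i *: v i) - Q.
  rewrite w'E; congr (_ - _); rewrite /P -[X in X - _]scale1r -th_sum scaler_suml.
  by rewrite -sumrB; apply: eq_bigr => i _; rewrite -scalerBr.
rewrite dotBl; apply: le_trans (ler_normB _ _) _.
rewrite mulrDl; apply: lerD; last first.
  by apply: le_trans Q_le; exact: dot_unit_le.
rewrite -[leRHS]mul1r -[X in _ <= X * _]th_normsum; apply: dot_sum_act_le th_act => //.
  by rewrite !(addr_ge0, mulr_ge0).
move=> i ai; have onb := u_onb ai.
have vl (l : 'I_N) : (n <= l)%N ->
    `|dot (v i) (u i l)| <= N%:R * (eta * (alpha * enorm w)).
  move=> nl; rewrite /v dotBl (dotC (component _ _ _)) dot_component.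
  rewrite (bigD1 l)//= -enormE onb.1 expr1n mulr1 opprD addNKr normrN.
  apply: le_trans (ler_norm_sum _ _ _) _.
  apply: sumr_le_card => [|k /andP[nk kl]]; first by rewrite !mulr_ge0.
  rewrite normrM mulrC ler_pM// ?(w_tangent ai nk)//.
  by apply: onb.2; rewrite eq_sym.
have M0 : 0 <= N%:R * (eta * (alpha * enorm w)) by rewrite !mulr_ge0.
apply: le_trans (dot_transfer eta_ge0 M0 onb w11 (uw1 i ai) vl) _.
have := enorm_sub_component normal_index w eta_ge0 eta_le onb; rewrite -/(v i) => h.
have h2 : 0 <= 2 * N%:R * eta by rewrite !mulr_ge0.
by have := ler_wpM2l h2 h; lra.
Qed.

End ProjectionStep.

(** * Nets and partitions of unity *)

(** Normalization costs a factor 2, because the totals differ by at most the sum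
    of the differences. *)
Lemma normalized_weights_close {R : realType} {I : Type} (r : seq I) (g h : I -> R) :
  (forall i, 0 <= h i) -> 1 <= \sum_(i <- r) g i -> 0 < \sum_(i <- r) h i ->
  \sum_(i <- r) `|g i / (\sum_(i <- r) g i) - h i / (\sum_(i <- r) h i)|
    <= 2 * \sum_(i <- r) `|g i - h i|.
Proof.
move=> h0; set G := \sum_(i <- r) g i; set H := \sum_(i <- r) h i => G1 H0.
have G0 : 0 < G by rewrite (lt_le_trans _ G1).
have GH : `|H - G| <= \sum_(i <- r) `|g i - h i|.
  rewrite distrC /G /H -sumrB; exact: ler_norm_sum.
apply: (@le_trans _ _ (\sum_(i <- r) (`|g i - h i| + h i / H * `|H - G|))).
  apply: ler_sum => i _.
  have -> : g i / G - h i / H = G^-1 * ((g i - h i) + h i / H * (H - G)).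
    by field; rewrite !gt_eqF.
  rewrite normrM [`|G^-1|]ger0_norm ?invr_ge0 ?(ltW G0)//.
  apply: (@le_trans _ _ (1 * `|(g i - h i) + h i / H * (H - G)|)).
    by rewrite ler_wpM2r// invf_le1.
  rewrite mul1r; apply: le_trans (ler_normD _ _) _; rewrite lerD2l normrM.
  by rewrite [`|h i / H|]ger0_norm// divr_ge0// ltW.
rewrite big_split /= -mulr_suml -mulr_suml -/H divff ?gt_eqF// mul1r.
by rewrite mulrC mulr_natr mulr2n lerD2l.
Qed.

Lemma eq_mod_close (m a b : nat) : (a <= b + m)%N -> (b <= a + m)%N ->
  a = b %[mod m.+1] -> a = b.
Proof.
wlog ab : a b / (a <= b)%N.
  by move=> W h1 h2 h; have [/W|/ltnW/W] := leqP a b; [apply|move=> ->].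
move=> _ ba /esym/eqP; rewrite eqn_mod_dvd// => d.
have [|h] := posnP (b - a)%N; first lia.
by have := dvdn_leq h d; lia.
Qed.

Section Nets.
Context {R : realType} {N : nat}.
Variable n : nat.
Implicit Types (x y c : 'rV[R]_N) (t rho : R).

Definition parallel x y := forall k : 'I_N, (n <= k)%N -> (y - x) 0 k = 0.

Lemma parallel_refl x : parallel x x.
Proof. by move=> k _; rewrite subrr mxE. Qed.

Lemma parallel_join x y z : parallel x y -> parallel x z -> parallel y z.
Proof.
move=> xy xz k nk; move: (xy k nk) (xz k nk); rewrite !mxE => h1 h2.
by apply/eqP; rewrite subr_eq0; apply/eqP; lra.
Qed.

Definition net_multiplicity : nat := ((66 * N).+1 ^ n)%N.

Section Grid.
Variables (x0 : 'rV[R]_N) (delta : R) (M : nat).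
Hypothesis delta_gt0 : 0 < delta.

Definition grid_point (i : {ffun 'I_n -> 'I_(M.*2.+1)}) : 'rV[R]_N :=
  x0 + \row_k (if insub (nat_of_ord k) is Some l
               then delta * ((i l)%:R - M%:R) else 0).

Lemma grid_point_parallel i : parallel x0 (grid_point i).
Proof.
move=> k nk; rewrite /grid_point addrAC subrr add0r mxE insubF//.
by apply/negbTE; rewrite -leqNgt.
Qed.

(** The indices of two grid points in the same ball differ by at most [66 * N] in
    each direction, hence are determined by their residues mod [66 * N + 1]. *)
Lemma grid_multiplicity x : (n <= N)%N ->
  (#|[pred i | (enorm (grid_point i - x) <= 33 * (N%:R * delta))%R]|
     <= net_multiplicity)%N.
Proof.
move=> nN; set A := [pred i | _]; pose m := (66 * N)%N.
pose g (i : {ffun 'I_n -> 'I_(M.*2.+1)}) : {ffun 'I_n -> 'I_m.+1} :=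
  [ffun l => inord (i l %% m.+1)].
have ginj : {in A &, injective g}.
  move=> i i'; rewrite !inE => Ai Ai' gii'; apply/ffunP => l; apply/val_inj => /=.
  have coord j : enorm (grid_point j - x) <= 33 * (N%:R * delta) ->
      `|(j l)%:R - M%:R - (x - x0) 0 (widen_ord nN l) / delta| <= (33 * N)%:R.
    move=> Aj; have := le_trans (ler_coord_enorm _ (widen_ord nN l)) Aj.
    have -> : (grid_point j - x) 0 (widen_ord nN l) =
      delta * ((j l)%:R - M%:R - (x - x0) 0 (widen_ord nN l) / delta).
      rewrite /grid_point !mxE /= (insubT (fun k => k < n)%N (ltn_ord l)) /=.
      rewrite (_ : Sub _ _ = l); last exact/val_inj.
      by field; rewrite gt_eqF.
    rewrite normrM (gtr0_norm delta_gt0) natrM mulrA mulrC ler_pM2r//.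
  have := coord i Ai; have := coord i' Ai'.
  set c := _ / delta; rewrite !ler_norml natrM => /andP[h1 h2] /andP[h3 h4].
  have le1 : (i l <= i' l + m)%N.
    by rewrite -(ler_nat R) natrD /m natrM; lra.
  have le2 : (i' l <= i l + m)%N.
    by rewrite -(ler_nat R) natrD /m natrM; lra.
  apply: (eq_mod_close le1 le2).
  move/ffunP/(_ l): gii'; rewrite !ffunE => /(congr1 val).
  by rewrite /= !inordK ?ltn_pmod.
rewrite -(card_in_image ginj); apply: leq_trans (max_card _) _.
by rewrite card_ffun !card_ord.
Qed.

Lemma grid_point_near x : parallel x0 x -> enorm (x - x0) <= M%:R * delta ->
  exists i, enorm (grid_point i - x) <= N%:R * delta.
Proof.
move=> px xM; pose y (k : 'I_N) := (x - x0) 0 k / delta + M%:R.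
have yM k : `|(x - x0) 0 k / delta| <= M%:R.
  rewrite normrM normfV (gtr0_norm delta_gt0) ler_pdivrMr//.
  exact: le_trans (ler_coord_enorm _ _) xM.
have y0 k : 0 <= y k <= M%:R + M%:R.
  by have := yM k; rewrite ler_norml /y => /andP[? ?]; apply/andP; split; lra.
have tM k : (Num.truncn (y k) < M.*2.+1)%N.
  rewrite ltnS truncn_le_nat; case/andP: (y0 k) => _ /le_lt_trans; apply.
  by rewrite -addnn -natrD ltr_nat.
pose g (l : 'I_n) : 'I_(M.*2.+1) :=
  if insub (nat_of_ord l) is Some k then Ordinal (tM k) else ord0.
exists [ffun l => g l]; apply: enorm_le_coord; first exact: ltW.
move=> k; rewrite /grid_point.
have [nk|kn] := leqP n k.
  rewrite addrAC mxE [X in _ + X]mxE insubF; last by apply/negbTE; rewrite -leqNgt.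
  by rewrite addr0 -opprB mxE px// oppr0 normr0 ltW.
rewrite addrAC mxE [X in _ + X]mxE.
case: insubP => [l _ lk|]; last by rewrite kn.
rewrite ffunE /g; case: insubP => [k' _ k'l|]; last by rewrite lk ltn_ord.
have {k'l} -> : k' = k by apply/val_inj; rewrite k'l.
rewrite /= -opprB mxE; case/andP: (y0 k) => /truncn_itv/andP[h1 h2] _.
have -> : - (x - x0) 0 k + delta * ((Num.truncn (y k))%:R - M%:R) =
    - (delta * (y k - (Num.truncn (y k))%:R)).
  by rewrite /y; field; rewrite gt_eqF.
rewrite normrN normrM (gtr0_norm delta_gt0) -[leRHS]mulr1 ler_pM2l//.
rewrite ger0_norm ?subr_ge0//; move: h2; rewrite -natr1; lra.
Qed.

End Grid.

(** The multiplicity is bounded independently of [t]: it enters the Lipschitz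
    constant of the partition of unity. *)
Lemma exists_net x0 t rho : (0 < N)%N -> (n <= N)%N -> 0 < t -> 0 <= rho ->
  exists cs : seq 'rV[R]_N,
  [/\ forall c, c \in cs -> parallel x0 c /\ enorm (c - x0) <= rho + t,
      forall x, parallel x0 x -> enorm (x - x0) <= rho ->
        exists2 c, c \in cs & enorm (c - x) <= t &
      forall x, (count (fun c => enorm (c - x) <= 33 * t)%R cs
                  <= net_multiplicity)%N].
Proof.
move=> N0 nN t0 rho0; (* a cube of side t / N has diameter at most t *)
pose delta := t / N%:R.
have NR : 0 < N%:R :> R by rewrite ltr0n.
have delta0 : 0 < delta by rewrite divr_gt0.
have Nd : N%:R * delta = t by rewrite /delta; field; rewrite gt_eqF.
pose M := Num.bound (rho / delta).
have rhoM : rho <= M%:R * delta.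
  by rewrite -ler_pdivrMr// ltW// archi_boundP// divr_ge0// ltW.
pose G := grid_point x0 delta (M := M).
exists [seq G i | i <- enum {: {ffun 'I_n -> 'I_(M.*2.+1)}} &
  enorm (G i - x0) <= rho + t]; split=> [c|x px xr|x].
- move=> /mapP[i]; rewrite mem_filter => /andP[h _] ->; split=> //.
  exact: grid_point_parallel.
- have [i h] := grid_point_near delta0 px (le_trans xr rhoM).
  rewrite Nd in h; exists (G i) => //; apply: map_f; rewrite mem_filter mem_enum andbT.
  apply: le_trans (ler_enorm_dist _ x _) _; rewrite addrC; exact: lerD.
rewrite count_map count_filter; apply: leq_trans (grid_multiplicity x0 M delta0 x nN).
rewrite cardE size_filter /enum_mem count_filter.
rewrite -enumT; apply: sub_count => i /=; rewrite Nd.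
by case/andP => /andP[].
Qed.

End Nets.

(** * One scale of the construction *)

(** In units of the excess [e]: [frame_const] bounds the angles of frames,
    [shift_const] the displacement by one projection, [offset_const] the distance
    of a displaced point to a nearby plane, [weight_const] the effect of the
    variation of the weights, [tangent_const] the slope of the difference of two
    projected points, [slope_const] the same slope seen from another frame, and
    [stretch_const] the relative change of squared lengths in units of [e ^+ 2].
    There is no circularity: [tangent_const] is built from the first four, which
    do not involve slopes. *)
Section Constants.
Variables (R : realType) (n N : nat).

Definition frame_const : R := locked
  (3 * scale_ratio ^+ 2).
Definition shift_const : R := locked
  (N%:R * frame_const).
Definition offset_const : R := locked
  (3 * shift_const + 3 * scale_ratio).
Definition weight_const : R := locked
  (2 * (net_multiplicity (N := N) n)%:R * scale_ratio * offset_const).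
Definition tangent_const : R := locked
  (2 * (2 * N%:R * frame_const + N%:R + N%:R * weight_const) +
  4 * scale_ratio * (6 * shift_const + 3 * scale_ratio)).
Definition slope_const : R := locked
  (2 * N%:R * frame_const + N%:R * tangent_const).
Definition stretch_const : R := locked
  (2 * (N%:R * slope_const ^+ 2 + N%:R * weight_const * slope_const) +
  (N%:R * slope_const + N%:R * weight_const) ^+ 2).
Definition inv_threshold : R :=
  10 ^+ 4 * N%:R + 1 + 4 * N%:R * frame_const
  + N%:R * frame_const * slope_const + 2 * stretch_const
  + 24 * shift_const * scale_ratio + 4 * N%:R * slope_const ^+ 2
  + 16 * shift_const.

Lemma scale_ratio_ge1 : 1 <= scale_ratio :> R.
Proof. by rewrite /scale_ratio -lock; lra. Qed.

Let kap0 : 0 <= scale_ratio :> R.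
Proof. exact: le_trans scale_ratio_ge1. Qed.

Lemma frame_const_ge0 : 0 <= frame_const.
Proof. by rewrite /frame_const -lock mulr_ge0// sqr_ge0. Qed.

Lemma shift_const_ge0 : 0 <= shift_const.
Proof. by rewrite /shift_const -lock mulr_ge0// frame_const_ge0. Qed.

Lemma offset_const_ge0 : 0 <= offset_const.
Proof. by rewrite /offset_const -lock addr_ge0 ?mulr_ge0// shift_const_ge0. Qed.

Lemma weight_const_ge0 : 0 <= weight_const.
Proof. by rewrite /weight_const -lock !mulr_ge0// offset_const_ge0. Qed.

Lemma tangent_const_ge0 : 0 <= tangent_const.
Proof.
rewrite /tangent_const -lock; move: frame_const_ge0 weight_const_ge0 shift_const_ge0.
move: frame_const weight_const shift_const kap0; move: scale_ratio.
by move=> k b w s *; rewrite !(addr_ge0, mulr_ge0).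
Qed.

Lemma slope_const_ge0 : 0 <= slope_const.
Proof.
rewrite /slope_const -lock; move: frame_const_ge0 tangent_const_ge0.
by move: frame_const tangent_const => b c *; rewrite !(addr_ge0, mulr_ge0).
Qed.

Lemma stretch_const_ge0 : 0 <= stretch_const.
Proof.
rewrite /stretch_const -lock; move: weight_const_ge0 slope_const_ge0.
move: weight_const slope_const => w c *.
by rewrite addr_ge0 ?sqr_ge0// mulr_ge0// addr_ge0// !mulr_ge0// sqr_ge0.
Qed.

Definition small_excess (e : R) := 0 <= e /\ e * inv_threshold <= 1.

Let split_threshold (a : nat -> R) e : 0 <= e -> (forall i, 0 <= a i) ->
  e * (a 0%N + a 1%N + a 2%N + a 3%N + a 4%N + a 5%N + a 6%N + a 7%N) <= 1 ->
  forall i, (i <= 7)%N -> a i * e <= 1.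
Proof.
move=> e0 a0; rewrite !mulrDr => h i.
have p i' : 0 <= e * a i' by rewrite mulr_ge0.
have := p 0%N; have := p 1%N; have := p 2%N; have := p 3%N; have := p 4%N.
have := p 5%N; have := p 6%N; have := p 7%N; rewrite (mulrC (a i)).
by do 8?[case: i => [|i]] => // *; lra.
Qed.

Lemma small_excessP e : small_excess e ->
  [/\ 0 <= e <= 1, 10 ^+ 4 * (N%:R * e) <= 1, 4 * N%:R * frame_const * e <= 1,
      N%:R * frame_const * slope_const * e <= 1 & 2 * stretch_const * e <= 1] /\
  [/\ 24 * shift_const * scale_ratio * e <= 1, 4 * N%:R * slope_const ^+ 2 * e <= 1
    & 16 * shift_const * e <= 1].
Proof.
move: frame_const_ge0 slope_const_ge0 stretch_const_ge0 shift_const_ge0 kap0.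
rewrite /small_excess /inv_threshold.
move: (10 ^+ 4) (exprn_ge0 4 (ler0n R 10)).
move: frame_const slope_const stretch_const shift_const scale_ratio.
move=> b c d sh k T T0 b0 c0 d0 sh0 k0 [e0 h].
pose a i := nth 0 [:: T * N%:R; 1; 4 * N%:R * b; N%:R * b * c; 2 * d;
  24 * sh * k; 4 * N%:R * c ^+ 2; 16 * sh] i.
have a0 i : 0 <= a i.
  by do 8?[case: i => [|i]]; rewrite /a /= ?nth_nil// ?mulr_ge0// sqr_ge0.
have H := split_threshold e0 a0 h.
split; split.
- by rewrite e0 -[e]mul1r; exact: (H 1%N isT).
- by rewrite mulrA; exact: (H 0%N isT).
- exact: (H 2%N isT).
- exact: (H 3%N isT).
- exact: (H 4%N isT).
- exact: (H 5%N isT).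
- exact: (H 6%N isT).
exact: (H 7%N isT).
Qed.

End Constants.

Lemma enorm_dist_dist {R : realType} {N : nat} (x y z : 'rV[R]_N) :
  `|enorm (x - z) - enorm (y - z)| <= enorm (x - y).
Proof.
rewrite ler_norml; apply/andP; split.
  by have := ler_enorm_dist y x z; rewrite (enormB y x); lra.
by have := ler_enorm_dist x y z; lra.
Qed.

Lemma max0_lipschitz {R : realType} (u v : R) :
  `|Num.max 0 u - Num.max 0 v| <= `|u - v|.
Proof.
rewrite !maxEle; case: (leP 0 u) => hu; case: (leP 0 v) => hv //.
- by rewrite subr0 ger0_norm// ler_normr; apply/orP; left; lra.
- by rewrite sub0r normrN ger0_norm// ler_normr; apply/orP; right; lra.
- by rewrite subrr normr0.
Qed.

Lemma sum_count_le {R : realType} {I : Type} (r : seq I) (P : pred I)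
    (g : I -> R) (B : R) : (forall i, P i -> g i <= B) ->
  (forall i, ~~ P i -> g i = 0) -> \sum_(i <- r) g i <= (count P r)%:R * B.
Proof.
move=> gB g0; elim: r => [|i r IH]; first by rewrite big_nil mul0r.
rewrite big_cons /= natrD mulrDl lerD//; case: (boolP (P i)) => Pi.
  by rewrite mul1r gB.
by rewrite mul0r g0.
Qed.

Section Level.
Context {R : realType} {N : nat}.
Variables (n : nat) (f : 'rV[R]_N -> 'rV[R]_N) (k0 : 'I_N).
Hypothesis f_inj : injective f.
Variables (x0 : 'rV[R]_N) (R0 e0 : R).
Hypothesis e0_small : small_excess n N e0.
Hypothesis q0 : weakly_qs f (eball x0 R0) e0.
Variable E : 'rV[R]_N -> R -> R.
Hypothesis E_qs : forall x s, eball x s `<=` eball x0 R0 ->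
  0 <= E x s <= e0 /\ weakly_qs f (eball x s) (E x s).
Variables (t : R) (cs : seq 'rV[R]_N).
Hypotheses (t_gt0 : 0 < t) (t_le : 1024 * t <= R0).
Hypothesis cs_near : forall c : 'rV[R]_N, c \in cs ->
  parallel n x0 c /\ enorm (c - x0) <= R0 / 512.
Hypothesis cs_net : forall x : 'rV[R]_N, parallel n x0 x -> enorm (x - x0) <= R0 / 1024 ->
  exists2 c, c \in cs & enorm (c - x) <= t.
Hypothesis cs_count : forall x : 'rV[R]_N,
  (count (fun c : 'rV[R]_N => enorm (c - x) <= 33 * t)%R cs <= net_multiplicity (N := N) n)%N.
Implicit Types (x y a b c : 'rV[R]_N).

(** The points that are followed through the scales; all the balls that are used
    around them stay inside [eball x0 R0]. *)
Definition core x := parallel n x0 x /\ enorm (x - x0) <= R0 / 2048.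

(** The factor 64 between the radius of the frames and the scale of the weights
    leaves room for all the points [c] whose weight is nonzero near [x]. *)
Let r := 64 * t.
Let s x := stretch f k0 x t.

(** The value 4 makes the weight at least 1 when [c] is within [t] of the point
    whose image is near [a]; distances are compared in the image, in units of the
    local stretch, so that the weights are Lipschitz functions of [a] itself. *)
Definition weight a c : R :=
  if c \in cs then Num.max 0 (4 - enorm (a - f c) / s c) else 0.

Definition share a c : R := weight a c / \sum_(c' <- cs) weight a c'.

Definition level_projection a : 'rV[R]_N :=
  average_projection cs n (fun c => normal f c r) f (share a) a.

Let e01 : 0 <= e0 <= 1. Proof. by have [[]] := small_excessP e0_small. Qed.
Let Ne0 : N%:R * e0 <= 10000^-1.
Proof. by have [[_ h _ _ _] _] := small_excessP e0_small; lra. Qed.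
Let e0_le : e0 <= 100^-1.
Proof.
apply: (@le_trans _ _ 10000^-1); last by lra.
apply: le_trans Ne0; rewrite -[leLHS]mul1r ler_wpM2r//; first by case/andP: e01.
by rewrite (ler_nat _ 1); exact: leq_ltn_trans (leq0n _) (ltn_ord k0).
Qed.
Let R0_gt0 : 0 < R0. Proof. have := t_gt0; have := t_le; lra. Qed.
Let r_gt0 : 0 < r. Proof. have := t_gt0; rewrite /r; lra. Qed.
Let s_gt0 x : 0 < s x. Proof. exact: stretch_gt0. Qed.

Let ball0 x p : enorm (x - x0) + p <= R0 -> eball x p `<=` eball x0 R0.
Proof. exact: eball_sub. Qed.

Let mem_ball0 x p : 0 <= p -> enorm (x - x0) + p <= R0 ->
  eball x0 R0 (x + p *: delta_mx 0 k0).
Proof. by move=> p0 /ball0; apply; exact: eball_addr. Qed.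

Lemma weight_ge0 a c : 0 <= weight a c.
Proof. by rewrite /weight; case: ifP => // _; rewrite le_max lexx. Qed.

Lemma weight_lipschitz a b c :
  `|weight a c - weight b c| <= enorm (a - b) / s c.
Proof.
rewrite /weight; case: ifP => _; last first.
  by rewrite subrr normr0 divr_ge0// ?enorm_ge0// ltW.
apply: le_trans (max0_lipschitz _ _) _.
have -> : 4 - enorm (a - f c) / s c - (4 - enorm (b - f c) / s c) =
  (enorm (b - f c) - enorm (a - f c)) / s c by ring.
rewrite normrM.
rewrite [`|_^-1|]ger0_norm ?invr_ge0 ?(ltW (s_gt0 c))//.
rewrite ler_wpM2r ?invr_ge0 ?(ltW (s_gt0 c))//.
by rewrite (enormB a b); exact: enorm_dist_dist.
Qed.

Lemma weight_total_ge1 x a : core x -> enorm (a - f x) <= s x / 8 ->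
  1 <= \sum_(c <- cs) weight a c.
Proof.
have t0 := t_gt0; have tR := t_le.
move=> [px xR] ax; have [|c cin cx] := cs_net px; first by lra.
have [_ cR] := cs_near cin.
have Bc : eball x0 R0 c by rewrite /eball/=; lra.
have Bx : eball x0 R0 x by rewrite /eball/=; lra.
have Bct : eball x0 R0 (c + t *: delta_mx 0 k0) by apply: mem_ball0; lra.
have Bxt : eball x0 R0 (x + t *: delta_mx 0 k0) by apply: mem_ball0; lra.
have h0 : enorm (f x - f c) <= 2 * 3 ^+ 0 * s c.
  apply: (doubling q0 e01 (ltW t_gt0) Bc Bct Bx).
  by rewrite expr0 mul1r enormB.
have h1 : enorm (f (x + t *: delta_mx 0 k0) - f c) <= 2 * 3 ^+ 1 * s c.
  apply: (doubling q0 e01 (ltW t_gt0) Bc Bct Bxt).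
  rewrite addrAC; apply: le_trans (ler_enormD _ _) _.
  rewrite enorm_scale_delta; last exact: ltW.
  by rewrite (enormB x); lra.
have sx : s x <= 8 * s c.
  rewrite /s {1}/stretch; apply: le_trans (ler_enorm_dist _ (f c) _) _.
  by rewrite (enormB (f c)) -/(s c); lra.
have ac : enorm (a - f c) <= 3 * s c.
  by apply: le_trans (ler_enorm_dist _ (f x) _) _; lra.
have wc : 1 <= weight a c.
  rewrite /weight cin le_max; apply/orP; right.
  have : enorm (a - f c) / s c <= 3 by rewrite ler_pdivrMr.
  lra.
rewrite (big_rem c)//= -[leLHS]addr0 lerD// sumr_ge0// => c' _.
exact: weight_ge0.
Qed.

Lemma share_sum x a : core x -> enorm (a - f x) <= s x / 8 ->
  \sum_(c <- cs) share a c = 1.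
Proof.
move=> Yx ax; rewrite -mulr_suml divff// gt_eqF//.
exact: lt_le_trans (weight_total_ge1 Yx ax).
Qed.

Lemma share_ge0 a c : 0 <= share a c.
Proof.
rewrite divr_ge0 ?weight_ge0// sumr_ge0// => c' _; exact: weight_ge0.
Qed.

(** Images grow by a definite factor with the scale, so a point [c] that is far
    from [x] has its image too far from [f x] to carry weight. *)
Lemma weight_support x a c : core x -> enorm (a - f x) <= s x / 8 ->
  weight a c != 0 -> c \in cs /\ enorm (c - x) <= 16 * t.
Proof.
have t0 := t_gt0; have tR := t_le.
move=> [px xR] ax; rewrite /weight; case: ifP => cin; last by rewrite eqxx.
rewrite maxEle; case: ifP => [|_]; last by rewrite eqxx.
rewrite subr_ge0 ler_pdivrMr// => ac _; split=> //.
have [_ cR] := cs_near cin; rewrite leNgt; apply/negP => far.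
have t16 : 16 * t = 2 ^+ 4 * t by lra.
have Bc : eball x0 R0 c by rewrite /eball/=; lra.
have Bx : eball x0 R0 x by rewrite /eball/=; lra.
have grow y : enorm (y - x0) <= R0 / 512 ->
    s y <= (2 / 3) ^+ 4 * stretch f k0 y (2 ^+ 4 * t).
  move=> yR; have [e00 _] := andP e01.
  have := @stretch_pow_ge _ _ _ f_inj e0 k0 x0 R0 y t 4 q0 e00 Ne0 t_gt0; apply.
  by rewrite -t16; lra.
have reach y z : eball x0 R0 y -> eball x0 R0 z -> enorm (y - x0) <= R0 / 512 ->
    16 * t <= enorm (z - y) ->
    stretch f k0 y (2 ^+ 4 * t) <= (1 + e0) * enorm (f z - f y).
  move=> By Bz yR zy; rewrite /stretch -t16.
  have By16 : eball x0 R0 (y + (16 * t) *: delta_mx 0 k0) by apply: mem_ball0; lra.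
  apply: (q0 By16 Bz By).
  by rewrite [y + _ - _]addrC addKr enorm_scale_delta//; lra.
have sc := grow c cR.
have sx : s x <= (2 / 3) ^+ 4 * stretch f k0 x (2 ^+ 4 * t) by apply: grow; lra.
have h1 : stretch f k0 c (2 ^+ 4 * t) <= (1 + e0) * enorm (f x - f c).
  by apply: reach => //; rewrite enormB ltW.
have h2 : stretch f k0 x (2 ^+ 4 * t) <= (1 + e0) * enorm (f x - f c).
  by rewrite (enormB (f x)); apply: reach => //; [lra|exact: ltW].
have h3 : enorm (f x - f c) <= 4 * s c + s x / 8.
  by apply: le_trans (ler_enorm_dist _ a _) _; rewrite (enormB (f x)); lra.
have pos : 0 < enorm (f x - f c).
  have c0 : 0 < (2 / 3) ^+ 4 :> R by rewrite exprn_gt0// divr_gt0.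
  have := lt_le_trans (s_gt0 c) sc; rewrite pmulr_rgt0// => A0.
  have := lt_le_trans A0 h1; rewrite pmulr_rgt0//.
  by case/andP: e01; lra.
case/andP: e01 => e00 _; move: sc sx h1 h2 h3 pos e0_le.
move: (s c) (s x) (stretch f k0 c _) (stretch f k0 x _) (enorm _).
move=> sc sx A A' d h4 h5 h1 h2 h3 d0 e0l.
have h6 : (1 + e0) * d <= (1 + 100^-1) * d by rewrite ler_wpM2r ?(ltW d0)//; lra.
by move: h4 h5; rewrite !exprS expr0; lra.
Qed.

Lemma share_support x a c : core x -> enorm (a - f x) <= s x / 8 ->
  share a c != 0 -> c \in cs /\ enorm (c - x) <= 16 * t.
Proof.
move=> Yx ax sh; apply: (weight_support Yx ax); apply: contraNneq sh => w0.
by rewrite /share w0 mul0r.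
Qed.

Section Ball.
Variables (z : 'rV[R]_N) (p : R).
Hypotheses (z_core : core z) (p_ge : 128 * t <= p) (p_le : p <= 256 * t).
Let B := eball z p.
Let e := E z p.
Let D := scale f k0 z p.

Let p0 : 0 <= p. Proof. have := t_gt0; have := p_ge; lra. Qed.
Let BX : B `<=` eball x0 R0.
Proof.
have t0 := t_gt0; have tR := t_le; have pt := p_le.
by apply: ball0; case: z_core => _; lra.
Qed.
Let qB : weakly_qs f B e. Proof. by have [] := E_qs BX. Qed.
Let e_ge0 : 0 <= e. Proof. by have [/andP[]] := E_qs BX. Qed.
Let e_le : e <= e0. Proof. by have [/andP[]] := E_qs BX. Qed.
Let eB : 0 <= e <= 1.
Proof. by rewrite e_ge0 (le_trans e_le)//; case/andP: e01. Qed.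
Let DB x y : B x -> B y -> enorm (f x - f y) <= D.
Proof. by move=> Bx By; exact: (scale_diam k0 qB eB p0 Bx By). Qed.
Let kap0 : 0 <= scale_ratio :> R.
Proof. exact: le_trans (scale_ratio_ge1 _). Qed.

Lemma chord_level c rho k : 32 * t <= rho -> enorm (c - z) + rho <= p ->
  D <= scale_ratio * enorm (chord f c rho k).
Proof.
have t0 := t_gt0; have pt := p_le.
move=> rho_ge crho; apply: (scale_chord k0 k qB eB) => //; try lra.
exact: eball_sub.
Qed.

Lemma stretch_level c : enorm (c - z) + t <= p -> D <= scale_ratio * s c.
Proof.
have t0 := t_gt0; have pt := p_le.
move=> ct; have h : eball c t `<=` B by exact: eball_sub.
apply: (scale_stretch k0 qB eB) => //; try lra.
  exact/h/eball_center/ltW.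
exact/h/eball_addr/ltW.
Qed.

Lemma frame_level c rho : 32 * t <= rho -> enorm (c - z) + rho <= p ->
  almost_orthonormal (normal f c rho) (frame_const R * e).
Proof.
have t0 := t_gt0; have pt := p_le.
move=> rho_ge crho; rewrite /frame_const -lock.
apply: (normal_almost_orthonormal f_inj qB eB) => //.
- lra.
- exact: DB.
- by move=> k; exact: chord_level.
exact: eball_sub.
Qed.

Lemma frames_level c rho c' rho' (l k : 'I_N) :
  32 * t <= rho -> enorm (c - z) + rho <= p ->
  32 * t <= rho' -> enorm (c' - z) + rho' <= p -> parallel n c c' ->
  (l < n)%N -> (n <= k)%N ->
  `|dot (normal f c' rho' l) (normal f c rho k)| <= frame_const R * e.
Proof.
have t0 := t_gt0; have pt := p_le.
move=> h1 h2 h3 h4 pc ln nk; rewrite /frame_const -lock.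
have Bc : eball c rho `<=` B by exact: eball_sub.
have Bc' : eball c' rho' `<=` B by exact: eball_sub.
apply: (dot_normal_normal_le f_inj qB eB _ _ kap0 DB (chord_level k h1 h2)
  (chord_level l h3 h4)); try lra.
- by apply/Bc/eball_addr; lra.
- by apply/Bc/eball_subr; lra.
- by apply/Bc'/eball_addr; lra.
- by apply/Bc'/eball_subr; lra.
- exact: pc.
by apply: contraTneq ln => ->; rewrite -leqNgt.
Qed.

Lemma flat_level c rho x y (k : 'I_N) : 32 * t <= rho -> enorm (c - z) + rho <= p ->
  B x -> B y -> parallel n c x -> parallel n c y -> (n <= k)%N ->
  `|dot (f x - f y) (normal f c rho k)| <= 3 * scale_ratio * D * e.
Proof.
have t0 := t_gt0; have pt := p_le.
move=> h1 h2 Bx By cx cy nk.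
have Bc : eball c rho `<=` B by exact: eball_sub.
apply: (dot_normal_le f_inj qB eB _ kap0 DB (chord_level k h1 h2)) => //.
- lra.
- by apply/Bc/eball_addr; lra.
- by apply/Bc/eball_subr; lra.
- exact: cx.
exact: cy.
Qed.

End Ball.

Let core_ball z p : core z -> p <= 256 * t -> eball z p `<=` eball x0 R0.
Proof.
move=> [_ zR] pt; apply: ball0; have tR := t_le; have RR := R0_gt0; lra.
Qed.

Let net_core x c : core x -> c \in cs -> parallel n c x.
Proof.
by move=> [px _] /cs_near[pc _]; exact: parallel_join pc px.
Qed.

Let core_net x c : core x -> c \in cs -> parallel n x c.
Proof.
by move=> [px _] /cs_near[pc _]; exact: parallel_join px pc.
Qed.

Let frame_eps_le e : 0 <= e <= e0 -> N%:R * (frame_const R * e) <= 1.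
Proof.
case/andP=> e00 ee; have [[_ _ h _ _] _] := small_excessP e0_small.
have b0 := frame_const_ge0 R; have : 0 <= N%:R * frame_const R by rewrite mulr_ge0.
move: (frame_const R) b0 h => b b0 h Nb.
have : N%:R * b * e <= N%:R * b * e0 by rewrite ler_wpM2l.
by rewrite mulrA; lra.
Qed.

Lemma stretch_small e : 0 <= e <= e0 -> stretch_const R n N * e ^+ 2 <= 2^-1.
Proof.
case/andP=> e00 ee; have [[/andP[_ e1] _ _ _ h] _] := small_excessP e0_small.
move: (stretch_const R n N) (stretch_const_ge0 R n N) h => C C0 h.
have h1 : e ^+ 2 <= e by rewrite expr2 ler_piMl// (le_trans ee).
have h2 : C * e ^+ 2 <= C * e by rewrite ler_wpM2l.
have : C * e <= C * e0 by rewrite ler_wpM2l.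
lra.
Qed.

(** Only the distance of [f x] to the nearby planes can move a point away from
    [f x]. The factor in front of [enorm (a - f x)] is exactly 1, so that errors
    add up and do not multiply when the scales are composed. *)
Lemma level_projection_shift x a : core x -> enorm (a - f x) <= s x / 8 ->
  enorm (level_projection a - f x) <=
  enorm (a - f x) + shift_const R N * E x (128 * t) * s x.
Proof.
move=> Yx ax; have t0 := t_gt0; have tR := t_le.
have p_le : 128 * t <= 256 * t by lra.
have p_ge : 128 * t <= 128 * t by [].
have [/andP[e_ge0 e_le] _] := E_qs (core_ball Yx p_le).
set e := E x (128 * t) in e_ge0 e_le *.
have kap0 : 0 <= scale_ratio :> R by exact: le_trans (scale_ratio_ge1 _).
pose act c := share a c != 0.
have sup c : act c -> c \in cs /\ enorm (c - x) + r <= 128 * t.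
  by move=> /(share_support Yx ax)[cin h]; split=> //; rewrite /r; lra.
have frm c : act c -> almost_orthonormal (normal f c r) (frame_const R * e).
  move=> /sup[cin h]; apply: (frame_level Yx p_ge p_le _ h); rewrite /r; lra.
pose K := normal_index (N := N) n.
pose G c := (a - f x) - component (normal f c r) K (a - f x)
            + component (normal f c r) K (f c - f x).
have -> : level_projection a - f x = \sum_(c <- cs) share a c *: G c.
  have sh1 := share_sum Yx ax.
  rewrite /level_projection /average_projection addrAC.
  rewrite -[X in X - _]scale1r -sh1 scaler_suml -sumrB.
  apply: eq_bigr => c _; rewrite -scalerBr /G; congr (_ *: _).
  have -> : a - f c = (a - f x) - (f c - f x) by rewrite opprB addrA subrK.
  by rewrite componentB opprB addrCA addrC.
have S1 : \sum_(c <- cs) `|share a c| = 1.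
  rewrite -(share_sum Yx ax); apply: eq_bigr => c _.
  by rewrite ger0_norm// share_ge0.
rewrite -[leRHS]mul1r -[X in _ <= X * _]S1.
apply: (@enorm_sum_act_le _ _ _ cs act).
- by rewrite addr_ge0 ?enorm_ge0// !mulr_ge0 ?shift_const_ge0// enorm_ge0.
- move=> c ac; have [cin cx] := sup c ac; apply: le_trans (ler_enormD _ _) _.
  apply: lerD.
    apply: (enorm_sub_component _ _ _ _ (frm c ac)).
      by rewrite mulr_ge0 ?frame_const_ge0.
    by apply: frame_eps_le; rewrite e_ge0 e_le.
  apply: (@le_trans _ _ (N%:R * (3 * scale_ratio * scale f k0 x (128 * t) * e))).
    apply: enorm_component_le.
    + by rewrite !mulr_ge0// enorm_ge0.
    + by case: (frm c ac).
    + move=> k nk; apply: (flat_level Yx p_ge p_le _ cx) => //.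
      * by rewrite /r; lra.
      * by rewrite /eball/=; move: cx; rewrite /r; lra.
      * by apply: eball_center; lra.
      * exact: parallel_refl.
      * exact: net_core.
  have h := stretch_level Yx p_ge p_le (c := x).
  have {}h : scale f k0 x (128 * t) <= scale_ratio * s x.
    by apply: h; rewrite subrr enorm0; lra.
  rewrite /shift_const /frame_const -!lock.
  have -> : N%:R * (3 * scale_ratio ^+ 2) * e * s x =
     N%:R * (3 * scale_ratio * (scale_ratio * s x) * e) by ring.
  rewrite ler_wpM2l// ler_wpM2r// ler_wpM2l//.
  by rewrite mulr_ge0.
by move=> c; rewrite negbK => /eqP.
Qed.

(** One step for two points at distance at most [t]. The frame of radius [r / 2]
    at [x] is the one of the next finer scale, where the tangency of the
    difference is known; it is transferred to the frames of the net points. *)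
Section PairStep.
Variables (x y a b : 'rV[R]_N).
Hypotheses (x_core : core x) (y_core : core y).
Hypothesis xy_le : enorm (x - y) <= t.
Hypotheses (a_near : enorm (a - f x) <= s x / 8)
  (b_near : enorm (b - f y) <= s y / 8).
Let p := 256 * t.
Let e := E x p.
Let D := scale f k0 x p.
Hypothesis b_close : enorm (b - f y) <= 3 * shift_const R N * e * D.
Let w := a - b.
Hypothesis w_tangent : forall k : 'I_N, (n <= k)%N ->
  `|dot w (normal f x (r / 2) k)| <= tangent_const R n N * e * enorm w.
Let w' := level_projection a - level_projection b.

Let p_ge : 128 * t <= p. Proof. by have t0 := t_gt0; rewrite /p; lra. Qed.
Let p_le : p <= 256 * t. Proof. by []. Qed.
Let e_bounds : 0 <= e <= e0.
Proof. by have [] := E_qs (core_ball x_core p_le). Qed.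
Let e_ge0 : 0 <= e. Proof. by case/andP: e_bounds. Qed.
Let D_gt0 : 0 < D. Proof. by apply: scale_gt0 => //; have t0 := t_gt0; rewrite /p; lra. Qed.
Let kap0 : 0 <= scale_ratio :> R.
Proof. exact: le_trans (scale_ratio_ge1 _). Qed.
Let frm0 : 0 <= frame_const R * e.
Proof. by rewrite mulr_ge0// frame_const_ge0. Qed.
Let slope0 : 0 <= slope_const R n N * e.
Proof. by rewrite mulr_ge0// slope_const_ge0. Qed.

Let act c := (share a c != 0) || (share b c != 0).

Let act_near c : act c -> c \in cs /\ enorm (c - x) <= 17 * t.
Proof.
have t0 := t_gt0; have xyt := xy_le.
case/orP=> [/(share_support x_core a_near)|/(share_support y_core b_near)][cin h].
  by split=> //; lra.
split=> //; apply: le_trans (ler_enorm_dist _ y _) _.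
by rewrite (enormB y); lra.
Qed.

Let act_frame c : act c -> almost_orthonormal (normal f c r) (frame_const R * e).
Proof.
move=> /act_near[cin h]; have t0 := t_gt0.
by apply: (frame_level x_core p_ge p_le); rewrite /r /p; lra.
Qed.

Let x_frame rho : 32 * t <= rho -> rho <= p ->
  almost_orthonormal (normal f x rho) (frame_const R * e).
Proof.
move=> h1 h2; apply: (frame_level x_core p_ge p_le) => //.
by rewrite subrr enorm0 add0r.
Qed.

Let act_tangent c : act c -> forall k : 'I_N, (n <= k)%N ->
  `|dot w (normal f c r k)| <= slope_const R n N * e * enorm w.
Proof.
move=> /act_near[cin h] k nk; have t0 := t_gt0.
have M0 : 0 <= tangent_const R n N * e * enorm w.
  by rewrite !mulr_ge0 ?enorm_ge0// tangent_const_ge0.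
have uo : almost_orthonormal (normal f x (r / 2)) (frame_const R * e).
  by apply: x_frame; rewrite /r /p; lra.
apply: le_trans (dot_transfer frm0 M0 uo _ _ w_tangent) _.
- exact: enorm_normal.
- move=> l ln; apply: (frames_level x_core p_ge p_le) => //.
  + by rewrite /r; lra.
  + by rewrite /r /p; lra.
  + by rewrite /r; lra.
  + by rewrite subrr enorm0 add0r /r /p; lra.
  + exact: net_core.
rewrite /slope_const -lock; move: (frame_const R) (tangent_const R n N) => A B.
by rewrite le_eqVlt; apply/orP; left; apply/eqP; ring.
Qed.

Let offset := offset_const R N * e * D.

Let offset_ge0 : 0 <= offset.
Proof.
by rewrite /offset mulr_ge0 ?(ltW D_gt0)// mulr_ge0// offset_const_ge0.
Qed.

Let act_offset c : act c -> forall k : 'I_N, (n <= k)%N ->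
  `|dot (b - f c) (normal f c r k)| <= offset.
Proof.
move=> /act_near[cin h] k nk; have t0 := t_gt0; have xyt := xy_le.
have -> : b - f c = (b - f y) + (f y - f c) by rewrite addrA subrK.
rewrite dotDl; apply: le_trans (ler_normD _ _) _.
have h1 := dot_unit_le (b - f y) (enorm_normal f_inj c k r_gt0).
have h2 : `|dot (f y - f c) (normal f c r k)| <= 3 * scale_ratio * D * e.
  apply: (flat_level x_core p_ge p_le) => //.
  - by rewrite /r; lra.
  - by rewrite /r /p; lra.
  - by rewrite /eball/= enormB /p; lra.
  - by rewrite /eball/= /p; lra.
  - exact: net_core.
  - exact: parallel_refl.
apply: le_trans (lerD (le_trans h1 b_close) h2) _.
rewrite /offset /offset_const -lock; move: (shift_const R N) (scale_ratio) => A B.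
by rewrite le_eqVlt; apply/orP; left; apply/eqP; ring.
Qed.

Let shares_close : (\sum_(c <- cs) `|share a c - share b c|) * offset <=
  weight_const R n N * e * enorm w.
Proof.
have t0 := t_gt0.
have wa := weight_total_ge1 x_core a_near.
have wb := weight_total_ge1 y_core b_near.
have h := normalized_weights_close (weight_ge0 b) wa (lt_le_trans ltr01 wb).
have active c : ~~ act c -> weight a c = 0 /\ weight b c = 0.
  rewrite negb_or !negbK !mulf_eq0 !invr_eq0 => /andP[].
  rewrite (gt_eqF (lt_le_trans ltr01 wa)) (gt_eqF (lt_le_trans ltr01 wb)) !orbF.
  by move=> /eqP -> /eqP ->.
have lip c : act c -> `|weight a c - weight b c| <= enorm w * (scale_ratio / D).
  move=> /act_near[cin cx]; apply: le_trans (weight_lipschitz _ _ _) _.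
  rewrite ler_wpM2l ?enorm_ge0// -[leRHS]invrK invf_div lef_pV2 ?posrE//.
    by rewrite ler_pdivrMr ?(lt_le_trans ltr01 (scale_ratio_ge1 _))// mulrC;
       apply: (stretch_level x_core p_ge p_le); rewrite /p; lra.
  by rewrite divr_gt0// (lt_le_trans ltr01 (scale_ratio_ge1 _)).
have cnt : \sum_(c <- cs) `|weight a c - weight b c| <=
    (net_multiplicity (N := N) n)%:R * (enorm w * (scale_ratio / D)).
  have B0 : 0 <= enorm w * (scale_ratio / D).
    by rewrite mulr_ge0 ?enorm_ge0// divr_ge0// ltW.
  apply: le_trans (sum_count_le cs lip _) _.
    by move=> c /active[-> ->]; rewrite subrr normr0.
  rewrite ler_wpM2r// ler_nat; apply: leq_trans (cs_count x).
  by apply: sub_count => c /act_near[_ cx] /=; lra.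
have : (\sum_(c <- cs) `|share a c - share b c|) * offset <=
    2 * ((net_multiplicity (N := N) n)%:R * (enorm w * (scale_ratio / D))) * offset.
  rewrite ler_wpM2r//; apply: le_trans h _; rewrite ler_wpM2l//.
move=> h2; apply: le_trans h2 _.
rewrite /offset /weight_const -lock; move: (offset_const R N) (scale_ratio) => A B.
rewrite le_eqVlt; apply/orP; left; apply/eqP; field.
by rewrite gt_eqF.
Qed.

Lemma pair_step_dist :
  `|enorm w' ^+ 2 - enorm w ^+ 2| <= stretch_const R n N * e ^+ 2 * enorm w ^+ 2.
Proof.
have [th_act th'_act] : (forall c, ~~ act c -> share a c = 0) /\
    (forall c, ~~ act c -> share b c = 0).
  by split=> c; rewrite negb_or !negbK => /andP[/eqP ? /eqP ?].
have g0 : 0 <= weight_const R n N * e by rewrite mulr_ge0 ?weight_const_ge0.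
have := average_projection_dist (share_ge0 a) (share_sum x_core a_near)
  th_act th'_act act_frame slope0 offset_ge0 g0 act_tangent act_offset shares_close.
move/le_trans; apply; rewrite ler_wpM2r ?sqr_ge0// /stretch_const -lock.
move: (slope_const R n N) (weight_const R n N) => A B.
by rewrite le_eqVlt; apply/orP; left; apply/eqP; ring.
Qed.

Lemma pair_step_le : enorm w <= 2 * enorm w'.
Proof.
have := pair_step_dist; rewrite ler_norml => /andP[h _].
have h2 := ler_wpM2r (sqr_ge0 (enorm w)) (stretch_small e_bounds).
rewrite -(@ler_pXn2r _ 2)// ?nnegrE ?mulr_ge0 ?enorm_ge0// exprMn.
by have := sqr_ge0 (enorm w); lra.
Qed.

(** The new slope is relative to the new length, for which [pair_step_le] loses a
    factor 2; this factor is part of [tangent_const]. *)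
Lemma pair_step_tangent (k : 'I_N) : (n <= k)%N ->
  `|dot w' (normal f x r k)| <= tangent_const R n N * e * enorm w'.
Proof.
move=> nk; have t0 := t_gt0.
have [th_act th'_act] : (forall c, ~~ act c -> share a c = 0) /\
    (forall c, ~~ act c -> share b c = 0).
  by split=> c; rewrite negb_or !negbK => /andP[/eqP ? /eqP ?].
have := average_projection_tangent (share_ge0 a) (share_sum x_core a_near)
  th_act th'_act frm0 (frame_eps_le e_bounds) act_frame slope0 offset_ge0
  act_tangent act_offset shares_close (enorm_normal f_inj x k r_gt0).
have fl c : act c -> forall l : 'I_N, (l < n)%N ->
    `|dot (normal f c r l) (normal f x r k)| <= frame_const R * e.
  move=> /act_near[cin cx] l ln.
  apply: (frames_level x_core p_ge p_le) => //.
  - by rewrite /r; lra.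
  - by rewrite subrr enorm0 add0r /r /p; lra.
  - by rewrite /r; lra.
  - by rewrite /r /p; lra.
  - exact: core_net.
move=> /(_ fl) h; apply: le_trans h _.
have [[_ _ _ h2 _] _] := small_excessP e0_small.
have wc0 := weight_const_ge0 R n N; have sc0 := slope_const_ge0 R n N.
have fc0 := frame_const_ge0 R; have uc0 := shift_const_ge0 R N.
have K0 : 0 <= 2 * N%:R * frame_const R + N%:R + N%:R * weight_const R n N.
  apply: addr_ge0; last exact: mulr_ge0.
  by apply: addr_ge0 => //; apply: mulr_ge0 => //; exact: mulr_ge0.
have le1 : N%:R * (N%:R * (frame_const R * e) * (slope_const R n N * e)) <= N%:R * e.
  have c0 : 0 <= N%:R * frame_const R * slope_const R n N by rewrite !mulr_ge0.
  have [_ ee0] := andP e_bounds; have := ler_wpM2l c0 ee0 => h3.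
  have -> : N%:R * (N%:R * (frame_const R * e) * (slope_const R n N * e)) =
    N%:R * e * (N%:R * frame_const R * slope_const R n N * e) by ring.
  by rewrite ler_piMr ?mulr_ge0//; apply: le_trans h2.
apply: (@le_trans _ _ ((2 * N%:R * frame_const R + N%:R
    + N%:R * weight_const R n N) * e * enorm w)).
  rewrite ler_wpM2r ?enorm_ge0//; move: le1.
  move: (frame_const R) (slope_const R n N) (weight_const R n N).
  by move: (N%:R : R) => M A B C; lra.
apply: (@le_trans _ _ ((2 * N%:R * frame_const R + N%:R
    + N%:R * weight_const R n N) * e * (2 * enorm w'))).
  by rewrite ler_wpM2l ?pair_step_le// mulr_ge0.
rewrite mulrA ler_wpM2r ?enorm_ge0// mulrAC ler_wpM2r// /tangent_const -lock.
rewrite [leLHS]mulrC lerDl mulr_ge0//; first exact: mulr_ge0.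
by apply: addr_ge0; apply: mulr_ge0.
Qed.

End PairStep.

End Level.

(** * Descent through the scales *)

Section Descent.
Context {R : realType} {N : nat}.
Variables (n : nat) (f : 'rV[R]_N -> 'rV[R]_N) (k0 : 'I_N).
Hypothesis f_inj : injective f.
Variables (x0 : 'rV[R]_N) (R0 e0 : R).
Hypothesis R0_gt0 : 0 < R0.
Hypothesis e0_small : small_excess n N e0.
Hypothesis q0 : weakly_qs f (eball x0 R0) e0.
Variable E : 'rV[R]_N -> R -> R.
Hypothesis E_qs : forall x s, eball x s `<=` eball x0 R0 ->
  0 <= E x s <= e0 /\ weakly_qs f (eball x s) (E x s).
Hypothesis E_mono : forall x y s s', eball x s `<=` eball y s' ->
  eball y s' `<=` eball x0 R0 -> E x s <= E y s'.

Definition step j : R := R0 / 1024 / 2 ^+ j.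

Variable cs : nat -> seq 'rV[R]_N.
Hypothesis cs_near : forall j (c : 'rV[R]_N), c \in cs j ->
  parallel n x0 c /\ enorm (c - x0) <= R0 / 512.
Hypothesis cs_net : forall j (x : 'rV[R]_N), parallel n x0 x ->
  enorm (x - x0) <= R0 / 1024 -> exists2 c, c \in cs j & enorm (c - x) <= step j.
Hypothesis cs_count : forall j (x : 'rV[R]_N),
  (count (fun c : 'rV[R]_N => enorm (c - x) <= 33 * step j)%R (cs j)
    <= net_multiplicity (N := N) n)%N.
Implicit Types (x y : 'rV[R]_N) (j d K m : nat).

Let unit_gt0 : 0 < R0 / 1024. Proof. by have := R0_gt0; lra. Qed.

Let step_gt0 j : 0 < step j.
Proof.
by rewrite /step; move: (R0 / 1024) unit_gt0 => c c0; rewrite divr_gt0 ?exprn_gt0.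
Qed.

Let stepS j : step j = 2 * step j.+1.
Proof.
rewrite /step exprS; move: (R0 / 1024) => c; field.
by rewrite expf_neq0.
Qed.

Let step_anti i j : (i <= j)%N -> step j <= step i.
Proof.
move=> ij; rewrite /step; move: (R0 / 1024) unit_gt0 => c c0.
rewrite ler_wpM2l ?(ltW c0)// lef_pV2 ?posrE ?exprn_gt0//.
by rewrite ler_weXn2l// ler1n.
Qed.

Let step_le j : step j <= R0 / 1024.
Proof. by have := step_anti (leq0n j); rewrite {2}/step expr0 divr1. Qed.

Let step_le_R0 j : 1024 * step j <= R0.
Proof. by have := step_le j; lra. Qed.

Let step_128 j : 128 * step j <= R0 / 2.
Proof. by have := step_le j; have := R0_gt0; lra. Qed.

Let step_256 j : 256 * step j <= R0 / 2.
Proof. by have := step_le j; have := R0_gt0; lra. Qed.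

Let Core := core n x0 R0.
Let P j := level_projection n f k0 (step j) (cs j).
Let s x j := stretch f k0 x (step j).
Let C1 := shift_const R N.

Let C1_ge0 : 0 <= C1. Proof. exact: shift_const_ge0. Qed.
Let C1e0 : 16 * C1 * e0 <= 1. Proof. by have [_ []] := small_excessP e0_small. Qed.
Let e01 : 0 <= e0 <= 1. Proof. by have [[]] := small_excessP e0_small. Qed.

Let core_ball x p : Core x -> p <= R0 / 2 -> eball x p `<=` eball x0 R0.
Proof. by move=> [_ xR] pR; apply: eball_sub; have := R0_gt0; lra. Qed.

Let E_core x p : Core x -> p <= R0 / 2 ->
  0 <= E x p <= e0 /\ weakly_qs f (eball x p) (E x p).
Proof. by move=> Yx pR; exact/E_qs/core_ball. Qed.

Let s_gt0 x j : 0 < s x j. Proof. exact: stretch_gt0. Qed.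

Let s_succ x j : Core x -> s x j.+1 <= 2 / 3 * s x j.
Proof.
move=> Yx; have [e00 _] := andP e01.
have [[_ Ne _ _ _] _] := small_excessP e0_small.
have Ne' : N%:R * e0 <= 10000^-1 by lra.
have := @stretch_pow_ge _ _ _ f_inj e0 k0 x0 R0 x (step j.+1) 1 q0 e00 Ne'
  (step_gt0 _).
rewrite !expr1 -stepS; apply.
by have := step_le j; case: Yx => _; have := R0_gt0; lra.
Qed.

(** The image of [f x] under the projections at the scales [j], ..., [j + d - 1],
    the finest one being applied first. *)
Fixpoint descend j d x : 'rV[R]_N :=
  if d is d'.+1 then P j (descend j.+1 d' x) else f x.

Let E_decr x j : Core x -> E x (128 * step j.+1) <= E x (128 * step j).
Proof.
move=> Yx; apply: E_mono.
  by apply: eball_sub; rewrite subrr enorm0 add0r (stepS j); have := step_gt0 j.+1; lra.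
exact: core_ball.
Qed.

(** Since the images shrink geometrically with the scale, the successive
    displacements add up to a multiple of the last one. *)
Lemma descend_close d j x : Core x ->
  enorm (descend j d x - f x) <= 3 * C1 * E x (128 * step j) * s x j.
Proof.
move=> Yx; elim: d j => [|d IH] j /=.
  rewrite subrr enorm0 !mulr_ge0//; last by rewrite ltW.
  by have [/andP[]] := E_core Yx (step_128 j).
have [/andP[E0 Ee] _] := E_core Yx (step_128 j).
have close : enorm (descend j.+1 d x - f x) <= 2 * C1 * E x (128 * step j) * s x j.
  apply: le_trans (IH j.+1) _.
  have := s_succ j Yx; have := E_decr j Yx.
  have [/andP[E1 _] _] := E_core Yx (step_128 j.+1).
  move: (E x (128 * step j)) (E x (128 * step j.+1)) (s_gt0 x j) (s_gt0 x j.+1)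
    E0 E1 => a b; move: (s x j) (s x j.+1) => u v u0 v0 a0 b0 ba vu.
  have h1 : b * v <= a * (2 / 3 * u) by apply: ler_pM => //; exact: ltW.
  have := ler_wpM2l C1_ge0 h1; lra.
have near : enorm (descend j.+1 d x - f x) <= s x j / 8.
  apply: le_trans close _; move: C1e0 Ee C1_ge0 (s_gt0 x j).
  move: (E x _) E0 (s x j) => a a0 u h ae c0 u0.
  have h1 : 2 * C1 * a <= 8^-1 by have := ler_wpM2l c0 ae; lra.
  by rewrite mulrC ler_wpM2l// ltW.
have := level_projection_shift f_inj e0_small q0 E_qs (step_gt0 j) (step_le_R0 j)
  (@cs_near j) (@cs_net j) Yx near.
rewrite -/(P j) => h; apply: le_trans h _.
by move: close; rewrite -/(s x j) -/C1; lra.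
Qed.

Let descend_near d j x : Core x ->
  enorm (descend j.+1 d x - f x) <= s x j / 8.
Proof.
move=> Yx; apply: le_trans (descend_close d j.+1 Yx) _.
have [/andP[E0 Ee] _] := E_core Yx (step_128 j.+1).
move: (s_succ j Yx) C1e0 Ee C1_ge0 (s_gt0 x j) (s_gt0 x j.+1).
move: (E x _) E0 (s x j) (s x j.+1) => a a0 u v vu h ae c0 u0 v0.
have h1 : 3 * C1 * a <= 3 / 16 by have := ler_wpM2l c0 ae; lra.
have : 3 * C1 * a * v <= 3 / 16 * v by rewrite ler_wpM2r// ltW.
lra.
Qed.

Let image_diam x j a b : Core x ->
  eball x (256 * step j) a -> eball x (256 * step j) b ->
  enorm (f a - f b) <= scale f k0 x (256 * step j).
Proof.
move=> Yx; have [/andP[E0 E1] qB] := E_core Yx (step_256 j).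
have p0 : 0 <= 256 * step j by have := step_gt0 j; lra.
have eB : 0 <= E x (256 * step j) <= 1.
  by rewrite E0 (le_trans E1)//; case/andP: e01.
by move=> Ba Bb; exact: (scale_diam k0 qB eB p0 Ba Bb).
Qed.

(** The displacements of [y] up to the scale [step j] are measured by the excess
    on a larger ball around a point [x] near [y]. *)
Let close_around x y d j i : Core x -> Core y -> (j <= i)%N ->
  enorm (x - y) <= 2 * step j ->
  enorm (descend i d y - f y)
    <= 3 * C1 * E x (256 * step j) * scale f k0 x (256 * step j).
Proof.
move=> Yx Yy ji xyj; apply: le_trans (descend_close d i Yy) _.
have ti := step_gt0 i; have tij := step_anti ji.
have sub : eball y (128 * step i) `<=` eball x (256 * step j).
  by apply: eball_sub; rewrite enormB; lra.
have Ey : E y (128 * step i) <= E x (256 * step j).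
  by apply: E_mono sub _; exact: core_ball.
have sy : s y i <= scale f k0 x (256 * step j).
  apply: image_diam => //; apply: sub; last by apply: eball_center; lra.
  by apply: eballP; rewrite ?ger0_norm; lra.
have [/andP[E0 _] _] := E_core Yy (step_128 i).
rewrite -!mulrA ler_wpM2l// ler_wpM2l//.
by apply: ler_pM => //; exact/ltW/s_gt0.
Qed.

Section Pair.
Variables (x y : 'rV[R]_N) (K m : nat).
Hypotheses (x_core : Core x) (y_core : Core y) (mK : (m < K)%N).
Hypotheses (xy_le : enorm (x - y) <= step m)
  (xy_gt : step m.+1 < enorm (x - y)).

Let e j := E x (256 * step j).
Let D j := scale f k0 x (256 * step j).
Let w j := descend j (K - j) x - descend j (K - j) y.
Let T j := forall k : 'I_N, (n <= k)%N ->
  `|dot (w j) (normal f x (64 * step j) k)| <= tangent_const R n N * e j * enorm (w j).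

Let e_bounds j : 0 <= e j <= e0.
Proof. by have [] := E_core x_core (step_256 j). Qed.

Let e_decr j : e j.+1 <= e j.
Proof.
apply: E_mono.
  by apply: eball_sub; rewrite subrr enorm0 add0r (stepS j); have := step_gt0 j.+1; lra.
exact: core_ball.
Qed.

Let step_ge j : (j <= m)%N -> enorm (x - y) <= step j.
Proof.
by move=> jm; apply: le_trans xy_le (step_anti jm).
Qed.

Let w_step j : (j <= m)%N ->
  w j = P j (descend j.+1 (K - j.+1) x) - P j (descend j.+1 (K - j.+1) y).
Proof.
move=> jm; have -> // : w j = descend j (K - j.+1).+1 x - descend j (K - j.+1).+1 y.
by rewrite /w subnSK// (leq_ltn_trans jm).
Qed.

Let w_pair j (jm : (j <= m)%N) (Tj : T j.+1) :
  `|enorm (w j) ^+ 2 - enorm (w j.+1) ^+ 2|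
     <= stretch_const R n N * e j ^+ 2 * enorm (w j.+1) ^+ 2 /\ T j.
Proof.
have xyj := step_ge jm.
have yc : enorm (descend j.+1 (K - j.+1) y - f y) <= 3 * C1 * e j * D j.
  by apply: close_around => //; have := step_gt0 j; lra.
have half : 64 * step j / 2 = 64 * step j.+1 by rewrite (stepS j); field.
have wt (k : 'I_N) : (n <= k)%N ->
    `|dot (w j.+1) (normal f x (64 * step j / 2) k)| <=
    tangent_const R n N * e j * enorm (w j.+1).
  move=> nk; rewrite half; apply: le_trans (Tj k nk) _.
  rewrite ler_wpM2r ?enorm_ge0// ler_wpM2l ?tangent_const_ge0//.
rewrite /T w_step//; split.
  exact: (pair_step_dist f_inj e0_small q0 E_qs (step_gt0 j) (step_le_R0 j)
    (@cs_near j) (@cs_net j) (@cs_count j) x_core y_core xyj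
    (descend_near _ _ x_core) (descend_near _ _ y_core) yc wt).
move=> k nk.
exact: (pair_step_tangent f_inj e0_small q0 E_qs (step_gt0 j) (step_le_R0 j)
    (@cs_near j) (@cs_net j) (@cs_count j) x_core y_core xyj
    (descend_near _ _ x_core) (descend_near _ _ y_core) yc wt nk).
Qed.

Let d := f x - f y.
Let t0 := step_gt0 m.+1.
Let sc1 : 128 * step m.+1 <= 256 * step m.+1. Proof. by have := t0; lra. Qed.
Let sc2 : 256 * step m.+1 <= 256 * step m.+1. Proof. by []. Qed.

Let scale_le : D m.+1 <= 2 * scale_ratio * enorm d.
Proof.
have k0' : 0 <= scale_ratio :> R := le_trans ler01 (scale_ratio_ge1 _).
have := stretch_level (c := x) k0 e0_small E_qs t0 (step_le_R0 _) x_core sc1 sc2.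
rewrite subrr enorm0 => h.
have {}h : D m.+1 <= scale_ratio * s x m.+1 by apply: h; have := t0; lra.
have sub := core_ball x_core (step_256 m.+1).
have sd : s x m.+1 <= 2 * enorm d.
  have Bx : eball x0 R0 x by apply/sub/eball_center; have := t0; lra.
  have By : eball x0 R0 y.
    by apply: sub; rewrite /eball/= enormB; have := xy_le; rewrite (stepS m); have := t0; lra.
  have Bt : eball x0 R0 (x + step m.+1 *: delta_mx 0 k0).
    by apply/sub/eballP; rewrite ?ger0_norm; have := t0; lra.
  have := q0 Bt By Bx; rewrite [x + _ - _]addrC addKr enorm_scale_delta ?(ltW t0)//.
  rewrite (enormB y) => /(_ (ltW xy_gt)) h1; apply: le_trans h1 _.
  rewrite (enormB (f y)) -/d ler_wpM2r ?enorm_ge0//; case/andP: e01; lra.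
by apply: le_trans h _; rewrite [X in _ <= X * _]mulrC -mulrA ler_wpM2l.
Qed.

(** At the first scale below [enorm (x - y)] the difference is still close to
    [f x - f y], which is tangent by flatness. *)
Let start_close : enorm (w m.+1 - d) <= 6 * C1 * e m.+1 * D m.+1.
Proof.
have xy2 : enorm (x - y) <= 2 * step m.+1 by rewrite -stepS; exact: xy_le.
have hy := close_around (K - m.+1) x_core y_core (leqnn m.+1) xy2.
have := close_around (K - m.+1) x_core x_core (leqnn m.+1).
rewrite subrr enorm0 => hx.
have {}hx := hx _; have {}hx : enorm (descend m.+1 (K - m.+1) x - f x) <=
    3 * C1 * e m.+1 * D m.+1 by apply: hx; have := t0; lra.
have -> : w m.+1 - d = (descend m.+1 (K - m.+1) x - f x)
    - (descend m.+1 (K - m.+1) y - f y).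
  by rewrite /w /d; apply/rowP => i; rewrite !mxE; ring.
apply: le_trans (ler_enormD _ _) _; rewrite enormN.
by move: hx hy; rewrite /e /D; lra.
Qed.

Let start_dist : enorm (w m.+1 - d) <= 2^-1 * enorm d.
Proof.
have [/andP[e_ge0 e_le] k0'] := (e_bounds m.+1, le_trans ler01 (scale_ratio_ge1 R)).
have [_ [h _ _]] := small_excessP e0_small; rewrite -/C1 in h.
apply: le_trans start_close _.
have c0 : 0 <= 6 * C1 * e m.+1 by rewrite !mulr_ge0.
apply: (@le_trans _ _ (6 * C1 * e m.+1 * (2 * scale_ratio * enorm d))).
  by rewrite ler_wpM2l.
have c1 : 0 <= 12 * C1 * scale_ratio by rewrite !mulr_ge0.
have -> : 6 * C1 * e m.+1 * (2 * scale_ratio * enorm d) =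
  12 * C1 * scale_ratio * e m.+1 * enorm d by ring.
rewrite ler_wpM2r ?enorm_ge0//.
have := ler_wpM2l c1 e_le; lra.
Qed.

Let start_le : enorm d <= 2 * enorm (w m.+1) /\ enorm (w m.+1) <= 3 / 2 * enorm d.
Proof.
have h := start_dist; have := ler_enorm_dist d (w m.+1) 0.
rewrite !subr0 (enormB d) => h1; have := ler_enorm_dist (w m.+1) d 0.
by rewrite !subr0; split; lra.
Qed.

Let start_tangent : T m.+1.
Proof.
move=> k nk; have k0' : 0 <= scale_ratio :> R := le_trans ler01 (scale_ratio_ge1 _).
have /andP[e_ge0 e_le] := e_bounds m.+1.
have -> : dot (w m.+1) (normal f x (64 * step m.+1) k) =
    dot (w m.+1 - d) (normal f x (64 * step m.+1) k) +
    dot d (normal f x (64 * step m.+1) k) by rewrite -dotDl subrK.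
apply: le_trans (ler_normD _ _) _.
have u1 : enorm (normal f x (64 * step m.+1) k) = 1.
  by apply: enorm_normal => //; have := t0; lra.
have h1 := le_trans (dot_unit_le (w m.+1 - d) u1) start_close.
have h2 : `|dot d (normal f x (64 * step m.+1) k)| <= 3 * scale_ratio * D m.+1 * e m.+1.
  apply: (flat_level k0 f_inj e0_small E_qs t0 (step_le_R0 _) x_core sc1 sc2) => //.
  - by have := t0; lra.
  - by rewrite subrr enorm0; have := t0; lra.
  - by apply: eball_center; have := t0; lra.
  - by rewrite /eball/= enormB; have := xy_le; rewrite (stepS m); have := t0; lra.
  - exact: parallel_refl.
  - exact: parallel_join x_core.1 y_core.1.
apply: le_trans (lerD h1 h2) _.
have A0 : 0 <= (6 * C1 + 3 * scale_ratio) * e m.+1.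
  by rewrite mulr_ge0// addr_ge0// mulr_ge0.
have := ler_wpM2l A0 scale_le => h3.
have A1 : 0 <= (6 * C1 + 3 * scale_ratio) * e m.+1 * (2 * scale_ratio).
  by rewrite mulr_ge0// mulr_ge0.
have := ler_wpM2l A1 start_le.1 => h4.
have -> : 6 * C1 * e m.+1 * D m.+1 + 3 * scale_ratio * D m.+1 * e m.+1 =
   (6 * C1 + 3 * scale_ratio) * e m.+1 * D m.+1 by ring.
apply: le_trans h3 _; rewrite mulrA; apply: le_trans h4 _.
have -> : (6 * C1 + 3 * scale_ratio) * e m.+1 * (2 * scale_ratio) * (2 * enorm (w m.+1))
  = 4 * scale_ratio * (6 * C1 + 3 * scale_ratio) * (e m.+1 * enorm (w m.+1)) by ring.
rewrite -[leRHS]mulrA ler_wpM2r ?mulr_ge0 ?enorm_ge0// /tangent_const -lock -/C1 lerDr.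
have := weight_const_ge0 R n N; have := frame_const_ge0 R => *.
by rewrite mulr_ge0// !addr_ge0// ?mulr_ge0// mulr_ge0.
Qed.

Let C5 := stretch_const R n N.
Let C5_ge0 : 0 <= C5. Proof. exact: stretch_const_ge0. Qed.
Let growth j := expR (2 * C5 * \sum_(j <= i < m.+1) e i ^+ 2).

Let growth_pred j : (j <= m)%N ->
  growth j = expR (2 * C5 * e j ^+ 2) * growth j.+1.
Proof. by move=> jm; rewrite /growth big_ltn// mulrDr expRD. Qed.

(** Induction from fine to coarse scales: tangency gives the length estimate of
    the next step, which in turn gives tangency there. *)
Let descend_chain i : (i <= m.+1)%N -> T (m.+1 - i) /\
  enorm (w (m.+1 - i)) ^+ 2 <= growth (m.+1 - i) * enorm (w m.+1) ^+ 2 /\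
  enorm (w m.+1) ^+ 2 <= growth (m.+1 - i) * enorm (w (m.+1 - i)) ^+ 2.
Proof.
elim: i => [_|i IH im].
  by rewrite subn0 /growth big_geq// mulr0 expR0 !mul1r; do !split.
have {IH}[Tj [h1 h2]] := IH (ltnW im); pose j := (m.+1 - i.+1)%N.
have jE : (m.+1 - i)%N = j.+1 by rewrite /j subnS prednK// subn_gt0.
have jm : (j <= m)%N by rewrite /j subSS leq_subr.
rewrite -/j; rewrite jE in Tj h1 h2.
have [] := w_pair jm Tj; rewrite -/C5 ler_norml => /andP[g1 g2] Tj'.
split=> //; rewrite growth_pred//.
have Ce : C5 * e j ^+ 2 <= 2^-1 := stretch_small e0_small (e_bounds j).
have q : 0 <= C5 * e j ^+ 2 by rewrite mulr_ge0// sqr_ge0.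
have ex := expR_ge1Dx (2 * C5 * e j ^+ 2).
have w0 := sqr_ge0 (enorm (w j)); have w1 := sqr_ge0 (enorm (w j.+1)).
have gr : 0 < growth j.+1 := expR_gt0 _.
split.
  apply: (@le_trans _ _ (expR (2 * C5 * e j ^+ 2) * enorm (w j.+1) ^+ 2)).
    apply: (@le_trans _ _ ((1 + 2 * C5 * e j ^+ 2) * enorm (w j.+1) ^+ 2)).
      have := mulr_ge0 q w1; lra.
    by rewrite ler_wpM2r.
  by rewrite -[leRHS]mulrA ler_wpM2l ?expR_ge0.
apply: le_trans h2 _; rewrite [X in _ <= X * _]mulrC -[leRHS]mulrA ler_wpM2l ?(ltW gr)//.
apply: (@le_trans _ _ ((1 + 2 * C5 * e j ^+ 2) * enorm (w j) ^+ 2)); last first.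
  by rewrite ler_wpM2r.
have -> : 2 * C5 * e j ^+ 2 = 2 * (C5 * e j ^+ 2) by rewrite mulrA.
move: g1 Ce q; move: (C5 * e j ^+ 2) => z g1 Ce q.
set W := enorm (w j) ^+ 2 in w0 g1 *; set V := enorm (w j.+1) ^+ 2 in w1 g1 *.
have VW : V * (1 - z) <= W by lra.
have z1 : 0 <= 1 + 2 * z by lra.
have z2 : 0 <= 1 - 2 * z by lra.
have := ler_wpM2l z1 VW; have := mulr_ge0 (mulr_ge0 q z2) w1; rewrite -/V.
lra.
Qed.

(** At the coarsest scale tangency is transferred to the frame at [x0], the same
    for all pairs of points. *)
Let final_tangent (k : 'I_N) : (n <= k)%N ->
  `|dot (w 0) (normal f x0 (64 * step 0) k)|
    <= slope_const R n N * e0 * enorm (w 0).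
Proof.
move=> nk; have [Tw _] := descend_chain (leqnn m.+1); rewrite subnn in Tw.
have u0 := step_gt0 0.
have s1 : 128 * step 0 <= 256 * step 0 by lra.
have s2 : 256 * step 0 <= 256 * step 0 by [].
have /andP[e_ge0 e_le] := e_bounds 0.
have fc0 := frame_const_ge0 R; have tc0 := tangent_const_ge0 R n N.
have eta0 : 0 <= frame_const R * e 0 by rewrite mulr_ge0.
have M0 : 0 <= tangent_const R n N * e 0 * enorm (w 0).
  by rewrite !mulr_ge0 ?enorm_ge0.
have x0R : enorm (x0 - x) <= step 0.
  by rewrite enormB /step expr0 divr1; case: x_core => _; have := R0_gt0; lra.
have uo : almost_orthonormal (normal f x (64 * step 0)) (frame_const R * e 0).
  apply: (frame_level k0 f_inj e0_small E_qs u0 (step_le_R0 0) x_core s1 s2).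
    by lra.
  by rewrite subrr enorm0; lra.
have u1 : enorm (normal f x0 (64 * step 0) k) = 1.
  by apply: enorm_normal => //; lra.
apply: le_trans (dot_transfer eta0 M0 uo u1 _ Tw) _.
  move=> l ln.
  apply: (frames_level k0 f_inj e0_small E_qs u0 (step_le_R0 0) x_core s1 s2) => //.
  - by lra.
  - by lra.
  - by lra.
  - by rewrite subrr enorm0; lra.
  - exact: x_core.1.
have -> : 2 * N%:R * (frame_const R * e 0) * enorm (w 0)
    + N%:R * (tangent_const R n N * e 0 * enorm (w 0)) =
    slope_const R n N * e 0 * enorm (w 0) by rewrite /slope_const -lock; ring.
rewrite ler_wpM2r ?enorm_ge0// ler_wpM2l//; exact: slope_const_ge0.
Qed.

Hypothesis nN : (n <= N)%N.

Definition coordinates (v : 'rV[R]_N) : 'rV[R]_n :=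
  \row_l dot v (normal f x0 (64 * step 0) (widen_ord nN l)).

Lemma coordinatesB u v : coordinates (u - v) = coordinates u - coordinates v.
Proof. by apply/rowP => l; rewrite !mxE dotBl. Qed.

(** A vector that is almost orthogonal to the normal directions keeps its length,
    up to a factor, in the tangent coordinates. *)
Let coordinates_dist : enorm (w 0) ^+ 2 <= 2 * enorm (coordinates (w 0)) ^+ 2 /\
  enorm (coordinates (w 0)) ^+ 2 <= 3 / 2 * enorm (w 0) ^+ 2.
Proof.
have cx0 : Core x0.
  split; first exact: parallel_refl.
  by rewrite subrr enorm0; have := R0_gt0; lra.
have u0 := step_gt0 0.
have s1 : 128 * step 0 <= 128 * step 0 by [].
have s2 : 128 * step 0 <= 256 * step 0 by lra.
have [/andP[e_ge0 e_le] _] := E_core cx0 (step_128 0).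
set a := E x0 _ in e_ge0 e_le.
have uo : almost_orthonormal (normal f x0 (64 * step 0)) (frame_const R * a).
  apply: (frame_level k0 f_inj e0_small E_qs u0 (step_le_R0 0) cx0 s1 s2).
    by lra.
  by rewrite subrr enorm0; lra.
have fc0 := frame_const_ge0 R; have sc0 := slope_const_ge0 R n N.
have eta0 : 0 <= frame_const R * a by rewrite mulr_ge0.
have := almost_orthonormal_parseval (w 0) (w 0) eta0 uo.
have [[/andP[e00 e1] _ h1 _ _] [_ h2 _]] := small_excessP e0_small.
pose W := enorm (w 0) ^+ 2; pose u := normal f x0 (64 * step 0).
have W0 : 0 <= W by exact: sqr_ge0.
have -> : \sum_k dot (w 0) (u k) * dot (u k) (w 0) =
   enorm (coordinates (w 0)) ^+ 2 + \sum_(k : 'I_N | ~~ (k < n)%N) dot (w 0) (u k) ^+ 2.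
  rewrite (bigID (fun k : 'I_N => (k < n)%N)) /= enormE; congr (_ + _).
    rewrite big_ord_narrow; apply: eq_bigr => l _.
    by rewrite !mxE (dotC (u _)).
  by apply: eq_bigr => k _; rewrite (dotC (u _)) expr2.
set S := \sum_(k | _) _ => par.
have S0 : 0 <= S by apply: sumr_ge0 => k _; exact: sqr_ge0.
have SW : S <= 4^-1 * W.
  apply: (@le_trans _ _ (N%:R * (slope_const R n N * e0 * enorm (w 0)) ^+ 2)).
    apply: sumr_le_card => [|k nk]; first exact: sqr_ge0.
    by apply: sqr_le_norm; apply: final_tangent; rewrite leqNgt.
  rewrite exprMn mulrA ler_wpM2r// exprMn.
  have q : 0 <= N%:R * slope_const R n N ^+ 2 by rewrite mulr_ge0 ?sqr_ge0.
  have e2 : e0 ^+ 2 <= e0 by rewrite expr2 ler_piMl.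
  have := ler_wpM2l q e2; lra.
have NW : N%:R * (frame_const R * a) * enorm (w 0) * enorm (w 0) <= 4^-1 * W.
  rewrite -[leLHS]mulrA -expr2 ler_wpM2r//.
  have q : 0 <= N%:R * frame_const R by rewrite mulr_ge0.
  have := ler_wpM2l q e_le; lra.
have WE : dot (w 0) (w 0) = W by rewrite -enormE.
rewrite WE in par; have := le_trans par NW; rewrite ler_norml => /andP[p1 p2].
by rewrite -/W; split; lra.
Qed.

(** At all scales above [enorm (x - y)] the difference of the two points stays
    tangent, and its length changes by factors whose product converges. *)
Lemma descend_bilipschitz :
  let g z := coordinates (descend 0 K z) in
  let S := expR (2 * stretch_const R n N * \sum_(i < K) E x (256 * step i) ^+ 2) in
  enorm (f x - f y) ^+ 2 <= 8 * S * enorm (g x - g y) ^+ 2 /\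
  enorm (g x - g y) ^+ 2 <= 8 * S * enorm (f x - f y) ^+ 2.
Proof.
move=> g S; have -> : g x - g y = coordinates (w 0).
  by rewrite -coordinatesB /w subn0.
have [_] := descend_chain (leqnn m.+1); rewrite subnn => -[h1 h2].
have [c1 c2] := coordinates_dist; have [d1 d2] := start_le; rewrite -/d.
have gS : growth 0 <= S.
  rewrite ler_expR ler_wpM2l ?mulr_ge0//.
  rewrite -(big_mkord xpredT (fun i => e i ^+ 2)).
  have -> : \sum_(0 <= i < K) e i ^+ 2 =
    \sum_(0 <= i < m.+1) e i ^+ 2 + \sum_(m.+1 <= i < K) e i ^+ 2.
    exact: big_cat_nat.
  by rewrite lerDl sumr_ge0// => i _; exact: sqr_ge0.
have D2 : enorm d ^+ 2 <= 4 * enorm (w m.+1) ^+ 2.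
  have := enorm_ge0 d; have := enorm_ge0 (w m.+1); nra.
have D3 : enorm (w m.+1) ^+ 2 <= 9 / 4 * enorm d ^+ 2.
  have := enorm_ge0 d; have := enorm_ge0 (w m.+1); nra.
have G0 : 0 < growth 0 := expR_gt0 _.
move: (sqr_ge0 (enorm d)) (sqr_ge0 (enorm (w m.+1))) (sqr_ge0 (enorm (w 0)))
  (sqr_ge0 (enorm (coordinates (w 0)))) h1 h2 c1 c2 D2 D3.
move: (enorm d ^+ 2) (enorm (w m.+1) ^+ 2) (enorm (w 0) ^+ 2)
  (enorm (coordinates _) ^+ 2) => A B C Z A0 B0 C0 Z0 h1 h2 c1 c2 D2 D3.
have q1 := ler_wpM2r Z0 gS; have q2 := ler_wpM2r A0 gS.
have q3 := ler_wpM2l (ltW G0) c1; have q4 := ler_wpM2l (ltW G0) D3.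
split; lra.
Qed.

End Pair.

End Descent.

(** * Passing to the limit *)

Lemma ultra_fmap {T S : Type} (F : set_system T) (u : T -> S) :
  UltraFilter F -> UltraFilter (u @ F).
Proof.
move=> FU; split; first exact: fmap_proper_filter.
move=> G GF sub; apply/seteqP; split=> [A GA|]; last exact: sub.
have [//|FC] := in_ultra_setVsetC (u @^-1` A) FU.
have GC : G (~` A) by exact: sub.
by have [x []] := filter_ex (filterI GA GC).
Qed.

Lemma bounded_ultra_cvg {R : realType} {T : Type} (F : set_system T)
    (u : T -> R) (B : R) :
  UltraFilter F -> (forall K, `|u K| <= B) -> cvg (u @ F).
Proof.
move=> FU uB; have := @segment_compact R (- B) B; rewrite compact_ultra.
have FB : F (u @^-1` [set` `[- B, B]]).
  by apply: filterE => K; have := uB K; rewrite ler_norml /= in_itv.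
move=> /(_ (u @ F) (ultra_fmap u FU) FB) [].
by move=> l [_ ul]; apply/cvg_ex; exists l.
Qed.

Section Limit.
Context {R : realType} {N : nat}.
Variables (n : nat) (f : 'rV[R]_N -> 'rV[R]_N) (k0 : 'I_N).
Hypothesis f_inj : injective f.
Variables (x0 : 'rV[R]_N) (R0 e0 : R).
Hypothesis R0_gt0 : 0 < R0.
Hypothesis e0_small : small_excess n N e0.
Hypothesis q0 : weakly_qs f (eball x0 R0) e0.
Variable E : 'rV[R]_N -> R -> R.
Hypothesis E_qs : forall x s, eball x s `<=` eball x0 R0 ->
  0 <= E x s <= e0 /\ weakly_qs f (eball x s) (E x s).
Hypothesis E_mono : forall x y s s', eball x s `<=` eball y s' ->
  eball y s' `<=` eball x0 R0 -> E x s <= E y s'.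
Hypothesis nN : (n <= N)%N.
Variable A : R.
Hypothesis E_sum : forall x K, core n x0 R0 x ->
  \sum_(i < K) E x (256 * step R0 i) ^+ 2 <= A.

Let step_gt0 j : 0 < step R0 j.
Proof.
have : 0 < R0 / 1024 by have := R0_gt0; lra.
by rewrite /step; move: (R0 / 1024) => c c0; rewrite divr_gt0 ?exprn_gt0.
Qed.

Let step_le j : step R0 j <= R0 / 1024.
Proof.
have : 0 < R0 / 1024 by have := R0_gt0; lra.
rewrite /step; move: (R0 / 1024) => c c0.
rewrite ler_pdivrMr ?exprn_gt0// ler_peMr ?(ltW c0)//.
by rewrite exprn_ege1// ler1n.
Qed.

Let nets : exists cs : nat -> seq 'rV[R]_N, forall j,
  [/\ forall c : 'rV[R]_N, c \in cs j -> parallel n x0 c /\ enorm (c - x0) <= R0 / 512,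
      forall x : 'rV[R]_N, parallel n x0 x -> enorm (x - x0) <= R0 / 1024 ->
        exists2 c : 'rV[R]_N, c \in cs j & enorm (c - x) <= step R0 j &
      forall x : 'rV[R]_N,
        (count (fun c : 'rV[R]_N => enorm (c - x) <= 33 * step R0 j)%R (cs j)
           <= net_multiplicity (N := N) n)%N].
Proof.
have N0 : (0 < N)%N by exact: leq_ltn_trans (leq0n _) (ltn_ord k0).
have c0 : 0 <= R0 / 1024 by have := R0_gt0; lra.
pose P (j : nat) (cs : seq 'rV[R]_N) :=
  [/\ forall c : 'rV[R]_N, c \in cs -> parallel n x0 c /\ enorm (c - x0) <= R0 / 512,
      forall x : 'rV[R]_N, parallel n x0 x -> enorm (x - x0) <= R0 / 1024 ->
        exists2 c : 'rV[R]_N, c \in cs & enorm (c - x) <= step R0 j &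
      forall x : 'rV[R]_N,
        (count (fun c : 'rV[R]_N => enorm (c - x) <= 33 * step R0 j)%R cs
           <= net_multiplicity (N := N) n)%N].
have [|cs hcs] := boolp.choice (P := P); last by exists cs.
move=> j.
have [cs [h1 h2 h3]] := exists_net x0 N0 nN (step_gt0 j) c0.
exists cs; split=> // c /h1[pc cR]; split=> //.
by have := step_le j; lra.
Qed.

(** A pointwise limit, along an ultrafilter, of the maps obtained by descending
    from finer and finer scales; all of them satisfy the same bounds at a fixed
    pair of points once the starting scale is finer than their distance. *)
Lemma local_flattening : exists G : 'rV[R]_N -> 'rV[R]_n, forall x y,
  core n x0 R0 x -> core n x0 R0 y ->
  enorm (f x - f y) ^+ 2
    <= 8 * expR (2 * stretch_const R n N * A) * enorm (G x - G y) ^+ 2 /\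
  enorm (G x - G y) ^+ 2
    <= 8 * expR (2 * stretch_const R n N * A) * enorm (f x - f y) ^+ 2.
Proof.
have [cs hcs] := nets; have [U [UU subU]] := ultraFilterLemma eventually_filter.
pose g K x := coordinates f x0 R0 nN (descend n f k0 R0 cs 0 K x).
pose G x : 'rV[R]_n := \row_l lim ((fun K => g K x 0 l) @ U).
set M := 8 * expR _; exists G => x y Yx Yy.
have gcvg z : core n x0 R0 z -> forall l, cvg ((fun K => g K z 0 l) @ U).
  move=> Yz l; pose B := enorm (f z) + 3 * shift_const R N * E z (128 * step R0 0)
    * stretch f k0 z (step R0 0).
  apply: (@bounded_ultra_cvg _ _ _ _ B) => // K; rewrite mxE.
  apply: le_trans (dot_unit_le _ _) _.
    by apply: enorm_normal => //; have := step_gt0 0; lra.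
  have := descend_close k0 f_inj R0_gt0 e0_small q0 E_qs E_mono
    (fun j => let: And3 h _ _ := hcs j in h)
    (fun j => let: And3 _ h _ := hcs j in h) K 0 Yz.
  have := ler_enorm_dist (descend n f k0 R0 cs 0 K z) (f z) 0.
  by rewrite !subr0 /B; lra.
have Gl z (Yz : core n x0 R0 z) l : (fun K => g K z 0 l) @ U --> G z 0 l.
  by rewrite mxE; exact: gcvg.
have subE (a b : 'rV[R]_n) l : (a - b) 0 l = a 0 l - b 0 l by rewrite !mxE.
have GE : (fun K => enorm (g K x - g K y) ^+ 2) @ U --> enorm (G x - G y) ^+ 2.
  rewrite enormE /dot; under eq_fun do rewrite enormE /dot.
  apply: cvg_big => [|l _]; first exact: add_continuous.
  under eq_fun do rewrite subE.
  by rewrite subE; apply: cvgM; apply: cvgB; exact: Gl.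
have [->|xy] := eqVneq x y.
  by rewrite !subrr !enorm0 expr0n /= mulr0.
have xy0 : 0 < enorm (x - y) by rewrite enorm_gt0 subr_eq0.
have xy1 : enorm (x - y) <= step R0 0.
  rewrite /step expr0 divr1; case: Yx Yy => _ h1 [_ h2].
  apply: le_trans (ler_enorm_dist _ x0 _) _; rewrite (enormB x0); lra.
(* the least such index brackets the distance of the two points *)
have fine : exists m, step R0 m.+1 < enorm (x - y).
  have : 0 <= R0 / 1024 by have := R0_gt0; lra.
  rewrite /step; move: (R0 / 1024) => a a0.
  have c0 : 0 <= a / enorm (x - y) by exact: divr_ge0 (ltW xy0).
  exists (Num.bound (a / enorm (x - y))).
  rewrite ltr_pdivrMr ?exprn_gt0// mulrC -ltr_pdivrMr//.
  apply: lt_le_trans (archi_boundP c0) _.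
  by rewrite -natrX ler_nat ltnW// ltnW// ltn_expl.
case: (ex_minnP fine) => m hm mmin.
have hm2 : enorm (x - y) <= step R0 m.
  case: m mmin {hm} => // m mmin; rewrite leNgt; apply/negP => /mmin.
  by rewrite ltnn.
have bounds : forall K, (m < K)%N ->
    enorm (f x - f y) ^+ 2 <= M * enorm (g K x - g K y) ^+ 2 /\
    enorm (g K x - g K y) ^+ 2 <= M * enorm (f x - f y) ^+ 2.
  move=> K mK.
  have := descend_bilipschitz k0 f_inj R0_gt0 e0_small q0 E_qs E_mono
    (fun j => let: And3 h _ _ := hcs j in h)
    (fun j => let: And3 _ h _ := hcs j in h)
    (fun j => let: And3 _ _ h := hcs j in h) Yx Yy mK hm2 hm nN.
  move=> /= [h1 h2].
  have SM : 8 * expR (2 * stretch_const R n N *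
     \sum_(i < K) E x (256 * step R0 i) ^+ 2) <= M.
    rewrite ler_wpM2l// ler_expR ler_wpM2l ?mulr_ge0 ?stretch_const_ge0//.
    exact: E_sum.
  split; [apply: le_trans h1 _|apply: le_trans h2 _];
    by apply: ler_wpM2r => //; exact: sqr_ge0.
have Um : \forall K \near U, (m < K)%N by apply: subU; exact: nbhs_infty_gt.
split.
- apply: (@closed_cvg _ _ U _ (fun K => M * enorm (g K x - g K y) ^+ 2)
    [set r : R | enorm (f x - f y) ^+ 2 <= r]).
  + exact: closed_ge.
  + by apply: filterS Um => K /bounds[].
  + by apply: cvgMl_tmp; exact: GE.
- apply: (@closed_cvg _ _ U _ (fun K => enorm (g K x - g K y) ^+ 2)
    [set r : R | r <= M * enorm (f x - f y) ^+ 2]).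
  + exact: closed_le.
  + by apply: filterS Um => K /bounds[].
  + exact: GE.
Qed.

End Limit.

(** * The square Dini integral *)

Section Excess.
Context {R : realType} {N : nat}.
Variable f : 'rV[R]_N -> 'rV[R]_N.
Implicit Types (X Y : set 'rV[R]_N).
Local Open Scope ereal_scope.

Lemma wqs_const_ge1 X : 1 <= wqs_const f X.
Proof. by apply: le_ereal_inf_tmp => _ [H [H1 _] <-]; rewrite lee_fin. Qed.

Lemma wqs_excess_ge0 X : 0 <= wqs_excess f X.
Proof. by rewrite /wqs_excess sube_ge0// wqs_const_ge1. Qed.

Lemma wqs_excess_mono X Y : X `<=` Y -> wqs_excess f X <= wqs_excess f Y.
Proof.
move=> XY; apply: leeB => //; apply: ereal_inf_le_tmp => _ [H [H1 HY] <-].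
exists H => //; split=> // x y a /XY Yx /XY Yy /XY Ya; exact: HY.
Qed.

(** The infimum that defines the weak quasisymmetry constant is attained. *)
Lemma wqs_excess_qs X : wqs_excess f X < +oo ->
  weakly_qs f X (fine (wqs_excess f X)).
Proof.
move=> Xoo x y a Xx Xy Xa xya; set e := fine _.
have Xfin : wqs_excess f X \is a fin_num by rewrite ge0_fin_numE// wqs_excess_ge0.
have cE : wqs_const f X = (1 + e)%:E.
  by rewrite EFinD /e fineK// /wqs_excess addeC subeK.
set A := enorm (f x - f a); set B := enorm (f y - f a).
have B0 : (0 <= B)%R by exact: enorm_ge0.
rewrite leNgt; apply/negP => lt.
have [H [H1 HX] Hlt] : exists2 H : R, (1 <= H)%R /\ (forall x y a, X x -> X y -> X a ->
      (enorm (x - a) <= enorm (y - a))%R ->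
      (enorm (f x - f a) <= H * enorm (f y - f a))%R) & (H * B < A)%R.
  have [B00|] := eqVneq B 0%R.
    have : wqs_const f X < +oo by rewrite cE ltry.
    move=> /ereal_inf_lt[_ [H hH <-] _]; exists H => //.
    by move: lt; rewrite B00 !mulr0.
  rewrite neq_lt ltNge B0/= => Bp.
  have : wqs_const f X < (A / B)%:E by rewrite cE lte_fin ltr_pdivlMr.
  move=> /ereal_inf_lt[_ [H hH <-]]; rewrite lte_fin ltr_pdivlMr// => ?.
  by exists H.
by have := HX x y a Xx Xy Xa xya; rewrite leNgt Hlt.
Qed.

End Excess.

Section DiniSum.
Context {R : realType}.
Local Open Scope ereal_scope.
Notation mu := (@lebesgue_measure R).

(** Monotonicity for arbitrary functions: the integral of a nonnegative function
    is the supremum of the integrals of the simple functions below it. *)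
Lemma ge0_le_integral_any d (T : measurableType d) (m : {measure set T -> \bar R})
    (D : set T) (g h : T -> \bar R) :
  (forall x, D x -> 0 <= g x) -> (forall x, D x -> g x <= h x) ->
  \int[m]_(x in D) g x <= \int[m]_(x in D) h x.
Proof.
move=> g0 gh; have h0 x : D x -> 0 <= h x.
  by move=> Dx; exact: le_trans (g0 x Dx) (gh x Dx).
rewrite !ge0_integralE//; apply: ereal_sup_le => _ [s sg <-].
by exists s => // x; apply: le_trans (sg x) _; exact: lee_restrict.
Qed.

Variables (H : R -> \bar R) (r0 : R).
Hypothesis H_ge0 : forall r, 0 <= H r.
Hypothesis H_mono : forall r s, (r <= s)%R -> H r <= H s.
Hypotheses (r0_gt0 : (0 < r0)%R) (r0_le : (2 * r0 <= 1)%R).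

Let rr i : R := (r0 / 2 ^+ i)%R.

Let rr_gt0 i : (0 < rr i)%R.
Proof. by rewrite divr_gt0// exprn_gt0. Qed.

Let rrS i j : (i < j)%N -> (2 * rr j <= rr i)%R.
Proof.
case: j => // j ij; rewrite /rr exprS.
have -> : (2 * (r0 / (2 * 2 ^+ j)) = r0 / 2 ^+ j)%R.
  by field; rewrite expf_neq0.
rewrite ler_wpM2l ?(ltW r0_gt0)// lef_pV2 ?posrE ?exprn_gt0//.
by rewrite ler_weXn2l// ler1n.
Qed.

Let rr_le i : (2 * rr i <= 1)%R.
Proof.
apply: le_trans r0_le; rewrite ler_wpM2l// /rr ler_pdivrMr ?exprn_gt0//.
by rewrite ler_peMr ?(ltW r0_gt0)// exprn_ege1// ler1n.
Qed.

Let shell i : set R := [set` `[rr i, (2 * rr i)%R[].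

(** On the shell between [rr i] and [2 * rr i] the monotone function [H] is at
    least [h i], and the shell has mass at least 1/2 for [dr / r]. *)
Lemma dyadic_sum_le_integral (h : nat -> R) (K : nat) :
  (forall i, 0 <= h i)%R -> (forall i, (h i)%:E <= H (rr i)) ->
  ((\sum_(i < K) h i ^+ 2) / 2)%:E <=
    \int[mu]_(r in `]0%R, 1%R[) (H r ^+ 2 * (r^-1)%:E).
Proof.
move=> h0 hH; pose c i := (h i ^+ 2 / (2 * rr i))%R.
have c0 i : (0 <= c i)%R.
  by rewrite divr_ge0 ?sqr_ge0// mulr_ge0// ltW.
pose g i (r : R) := ((c i * \1_(shell i) r)%:E : \bar R).
have mD : measurable (`]0%R, 1%R[ : set R) by exact: measurable_itv.
have mS i : measurable (shell i) by exact: measurable_itv.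
have g0 i r : 0 <= g i r by rewrite lee_fin mulr_ge0.
have -> : ((\sum_(i < K) h i ^+ 2) / 2)%:E =
    \int[mu]_(r in `]0%R, 1%R[) (\sum_(i < K) g i r).
  rewrite ge0_integral_sum//; last first.
    move=> i; apply/measurable_EFinP; apply: measurable_funM => //.
    by apply: measurable_indic; exact: mS.
  rewrite mulr_suml -sumEFin; apply: eq_bigr => i _.
  have neg : (c i < 0)%R -> shell i = set0 by rewrite ltNge c0.
  have zE := @integralZl_indic _ _ R mu _ mD (fun=> shell i) (c i) neg (mS i).
  rewrite (@integral_indic _ _ R mu _ mD _ (mS i)) in zE.
  have -> : \int[mu]_(r in `]0%R, 1%R[) g i r =
      (c i)%:E * mu (shell i `&` `]0%R, 1%R[) by exact: zE.
  rewrite setIidl; last first.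
    move=> r; rewrite /shell /= !in_itv/= => /andP[h1 h2].
    by rewrite (lt_le_trans (rr_gt0 i) h1) (lt_le_trans h2).
  rewrite lebesgue_measure_itv/= lte_fin.
  have -> : (rr i < 2 * rr i)%R by have := rr_gt0 i; lra.
  rewrite -EFinB -EFinM; congr EFin; rewrite /c; field.
  by rewrite gt_eqF.
apply: ge0_le_integral_any => [r _|r]; first by apply: sume_ge0.
rewrite /= in_itv/= => /andP[rp r1].
have rhs0 : 0 <= H r ^+ 2 * (r^-1)%:E.
  by rewrite mule_ge0 ?expe_ge0// lee_fin invr_ge0 ltW.
have [[i ri]|none] := pselect (exists i : 'I_K, shell i r); last first.
  rewrite big1// => i _; rewrite /g indicE memNset ?mulr0//.
  by move=> ri; apply: none; exists i.
rewrite (bigD1 i)//= big1 ?adde0.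
  move: ri; rewrite /g indicE => ri; rewrite mem_set// mulr1.
  move: ri; rewrite /shell /= in_itv/= => /andP[h1 h2].
  have hr : (h i)%:E <= H r by apply: le_trans (hH i) _; exact: H_mono.
  rewrite /c EFinM.
  apply: lee_pmul; rewrite ?lee_fin ?sqr_ge0 ?invr_ge0 ?mulr_ge0 ?(ltW (rr_gt0 i))//.
    exact: ltW.
    by rewrite expr2 EFinM lee_pmul// lee_fin.
  by rewrite lef_pV2 ?posrE ?mulr_gt0// ltW.
move=> j ji; rewrite /g indicE memNset ?mulr0//.
move: ri; rewrite /shell /= !in_itv/= => /andP[h1 h2] /andP[h3 h4].
have [ij|ij|ij] := ltngtP (i : nat) (j : nat).
- by have := rrS ij; lra.
- by have := rrS ij; lra.
- by move: ji; rewrite -val_eqE /= ij eqxx.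
Qed.

End DiniSum.

(** * Local flattening of the image of the plane *)

Section Embedding.
Context {R : realType} {n N : nat}.
Hypothesis nN : (n <= N)%N.
Implicit Types (x y : 'rV[R]_n).

Lemma embed_lt x (l : 'I_n) : (embed x : 'rV[R]_N) 0 (widen_ord nN l) = x 0 l.
Proof.
rewrite mxE; case: insubP => [l' _ ll'|]; last by rewrite /= ltn_ord.
by congr (x 0 _); apply/val_inj.
Qed.

Lemma embed_ge x (k : 'I_N) : (n <= k)%N -> (embed x : 'rV[R]_N) 0 k = 0.
Proof. by move=> nk; rewrite mxE insubF//; apply/negbTE; rewrite -leqNgt. Qed.

Lemma embedB x y : (embed x - embed y : 'rV[R]_N) = embed (x - y).
Proof. by apply/rowP => k; rewrite !mxE; case: insub => [l|]; rewrite ?mxE ?subrr. Qed.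

Lemma enorm_embed x : enorm (embed x : 'rV[R]_N) = enorm x.
Proof.
rewrite /enorm; congr Num.sqrt.
rewrite (bigID (fun k : 'I_N => (k < n)%N)) /= [X in _ + X]big1 ?addr0.
  by rewrite big_ord_narrow; apply: eq_bigr => l _; rewrite embed_lt.
by move=> k; rewrite -leqNgt => nk; rewrite embed_ge// expr0n.
Qed.

Lemma parallel_embed x y : parallel n (embed x : 'rV[R]_N) (embed y).
Proof. by move=> k nk; rewrite embedB embed_ge. Qed.

Lemma parallel_embedP x (z : 'rV[R]_N) : parallel n (embed x) z ->
  exists y, z = embed y.
Proof.
move=> pz; exists (\row_l z 0 (widen_ord nN l)); apply/rowP => k.
have [nk|kn] := leqP n k.
  have : z 0 k - (embed x : 'rV[R]_N) 0 k = 0 by rewrite -(pz k nk) !mxE.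
  by rewrite !embed_ge// subr0.
have -> : k = widen_ord nN (Ordinal kn) by exact/val_inj.
by rewrite embed_lt mxE.
Qed.

End Embedding.

Section EuclideanTopology.
Context {R : realType} {N : nat}.
Implicit Types (x : 'rV[R]_N).

Lemma nbhs_eball x (r : R) : 0 < r -> nbhs x (eball x r).
Proof.
move=> r0; have N1 : 0 < (N%:R + 1 : R) by rewrite ltr_wpDl.
apply/nbhs_ballP; exists (r / (N%:R + 1)); first by rewrite /= divr_gt0.
move=> y [_ xy]; rewrite /eball/=.
apply: (@le_trans _ _ (N%:R * (r / (N%:R + 1)))); last first.
  rewrite mulrA ler_pdivrMr// mulrC ler_wpM2l ?(ltW r0)//; lra.
apply: enorm_le_coord; first by rewrite divr_ge0// ltW.
by move=> k; have := xy 0 k; rewrite /ball/= => /ltW; rewrite !mxE distrC.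
Qed.

Lemma nbhs_eballP x (A : set 'rV[R]_N) : nbhs x A ->
  exists2 r : R, 0 < r & eball x r `<=` A.
Proof.
move=> /nbhs_ballP[r /= r0 rA]; exists (r / 2); first by rewrite divr_gt0.
move=> y yr; apply: rA; split=> // i k; rewrite /ball/= (ord1 i).
have := ler_coord_enorm (y - x) k; rewrite !mxE distrC => /le_lt_trans; apply.
by apply: le_lt_trans yr _; lra.
Qed.

End EuclideanTopology.

(** Continuity of the inverse: the points of the image that are close to [f x]
    come from points close to [x]. *)
Lemma quasiconformal_homeo_inverse {R : realType} {N : nat}
    (f : 'rV[R]_N -> 'rV[R]_N) : quasiconformal_homeo f ->
  continuous f /\ exists g : 'rV[R]_N -> 'rV[R]_N,
    [/\ cancel f g, cancel g f & continuous g].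
Proof.
case=> -[_ [fc [g [gK gc]]] _] fT; split; first exact/continuous_subspace_setT.
exists g; split.
- by move=> x; exact: gK.
- move=> y; have [x _ <-] : range f y by rewrite fT.
  by rewrite gK.
by move: gc; rewrite fT => gc; apply/continuous_subspace_setT.
Qed.

Section LocalFlattening.
Context {R : realType} {n N : nat}.
Variable f : 'rV[R]_N -> 'rV[R]_N.
Hypotheses (f_inj : injective f) (nN : (1 <= n <= N - 1)%N).

(** Squared bi-Lipschitz constant of the flattening; [2 * A] bounds the sum of the
    squared excesses over the dyadic scales. *)
Definition flattening_const (A : R) : R :=
  8 * expR (2 * stretch_const R n N * (2 * A)).

Let E (x : 'rV[R]_N) (r : R) : R := fine (wqs_excess f (eball x r)).

Let nN' : (n <= N)%N. Proof. lia. Qed.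

Lemma dini_sup_sum (x0 x : 'rV[R]_n) (r0 : R) (h : nat -> R) (K : nat) :
  (dini_sup f x0 < +oo)%E -> eball x0 1 x -> 0 < r0 -> 2 * r0 <= 1 ->
  (forall i, 0 <= h i) ->
  (forall i, ((h i)%:E <= wqs_excess f (eball (embed x) (r0 / 2 ^+ i)))%E) ->
  \sum_(i < K) h i ^+ 2 <= 2 * fine (dini_sup f x0).
Proof.
move=> fin xB r00 r01 h0 hH.
have le1 : (((\sum_(i < K) h i ^+ 2) / 2)%:E <= dini_sup f x0)%E.
  apply: le_trans (dyadic_sum_le_integral (H := fun r => wqs_excess f (eball (embed x) r))
    _ _ r00 r01 K h0 hH) _.
  - by move=> r; exact: wqs_excess_ge0.
  - move=> r s rs; apply: wqs_excess_mono; apply: eball_sub.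
    by rewrite subrr enorm0 add0r.
  - by apply: ereal_sup_ubound; exists x.
have ge0 : (0 <= dini_sup f x0)%E.
  by apply: le_trans le1; rewrite lee_fin divr_ge0// sumr_ge0// => i _; exact: sqr_ge0.
have dfin : dini_sup f x0 \is a fin_num by rewrite ge0_fin_numE.
by move: le1; rewrite -(fineK dfin) lee_fin; lra.
Qed.

(** Otherwise the excess would be bounded below at all dyadic scales, and the sum
    of its squares would diverge. *)
Lemma dini_sup_small (x0 : 'rV[R]_n) (e : R) : (dini_sup f x0 < +oo)%E -> 0 < e ->
  exists2 r, 0 < r <= 2^-1 & (wqs_excess f (eball (embed x0) r) <= e%:E)%E.
Proof.
move=> fin e0; apply: contrapT => none.
have big i : (e%:E <= wqs_excess f (eball (embed x0) (2^-1 / 2 ^+ i)))%E.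
  rewrite leNgt; apply/negP => lt; apply: none.
  exists (2^-1 / 2 ^+ i); last exact: ltW.
  rewrite divr_gt0 ?exprn_gt0//= ler_pdivrMr ?exprn_gt0// ler_peMr//.
  by rewrite exprn_ege1// ler1n.
have half : 0 < 2^-1 :> R by [].
have h1 : 2 * 2^-1 <= 1 :> R by rewrite divff.
pose K := Num.bound (2 * fine (dini_sup f x0) / e ^+ 2).
have := dini_sup_sum K fin (eball_center x0 ler01) half h1
  (fun=> ltW e0) big.
rewrite sumr_const card_ord -[_ *+ K]mulr_natl -ler_pdivlMr ?exprn_gt0// leNgt.
move=> /negP; apply; apply: archi_boundP.
have := dini_sup_sum 0 fin (eball_center x0 ler01) half h1
  (fun=> ltW e0) big; rewrite big_ord0 => p.
by rewrite divr_ge0// sqr_ge0.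
Qed.

(** The radius is chosen from the integral at [x0] alone; after that, the constant
    depends only on the sums of squares at the points near [x0]. *)
Lemma flattening (x0 : 'rV[R]_n) : (dini_sup f x0 < +oo)%E ->
  exists2 delta : R, 0 < delta & exists G : 'rV[R]_n -> 'rV[R]_n,
  let M := flattening_const (fine (dini_sup f x0)) in
  forall x y, eball x0 delta x -> eball x0 delta y ->
    enorm (f (embed x) - f (embed y)) ^+ 2 <= M * enorm (G x - G y) ^+ 2 /\
    enorm (G x - G y) ^+ 2 <= M * enorm (f (embed x) - f (embed y)) ^+ 2.
Proof.
move=> fin; have T0 : 0 <= inv_threshold R n N.
  rewrite /inv_threshold; move: (frame_const_ge0 R) (slope_const_ge0 R n N)
    (stretch_const_ge0 R n N) (shift_const_ge0 R N)
    (le_trans ler01 (scale_ratio_ge1 R)).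
  move: (10 ^+ 4) (exprn_ge0 4 (ler0n R 10)).
  move: (frame_const R) (slope_const R n N) (stretch_const R n N)
    (shift_const R N) (scale_ratio : R).
  by move=> *; rewrite !addr_ge0// !mulr_ge0// sqr_ge0.
pose e0 := (inv_threshold R n N + 1)^-1.
have e0_gt0 : 0 < e0 by rewrite invr_gt0 ltr_wpDl.
have e0_small : small_excess n N e0.
  split; first exact: ltW.
  by rewrite /e0 mulrC ler_pdivrMr ?ltr_wpDl//; lra.
have [R0 /andP[R0_gt0 R0_le] R0e] := dini_sup_small fin e0_gt0.
have excess_le x s : eball x s `<=` eball (embed x0) R0 ->
    (wqs_excess f (eball x s) <= e0%:E)%E.
  by move=> sub; apply: le_trans R0e; exact: wqs_excess_mono.
have excess_fin x s : eball x s `<=` eball (embed x0) R0 ->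
    wqs_excess f (eball x s) \is a fin_num.
  move=> /excess_le le; rewrite ge0_fin_numE ?wqs_excess_ge0//.
  exact: le_lt_trans le (ltry _).
have E_qs x s : eball x s `<=` eball (embed x0) R0 ->
    0 <= E x s <= e0 /\ weakly_qs f (eball x s) (E x s).
  move=> sub; have xfin := excess_fin x s sub; split.
    by rewrite -!lee_fin /E fineK// wqs_excess_ge0 excess_le.
  by apply: wqs_excess_qs; exact: le_lt_trans (excess_le x s sub) (ltry _).
have E_mono x y s s' : eball x s `<=` eball y s' ->
    eball y s' `<=` eball (embed x0) R0 -> E x s <= E y s'.
  move=> xy y0; have x0' := subset_trans xy y0.
  by rewrite -lee_fin /E !fineK ?excess_fin//; exact: wqs_excess_mono.
have q0 : weakly_qs f (eball (embed x0) R0) e0.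
  have [/andP[_ Ee] q] := E_qs (embed x0) R0 (fun _ h => h).
  move=> x y a Xx Xy Xa xya; apply: le_trans (q x y a Xx Xy Xa xya) _.
  by rewrite ler_wpM2r ?enorm_ge0// lerD2l.
have N0 : (0 < N)%N by lia.
have E_sum x K : core n (embed x0) R0 x ->
    \sum_(i < K) E x (256 * step R0 i) ^+ 2 <= 2 * fine (dini_sup f x0).
  case=> px xR; have [y xy] := parallel_embedP nN' px; subst x.
  have rE i : 256 * step R0 i = R0 / 4 / 2 ^+ i.
    by rewrite /step; field; rewrite expf_neq0.
  have sub i : eball (embed y : 'rV[R]_N) (R0 / 4 / 2 ^+ i)
      `<=` eball (embed x0) R0.
    have p : R0 / 4 / 2 ^+ i <= R0 / 4.
      by rewrite ler_pdivrMr ?exprn_gt0// ler_peMr ?divr_ge0 ?(ltW R0_gt0)//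
        exprn_ege1// ler1n.
    by apply: eball_sub; apply: le_trans (lerD xR p) _; lra.
  apply: (@dini_sup_sum x0 y (R0 / 4) (fun i => E (embed y) (256 * step R0 i))) => //.
  - rewrite /eball/= -(enorm_embed nN') -embedB; apply: le_trans xR _.
    by lra.
  - by rewrite divr_gt0.
  - by lra.
  - by move=> i; rewrite rE; have [/andP[]] := E_qs _ _ (sub i).
  - by move=> i; rewrite rE /E fineK//; exact: excess_fin.
have [G HG] := local_flattening (Ordinal N0) f_inj R0_gt0 e0_small q0 E_qs E_mono
  nN' E_sum.
exists (R0 / 2048); first by lra.
exists (G \o embed) => M x y Bx By.
by apply: HG; split; rewrite ?embedB ?(enorm_embed nN')//; exact: parallel_embed.
Qed.

End LocalFlattening.

(** * Lipschitz parametrizations by the unit cube *)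

Section McShane.
Context {R : realType} {T : Type} {n N : nat}.
Variables (S : set T) (a : T -> 'rV[R]_n) (phi : T -> 'rV[R]_N) (K : R).
Hypothesis K0 : 0 <= K.
Hypothesis lip : forall x y, S x -> S y ->
  enorm (phi x - phi y) <= K * enorm (a x - a y).

Let values (k : 'I_N) (u : 'rV[R]_n) : set R :=
  [set phi x 0 k + K * enorm (u - a x) | x in S].

Let values_lbound k u x : S x -> forall y, S y ->
  phi x 0 k - K * enorm (u - a x) <= phi y 0 k + K * enorm (u - a y).
Proof.
move=> Sx y Sy; have := ler_coord_enorm (phi x - phi y) k.
rewrite !mxE ler_norml => /andP[_ h]; have := lip Sx Sy.
have := ler_wpM2l K0 (ler_enorm_dist (a x) u (a y)); rewrite (enormB (a x) u); lra.
Qed.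

(** McShane's extension, one coordinate at a time. *)
Lemma lipschitz_extension : S !=set0 -> exists Psi : 'rV[R]_n -> 'rV[R]_N,
  (forall x, S x -> Psi (a x) = phi x) /\
  (forall u v, enorm (Psi u - Psi v) <= N%:R * (K * enorm (u - v))).
Proof.
move=> [z Sz]; exists (fun u => \row_k inf (values k u)).
have hi k u : has_inf (values k u).
  split; first by exists (phi z 0 k + K * enorm (u - a z)); exists z.
  exists (phi z 0 k - K * enorm (u - a z)) => _ [y Sy <-].
  exact: values_lbound.
split=> [x Sx|u v].
  apply/rowP => k; rewrite mxE; apply/eqP; rewrite eq_le; apply/andP; split.
    apply: ge_inf; first exact: (hi k (a x)).2.
    by exists x => //; rewrite subrr enorm0 mulr0 addr0.
  apply: lb_le_inf; first exact: (hi k (a x)).1.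
  move=> _ [y Sy <-]; have := values_lbound k (a x) Sx Sy.
  by rewrite subrr enorm0 mulr0 subr0.
have half u' v' k : inf (values k u') - K * enorm (u' - v') <= inf (values k v').
  apply: lb_le_inf; first exact: (hi k v').1.
  move=> _ [y Sy <-]; rewrite lerBlDr.
  apply: (@le_trans _ _ (phi y 0 k + K * enorm (u' - a y))).
    by apply: ge_inf; [exact: (hi k u').2|exists y].
  rewrite -addrA lerD2l -mulrDr ler_wpM2l// [leRHS]addrC; exact: ler_enorm_dist.
apply: enorm_le_coord => [|k]; first by rewrite mulr_ge0 ?enorm_ge0.
rewrite !mxE ler_norml; have := half u v k; have := half v u k.
rewrite (enormB v u); move=> h1 h2; apply/andP; split; lra.
Qed.

(** Extend the inverse of the chart [a], then rescale the cube to a box that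
    contains the bounded set [a @` S]. *)
Lemma lipschitz_cube (B : R) : S !=set0 -> (forall x, S x -> enorm (a x) <= B) ->
  exists F : 'rV[R]_n -> 'rV[R]_N,
  (exists M : R, forall t u, enorm (F t - F u) <= M * enorm (t - u)) /\
  phi @` S `<=` F @` @unit_cube R n.
Proof.
move=> S0 aB; have [Psi [PsiE Psilip]] := lipschitz_extension S0.
have B0 : 0 <= B by case: S0 => z /aB; apply: le_trans; exact: enorm_ge0.
pose C := B + 1; have C0 : 0 < C by rewrite ltr_wpDl.
pose s (t : 'rV[R]_n) : 'rV[R]_n := (2 * C) *: t - const_mx C.
exists (Psi \o s); split.
  exists (N%:R * (K * (2 * C))) => t u /=; apply: le_trans (Psilip _ _) _.
  have -> : s t - s u = (2 * C) *: (t - u).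
    by apply/rowP => i; rewrite !mxE; ring.
  by rewrite enormZ ger0_norm ?mulr_ge0 ?(ltW C0)// !mulrA.
move=> _ [x Sx <-]; exists ((2 * C)^-1 *: (a x + const_mx C)).
  move=> i; rewrite !mxE; have := le_trans (ler_coord_enorm (a x) i) (aB x Sx).
  rewrite ler_norml => /andP[h1 h2]; have C2 : 0 < 2 * C by rewrite mulr_gt0.
  rewrite mulrC ler_pdivlMr// ler_pdivrMr// mul0r mul1r /C.
  by apply/andP; split; lra.
rewrite /= -(PsiE x Sx); congr Psi; apply/rowP => i; rewrite !mxE; field.
by rewrite gt_eqF.
Qed.

End McShane.

Section LipschitzCharts.
Context {R : realType} {n N : nat}.
Variable phi : 'rV[R]_n -> 'rV[R]_N.

Definition cube_covered (A : set 'rV[R]_N) :=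
  exists F : 'rV[R]_n -> 'rV[R]_N,
  (exists M : R, forall t u, enorm (F t - F u) <= M * enorm (t - u)) /\
  A `<=` F @` @unit_cube R n.

Definition rational_ball (q : 'rV[rat]_n * nat) : set 'rV[R]_n :=
  eball (map_mx ratr q.1) (q.2.+1%:R^-1).

Lemma rational_ball_near (x : 'rV[R]_n) (delta : R) : 0 < delta ->
  exists2 q, rational_ball q x & rational_ball q `<=` eball x delta.
Proof.
move=> d0; pose m := Num.bound (2 / delta); pose r : R := m.+1%:R^-1.
have r0 : 0 < r by rewrite invr_gt0.
have mr : 2 * r <= delta.
  rewrite /r ler_pdivrMr// mulrC -ler_pdivrMr//; apply: ltW.
  have := archi_boundP (divr_ge0 (ler0n R 2) (ltW d0)) => /lt_le_trans; apply.
  by rewrite ler_nat.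
have n1 : 0 < (n%:R + 1 : R) by rewrite ltr_wpDl.
have e0 : 0 < r / (n%:R + 1) by rewrite divr_gt0.
have qx (l : 'I_n) : exists q : rat, `|x 0 l - ratr q| <= r / (n%:R + 1).
  have : x 0 l - r / (n%:R + 1) < x 0 l by rewrite ltrBlDr ltrDl.
  move=> /rat_in_itvoo[q]; rewrite in_itv/= => /andP[h1 h2].
  by exists q; rewrite ler_norml; apply/andP; split; lra.
pose q : 'rV[rat]_n := \row_l xchoose (qx l).
have xq : enorm (x - map_mx ratr q) <= r.
  apply: (@le_trans _ _ (n%:R * (r / (n%:R + 1)))); last first.
    rewrite mulrA ler_pdivrMr// mulrC ler_wpM2l ?(ltW r0)//; lra.
  apply: enorm_le_coord => [|l]; first exact: ltW.
  by rewrite !mxE; exact: (xchooseP (qx l)).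
exists (q, m) => // y; rewrite /rational_ball /eball /= -/r => yq.
apply: le_trans (ler_enorm_dist _ (map_mx ratr q) _) _.
by rewrite (enormB _ x); lra.
Qed.

(** Countably many balls with rational centers and radii refine any local cover. *)
Lemma rectifiable_of_local : (0 < n)%N ->
  (forall x, exists2 delta : R, 0 < delta & cube_covered (phi @` eball x delta)) ->
  exists F : nat -> 'rV[R]_n -> 'rV[R]_N,
    (forall k, exists M : R, forall t u, unit_cube t -> unit_cube u ->
       enorm (F k t - F k u) <= M * enorm (t - u)) /\
    range phi `<=` \bigcup_k (F k @` @unit_cube R n).
Proof.
move=> n0 loc; pose P (k : nat) (F : 'rV[R]_n -> 'rV[R]_N) :=
  (exists M : R, forall t u, enorm (F t - F u) <= M * enorm (t - u)) /\
  forall q, unpickle k = Some q -> cube_covered (phi @` rational_ball q) ->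
    phi @` rational_ball q `<=` F @` @unit_cube R n.
have [|F FP] := boolp.choice (P := P).
  move=> k; case kq : (unpickle k : option ('rV[rat]_n * nat)) => [q|]; last first.
    exists (fun=> 0); split=> [|q]; last by rewrite kq.
    by exists 0 => t u; rewrite subrr enorm0 mul0r.
  have [[F [F1 F2]]|none] := pselect (cube_covered (phi @` rational_ball q)).
    by exists F; split=> // q'; rewrite kq => -[<-] _.
  exists (fun=> 0); split=> [|q']; last by rewrite kq => -[<-] /none.
  by exists 0 => t u; rewrite subrr enorm0 mul0r.
exists F; split=> [k|_ [x _ <-]].
  by have [[M FM] _] := FP k; exists M => t u _ _; exact: FM.
have [delta d0 [G [G1 G2]]] := loc x.
have [q xq qd] := rational_ball_near x d0.
exists (pickle q) => //; have [_] := FP (pickle q); apply.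
- exact: pickleK.
- by exists G; split=> // _ [y /qd yd <-]; apply: G2; exists y.
- by exists x.
Qed.

End LipschitzCharts.

(** * Hausdorff measure of Lipschitz images *)

Section Diameter.
Context {R : realType} {N : nat}.
Implicit Types (U V : set 'rV[R]_N).
Local Open Scope ereal_scope.

Lemma diam_ge0 U : 0 <= diam U.
Proof. by apply: ereal_sup_ubound; left. Qed.

Lemma diam_le U (d : R) : (0 <= d)%R ->
  (forall x y, U x -> U y -> (enorm (x - y) <= d)%R) -> diam U <= d%:E.
Proof.
move=> d0 Ud; apply: ge_ereal_sup => z [->|[[x y] [/= Ux Uy] <-]]; rewrite lee_fin//.
exact: Ud.
Qed.

Lemma diam_ub U x y : U x -> U y -> (enorm (x - y))%:E <= diam U.
Proof. by move=> Ux Uy; apply: ereal_sup_ubound; right; exists (x, y). Qed.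

Lemma diam0 : diam (set0 : set 'rV[R]_N) = 0.
Proof. by apply/eqP; rewrite eq_le diam_ge0 diam_le. Qed.

Lemma expe_pow_le (x : \bar R) (d : R) (n : nat) : 0 <= x -> x <= d%:E -> x ^+ n <= (d ^+ n)%:E.
Proof.
move=> x0 xd; elim: n => [|n IH]; first by rewrite expr0.
by rewrite expeS exprS EFinM lee_pmul// expe_ge0.
Qed.

Lemma hausdorff_content_ge0 n (delta : R) (A : set 'rV[R]_N) :
  0 <= hausdorff_content n delta A.
Proof.
apply: le_ereal_inf_tmp => _ [U _ <-]; apply: nneseries_ge0 => k _ _.
by rewrite expe_ge0// diam_ge0.
Qed.

Lemma hausdorff_unnormalized_ge0 n (A : set 'rV[R]_N) :
  0 <= hausdorff_unnormalized n A.
Proof.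
apply: le_trans (hausdorff_content_ge0 n 1 A) _; apply: ereal_sup_ubound.
by exists 1%R => //=.
Qed.

Lemma hausdorff_content_finite_cover n (delta d : R) (A : set 'rV[R]_N)
    (Us : seq (set 'rV[R]_N)) : (0 < n)%N -> (0 <= d)%R -> (d <= delta)%R ->
  A `<=` \bigcup_(k in `I_(size Us)) nth set0 Us k ->
  (forall k, (k < size Us)%N -> diam (nth set0 Us k) <= d%:E) ->
  hausdorff_content n delta A <= ((size Us)%:R * d ^+ n)%:E.
Proof.
move=> n0 d0 dd AU Ud.
have U0 k : (size Us <= k)%N -> diam (nth set0 Us k) ^+ n = 0.
  by move=> sk; rewrite nth_default// diam0; case: (n) n0 => // n' _; rewrite expeS mul0e.
apply: (@le_trans _ _ (\sum_(k <oo) diam (nth set0 Us k) ^+ n)).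
  apply: ereal_inf_lbound; exists (nth set0 Us) => //; split.
    by move=> x /AU[k _ kx]; exists k.
  move=> k; have [sk|ks] := leqP (size Us) k.
    by rewrite nth_default// diam0 lee_fin (le_trans d0).
  by apply: le_trans (Ud k ks) _; rewrite lee_fin.
rewrite (@nneseries_split _ _ 0 (size Us)) => [|k _]; last first.
  by rewrite expe_ge0// diam_ge0.
rewrite add0n eseries0 ?adde0; last by move=> k sk _; exact: U0.
rewrite big_mkord.
apply: (@le_trans _ _ (\sum_(k < size Us) (d ^+ n)%:E)).
  by apply: lee_sum => k _; rewrite expe_pow_le ?diam_ge0// Ud.
by rewrite sumEFin sumr_const card_ord -[(_ *+ size Us)%R]mulr_natl.
Qed.

Lemma hausdorff_unnormalized0 n : (0 < n)%N ->
  hausdorff_unnormalized n (set0 : set 'rV[R]_N) = 0.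
Proof.
move=> n0; apply/eqP; rewrite eq_le hausdorff_unnormalized_ge0 andbT.
apply: ge_ereal_sup => _ [delta /= d0 <-].
have := @hausdorff_content_finite_cover n delta 0 set0 [::] n0 (lexx _) (ltW d0).
by rewrite mul0r; apply.
Qed.

(** The unit cube is a union of [m ^ n] cubes of side [1 / m], whose images have
    diameter of order [1 / m]: the sum of the [n]-th powers is independent of
    [m]. *)
Lemma cube_covered_finite n (A : set 'rV[R]_N) : (0 < n)%N ->
  @cube_covered R n N A -> hausdorff_unnormalized n A < +oo.
Proof.
move=> n0 [F [[M0 FM0] AF]]; pose M := `|M0|%R.
have M_ge0 : (0 <= M)%R by exact: normr_ge0.
have FM t u : (enorm (F t - F u) <= M * enorm (t - u))%R.
  by apply: le_trans (FM0 t u) _; rewrite ler_wpM2r ?enorm_ge0// ler_norm.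
apply: (@le_lt_trans _ _ ((M * n%:R) ^+ n)%:E); last exact: ltry.
apply: ge_ereal_sup => _ [delta /= d0 <-].
pose m := (Num.bound (M * n%:R / delta)).+1.
have m0 : (0 < m%:R :> R)%R by rewrite ltr0n.
have Mn0 : (0 <= M * n%:R)%R by rewrite mulr_ge0.
have md : (M * n%:R / m%:R <= delta)%R.
  rewrite ler_pdivrMr// [leRHS]mulrC -ler_pdivrMr//; apply: ltW.
  apply: lt_le_trans (archi_boundP (divr_ge0 Mn0 (ltW d0))) _.
  by rewrite ler_nat /m.
pose sub (i : {ffun 'I_n -> 'I_m}) : set 'rV[R]_n :=
  [set t | forall l, (i l)%:R / m%:R <= t 0%R l <= (i l).+1%:R / m%:R]%R.
pose Us := [seq F @` sub i | i <- enum {: {ffun 'I_n -> 'I_m}}].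
have sz : size Us = (m ^ n)%N.
  by rewrite size_map -cardE card_ffun !card_ord.
have := @hausdorff_content_finite_cover n delta (M * n%:R / m%:R)%R A Us n0
  (divr_ge0 Mn0 (ltW m0)) md.
have -> : ((size Us)%:R * (M * n%:R / m%:R) ^+ n = (M * n%:R) ^+ n :> R)%R.
  rewrite sz natrX -exprMn mulrC divfK// gt_eqF//.
apply.
  move=> _ /AF[t tc <-].
  have tl l : (Num.truncn (t 0%R l * m%:R) < m.+1)%N.
    have /andP[t0 t1] := tc l; rewrite ltnS truncn_le_nat.
    by apply: (@le_lt_trans _ _ (m%:R)); rewrite ?ltr_nat// ler_piMl// ltW.
  (* on the face where the coordinate is 1, the index m is replaced by m - 1 *)
  have idx l : exists i : 'I_m, ((i%:R : R) / m%:R <= t 0%R l <= i.+1%:R / m%:R)%R.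
    have /andP[t0 t1] := tc l.
    have /andP[h1 h2] := truncn_itv (mulr_ge0 t0 (ltW m0)).
    have [e|lt] := leqP m (Num.truncn (t 0%R l * m%:R)).
      exists ord_max => /=; rewrite ler_pdivrMr// ler_pdivlMr//; apply/andP; split.
        by apply: le_trans h1; rewrite ler_nat (leq_trans _ e)// /m.
      by rewrite ler_piMl// ltW.
    exists (Ordinal lt) => /=; rewrite ler_pdivrMr// ler_pdivlMr// h1/=.
    exact: ltW.
  pose i := [ffun l => xchoose (idx l)].
  have iU : F @` sub i \in Us by apply: map_f; rewrite mem_enum.
  exists (index (F @` sub i) Us); first by rewrite /= index_mem.
  rewrite nth_index//; exists t => // l; rewrite ffunE; exact: (xchooseP (idx l)).
move=> k ks; have : nth set0 Us k \in Us by rewrite mem_nth.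
move=> /mapP[i _ ->]; apply: diam_le; first by rewrite divr_ge0// ltW.
move=> _ _ [t ti <-] [u ui <-]; apply: le_trans (FM t u) _.
rewrite -mulrA ler_wpM2l//; apply: enorm_le_coord => [|l].
  by rewrite invr_ge0 ltW.
rewrite !mxE; have := ti l; have := ui l; rewrite -[(i l).+1%:R]natr1 mulrDl mul1r.
move=> /andP[h1 h2] /andP[h3 h4]; rewrite ler_norml; apply/andP; split; lra.
Qed.

End Diameter.

(** * Normalization of the Hausdorff measure *)

Section Boxes.
Context {R : realType}.
Local Open Scope ereal_scope.

Definition tuple_box n (c : nat -> R) (d : R) :
    set (n.-tuple (measurableTypeR R)) :=
  [set t | forall i : 'I_n, `|tnth t i - c i| <= d]%R.

Lemma measurable_tuple_box n c d : measurable (tuple_box (n := n) c d).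
Proof.
have -> : tuple_box (n := n) c d =
   \bigcap_(i in [set: 'I_n]) ((fun t => tnth t i) @^-1` [set` `[(c i - d)%R, (c i + d)%R]]).
  rewrite predeqE => t; split=> [h i _|h i].
    have := h i; rewrite ler_distl /= in_itv/=; lra.
  have := h i Logic.I; rewrite /= in_itv/= ler_distl; lra.
apply: fin_bigcap_measurable => // i _; rewrite -[X in measurable X]setTI.
by apply: (@measurable_tnth _ (measurableTypeR R) n i); [exact: measurableT|exact: measurable_itv].
Qed.

Lemma lebesgue_tuple_box n c d : (0 <= d)%R ->
  lebesgue_tuple R n (tuple_box c d) = ((2 * d) ^+ n)%:E.
Proof.
move=> d0; elim: n c => [|n IH] c.
  by rewrite /= diracE expr0 mem_set// => -[].
have -> : lebesgue_tuple R n.+1 (tuple_box c d) =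
  (@lebesgue_measure R \x lebesgue_tuple R n)%E (tcons @^-1` tuple_box c d) by [].
have -> : tcons @^-1` (tuple_box (n := n.+1) c d) =
    [set` `[(c 0%N - d)%R, (c 0%N + d)%R]] `*` tuple_box (n := n) (fun i => c i.+1) d.
  rewrite predeqE => -[x t]; split=> [h|[/= hx ht] i].
    split=> /= [|i].
      by have := h ord0; rewrite (tnth_nth x) /= ler_distl in_itv/=; lra.
    by have := h (lift ord0 i); rewrite !(tnth_nth x) /=.
  case: (unliftP ord0 i) => [j ->|->].
    by have := ht j; rewrite !(tnth_nth x).
  by rewrite (tnth_nth x) /= ler_distl; move: hx; rewrite in_itv/=; lra.
rewrite product_measure1E; [|exact: measurable_itv|exact: measurable_tuple_box].
rewrite IH exprS EFinM; congr (_ * _).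
apply: etrans (lebesgue_measure_itv _) _; rewrite /= lte_fin; case: ltP => h.
  by rewrite -EFinB; congr EFin; ring.
by congr EFin; lra.
Qed.

Definition row_box n (c : nat -> R) (d : R) : set (borel_row R n) :=
  [set x | forall i : 'I_n, `|(x : 'rV[R]_n) 0%R i - c i| <= d]%R.

Lemma row_boxE n c d : row_box (n := n) c d = tuple_of_row @^-1` tuple_box c d.
Proof.
rewrite predeqE => x; split=> h i.
  by rewrite tnth_mktuple; exact: h.
by have := h i; rewrite tnth_mktuple.
Qed.

Lemma measurable_preimage_row n (B : set (n.-tuple (measurableTypeR R))) :
  measurable B -> measurable (tuple_of_row @^-1` B : set (borel_row R n)).
Proof. by move=> mB; exists B => //; rewrite setTI. Qed.

Lemma measurable_row_box n c d : measurable (row_box (n := n) c d).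
Proof.
rewrite row_boxE; exact: measurable_preimage_row (measurable_tuple_box _ _).
Qed.

Lemma lebesgue_row_box n c d : (0 <= d)%R ->
  @lebesgue_row R n (row_box c d) = ((2 * d) ^+ n)%:E.
Proof.
move=> d0; rewrite -(lebesgue_tuple_box _ c d0) /lebesgue_row /pushforward row_boxE.
rewrite -comp_preimage (_ : _ \o _ = id) ?preimage_id//.
by apply/funext; exact: row_of_tupleK.
Qed.

Lemma measurable_unit_ball n :
  measurable (eball 0 1 : set (borel_row R n)).
Proof.
pose g (t : n.-tuple (measurableTypeR R)) : R := (\sum_(i < n) tnth t i ^+ 2)%R.
have -> : (eball 0 1 : set (borel_row R n)) = tuple_of_row @^-1` (g @^-1` [set` `]-oo, 1%R]]).
  rewrite predeqE => x; rewrite /eball /= subr0 in_itv/=.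
  have -> : g (tuple_of_row x) = (enorm (x : 'rV[R]_n) ^+ 2)%R.
    by rewrite enormE; apply: eq_bigr => i _; rewrite tnth_mktuple expr2.
  by have := enorm_ge0 (x : 'rV[R]_n); split=> h; nra.
have mg : measurable_fun setT g.
  apply: measurable_sum => i; apply: measurable_funX.
  exact: (@measurable_tnth _ (measurableTypeR R) n i).
apply: measurable_preimage_row; rewrite -[X in measurable X]setTI.
by apply: mg; [exact: measurableT|exact: measurable_itv].
Qed.

Lemma lebesgue_unit_ball_fin n : @lebesgue_row R n (eball 0 1) < +oo.
Proof.
apply: (@le_lt_trans _ _ (@lebesgue_row R n (row_box (fun=> 0%R) 1))).
  apply: le_measure; rewrite ?inE.
  - exact: measurable_unit_ball.
  - exact: measurable_row_box.
  - move=> x; rewrite /eball /= subr0 => x1 i; rewrite subr0.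
    exact: le_trans (ler_coord_enorm _ _) x1.
by rewrite lebesgue_row_box// ltry.
Qed.

(** Lebesgue measure bounds the Hausdorff content from below, since a set of
    diameter [d] lies in a box of side [2 d]. *)
Lemma hausdorff_unit_ball_gt0 n N : (0 < n)%N -> (n <= N)%N ->
  0 < hausdorff_unnormalized n (embed @` eball (0 : 'rV[R]_n) 1 : set 'rV[R]_N).
Proof.
move=> n0 nN; set B := embed @` _.
have nR : (0 < n%:R :> R)%R by rewrite ltr0n.
apply: (@lt_le_trans _ _ ((n%:R^-1 ^+ n)%:E)).
  by rewrite lte_fin exprn_gt0// invr_gt0.
apply: (@le_trans _ _ (hausdorff_content n 1 B)); last first.
  by apply: ereal_sup_ubound; exists 1%R => //=.
apply: le_ereal_inf_tmp => _ [U [BU U1] <-].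
have Ufin k : diam (U k) \is a fin_num.
  by rewrite ge0_fin_numE ?diam_ge0//; exact: le_lt_trans (U1 k) (ltry _).
pose d k := fine (diam (U k)).
have d0 k : (0 <= d k)%R by rewrite fine_ge0// diam_ge0.
have box k : exists c : nat -> R, forall x : 'rV[R]_n, U k (embed x) ->
    row_box c (d k) x.
  have [[y Uy]|none] := pselect (exists y : 'rV[R]_n, U k (embed y)).
    exists (fun i => if insub i is Some l then y 0%R l else 0%R) => x Ux i.
    rewrite valK; have := ler_coord_enorm (x - y) i; rewrite !mxE => /le_trans; apply.
    rewrite -(enorm_embed nN) -embedB -lee_fin /d fineK//; exact: diam_ub.
  by exists (fun=> 0%R) => x Ux; exfalso; apply: none; exists x.
have [c cP] := boolp.choice box.
have cover : row_box (n := n) (fun=> 0%R) n%:R^-1 `<=`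
    \bigcup_k row_box (c k) (d k).
  move=> x xb; have : B (embed x).
    exists x => //; rewrite /eball/= subr0.
    have := @enorm_le_coord R n x n%:R^-1; rewrite divff ?gt_eqF//; apply.
      by rewrite invr_ge0.
    by move=> i; have := xb i; rewrite subr0.
  by move=> /BU[k _ Uk]; exists k => //; exact: cP.
have : @lebesgue_row R n (row_box (fun=> 0%R) n%:R^-1) <=
    \sum_(k <oo) @lebesgue_row R n (row_box (c k) (d k)).
  apply: (@measure_sigma_subadditive _ _ _ (@lebesgue_row R n)) cover.
    by move=> k; exact: measurable_row_box.
  exact: measurable_row_box.
rewrite lebesgue_row_box ?invr_ge0//.
have -> : \sum_(k <oo) @lebesgue_row R n (row_box (c k) (d k)) =
    (2 ^+ n)%:E * \sum_(k <oo) diam (U k) ^+ n.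
  rewrite -nneseriesZl => [|k _]; last by rewrite expe_ge0// diam_ge0.
  apply: eq_eseriesr => k _; rewrite lebesgue_row_box// exprMn EFinM; congr (_ * _).
  by rewrite EFin_expe /d fineK.
by rewrite exprMn EFinM lee_pmul2l// lte_fin exprn_gt0.
Qed.

Lemma hausdorff_lt_oo n N (A : set 'rV[R]_N) : (0 < n)%N -> (n <= N)%N ->
  hausdorff_unnormalized n A < +oo -> hausdorff n A < +oo.
Proof.
move=> n0 nN Aoo; rewrite /hausdorff.
have := hausdorff_unit_ball_gt0 n0 nN; set H := hausdorff_unnormalized n _ => H0.
have l0 : 0 <= @lebesgue_row R n (eball 0 1) by exact: measure_ge0.
have lfin : @lebesgue_row R n (eball 0 1) \is a fin_num.
  by rewrite ge0_fin_numE// lebesgue_unit_ball_fin.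
have [c c0 ->] : exists2 c : R, (0 <= c)%R & H^-1 = c%:E.
  case: H H0 => [r| |//]; last by exists 0%R; rewrite ?invey.
  by rewrite lte_fin => r0; exists r^-1%R; rewrite ?invr_ge0 ?ltW// inver gt_eqF.
have Afin : hausdorff_unnormalized n A \is a fin_num.
  by rewrite ge0_fin_numE// hausdorff_unnormalized_ge0.
by rewrite -(fineK lfin) -(fineK Afin) -!EFinM ltry.
Qed.

Lemma hausdorff_set0 n N : (0 < n)%N -> hausdorff n (set0 : set 'rV[R]_N) = 0.
Proof. by move=> n0; rewrite /hausdorff hausdorff_unnormalized0// mule0. Qed.

End Boxes.

(** * The theorem *)

Lemma le_sqrt_mul {R : realType} (M a b : R) : 0 <= M -> 0 <= a -> 0 <= b ->
  a ^+ 2 <= M * b ^+ 2 -> a <= Num.sqrt M * b.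
Proof.
move=> M0 a0 b0 ab; rewrite -(@ler_pXn2r _ 2)// ?nnegrE ?mulr_ge0 ?sqrtr_ge0//.
by rewrite exprMn sqr_sqrtr.
Qed.

Section Charts.
Context {R : realType} {n N : nat}.
Variable f g : 'rV[R]_N -> 'rV[R]_N.
Hypotheses (nN : (1 <= n <= N - 1)%N) (f_cont : continuous f).
Hypotheses (fK : cancel f g) (gK : cancel g f) (g_cont : continuous g).
Hypothesis dini : forall x0 : 'rV[R]_n, (dini_sup f x0 < +oo)%E.

Let phi (x : 'rV[R]_n) : 'rV[R]_N := f (embed x).

Let nN' : (n <= N)%N. Proof. lia. Qed.

Let M_gt0 A : 0 < @flattening_const R n N A.
Proof. by rewrite /flattening_const mulr_gt0// expR_gt0. Qed.

Lemma near_preimage (x0 : 'rV[R]_n) (delta : R) : 0 < delta ->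
  exists2 rho : R, 0 < rho & forall x : 'rV[R]_n,
    eball (phi x0) rho (phi x) -> eball x0 delta x.
Proof.
move=> d0; have : nbhs (phi x0) (g @^-1` eball (embed x0) delta).
  by apply: g_cont; rewrite fK; exact: nbhs_eball.
move=> /nbhs_eballP[rho r0 sub]; exists rho => // x /sub.
by rewrite /eball /= fK embedB (enorm_embed nN').
Qed.

Lemma local_chart (x0 : 'rV[R]_n) :
  exists (rho c : R) (h : 'rV[R]_N -> 'rV[R]_n),
  [/\ 0 < rho, 0 < c &
    forall p q : 'rV[R]_N,
      (range phi `&` eball (phi x0) rho) p ->
      (range phi `&` eball (phi x0) rho) q ->
      c * enorm (p - q) <= enorm (h p - h q)
        <= flattening_const (n := n) (N := N) (fine (dini_sup f x0)) * c
             * enorm (p - q)].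
Proof.
have [delta d0 [G HG]] := flattening (can_inj fK) nN (dini x0).
set M := flattening_const _; have M0 : 0 < M := M_gt0 _.
have s0 : 0 < Num.sqrt M by rewrite sqrtr_gt0.
have [rho r0 near] := near_preimage x0 d0.
pose h (p : 'rV[R]_N) := G (\row_l g p 0 (widen_ord nN' l)).
have hE x : h (phi x) = G x.
  by congr G; apply/rowP => l; rewrite mxE fK (embed_lt nN').
exists rho, (Num.sqrt M)^-1, h; split=> //; first by rewrite invr_gt0.
move=> _ _ [[x _ <-] /near xd] [[y _ <-] /near yd]; rewrite !hE.
have [h1 h2] := HG x y xd yd.
have sM : M * (Num.sqrt M)^-1 = Num.sqrt M.
  by rewrite -{1}(sqr_sqrtr (ltW M0)) expr2 mulfK// gt_eqF.
apply/andP; split.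
  by rewrite ler_pdivrMl//; apply: le_sqrt_mul h1; rewrite ?enorm_ge0// ltW.
by rewrite sM; apply: le_sqrt_mul h2; rewrite ?enorm_ge0// ltW.
Qed.

Lemma local_cube_cover (x0 : 'rV[R]_n) : exists2 delta : R, 0 < delta &
  @cube_covered R n N (phi @` eball x0 delta).
Proof.
have [delta1 d1 [G HG]] := flattening (can_inj fK) nN (dini x0).
set M := flattening_const _ in HG; have M0 : 0 < M := M_gt0 _.
have : nbhs (embed x0 : 'rV[R]_N) (f @^-1` eball (phi x0) 1).
  by apply: f_cont; exact: nbhs_eball.
move=> /nbhs_eballP[delta2 d2 sub].
pose delta := Num.min delta1 delta2; have d0 : 0 < delta by rewrite lt_min d1.
have s1 x : eball x0 delta x -> eball x0 delta1 x.
  by move=> /= h; apply: le_trans h _; rewrite ge_min lexx.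
have s2 x : eball x0 delta x -> enorm (phi x - phi x0) <= 1.
  move=> /= h; apply: (sub (embed x)).
  rewrite /eball /= embedB (enorm_embed nN'); apply: le_trans h _.
  by rewrite ge_min lexx orbT.
have x0d : eball x0 delta x0 by exact/eball_center/ltW.
exists delta => //; apply: (@lipschitz_cube R _ n N (eball x0 delta) G phi (Num.sqrt M) _ _
  (enorm (G x0) + Num.sqrt M)); first exact: sqrtr_ge0.
- move=> x y xd yd; have [h1 _] := HG x y (s1 x xd) (s1 y yd).
  by apply: le_sqrt_mul h1; rewrite ?enorm_ge0// ltW.
- by exists x0.
move=> x xd; have [_ h2] := HG x x0 (s1 x xd) (s1 x0 x0d).
have h3 := le_sqrt_mul (ltW M0) (enorm_ge0 _) (enorm_ge0 _) h2.
have := ler_wpM2l (sqrtr_ge0 M) (s2 x xd).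
have := ler_enorm_dist (G x) (G x0) 0; rewrite !subr0 /phi; lra.
Qed.

(** Around a point [f z] with [z] outside the plane, the image of the plane is
    empty, because the plane is closed and the inverse is continuous. *)
Lemma image_locally_finite : hausdorff_locally_finite n (range phi).
Proof.
have n0 : (0 < n)%N by lia.
move=> p; rewrite -(gK p); set z := g p.
have [[x0 zx]|out] := pselect (exists x0 : 'rV[R]_n, z = embed x0).
  have [delta d0 cov] := local_cube_cover x0.
  have [rho r0 near] := near_preimage x0 d0; exists rho => //.
  apply: hausdorff_lt_oo => //; apply: cube_covered_finite => //.
  have [F [FM FA]] := cov; exists F; split=> // q [[x _ <-] qr].
  by apply: FA; exists x => //; apply: near; move: qr; rewrite zx.
have [k nk zk] : exists2 k : 'I_N, (n <= k)%N & z 0 k != 0.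
  apply: contrapT => none; apply: out; apply: (parallel_embedP nN' (x := 0)).
  move=> k nk; apply/eqP; rewrite mxE [X in _ + X]mxE embed_ge// oppr0 addr0.
  by apply: contrapT => zk; apply: none; exists k => //; exact/negP.
have zk0 : 0 < `|z 0 k| / 2 by rewrite divr_gt0 ?normr_gt0.
have : nbhs (f z) (g @^-1` eball z (`|z 0 k| / 2)).
  by apply: g_cont; rewrite fK; exact: nbhs_eball.
move=> /nbhs_eballP[rho r0 sub]; exists rho => //.
rewrite (_ : _ `&` _ = set0) ?hausdorff_set0 ?ltry//.
rewrite -subset0 => q [[x _ <-] /sub]; rewrite /eball /= fK => h.
have := le_trans (ler_coord_enorm _ k) h.
by rewrite mxE [X in _ + X]mxE embed_ge// add0r normrN; lra.
Qed.

Lemma image_rectifiable : rectifiable n (range phi).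
Proof.
have n0 : (0 < n)%N by lia.
have [F [FM Fc]] := rectifiable_of_local n0 local_cube_cover.
exists F; split=> //; rewrite (_ : _ `\` _ = set0) ?hausdorff_set0//.
by rewrite setD_eq0.
Qed.

End Charts.

Theorem theorem1p3 (R : realType) :
  exists L : nat -> nat -> R -> R,
  forall (n N : nat) (f : 'rV[R]_N -> 'rV[R]_N),
    (1 <= n <= N - 1)%N ->
    quasiconformal_homeo f ->
    (forall x0 : 'rV[R]_n, (dini_sup f x0 < +oo)%E) ->
    let fRn : set 'rV[R]_N := range (fun x : 'rV[R]_n => f (embed x)) in
    [/\ forall x0 : 'rV[R]_n,
          exists (rho c : R) (h : 'rV[R]_N -> 'rV[R]_n),
          [/\ 0 < rho, 0 < c &
            forall p q : 'rV[R]_N,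
              (fRn `&` eball (f (embed x0)) rho) p ->
              (fRn `&` eball (f (embed x0)) rho) q ->
              c * enorm (p - q) <= enorm (h p - h q)
                <= L n N (fine (dini_sup f x0)) * c * enorm (p - q)],
        rectifiable n fRn &
        hausdorff_locally_finite n fRn].
Proof.
exists (fun n N A => flattening_const (n := n) (N := N) A).
move=> n N f nN /quasiconformal_homeo_inverse[fc [g [fK gK gc]]] dini fRn; split.
- exact: local_chart nN fK gc dini.
- exact: image_rectifiable nN fc fK dini.
exact: image_locally_finite nN fc fK gK gc dini.
Qed.
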